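(* Let $f:[0,\infty)\to\mathbb{R}$ be such that $V(x)=f\big(\frac{|x|^2}{2}\big)$, $x\in\mathbb{R}^n$, with $f$ smooth and $V$ bounded above. For $\varepsilon>0$ let $L_\varepsilon(x,v)=\frac12|v|^2-\varepsilon V(x)$ on $T\mathbb{R}^n$, with cost $$c_\varepsilon(x,y)=\inf\int_0^1L_\varepsilon(\gamma(t),\dot\gamma(t))\,dt,$$ the infimum being over all smooth curves $\gamma:[0,1]\to\mathbb{R}^n$ with $\gamma(0)=x$, $\gamma(1)=y$. For each $\varepsilon>0$ let $\mathcal U_\varepsilon$ be an open subset of $T\mathbb{R}^n$ all of whose elements are regular and outside the conjugate locus (for $L_\varepsilon$). Let $\mathcal U$ be a bounded open subset of $T\mathbb{R}^n$ such that, for some constant $C>0$, $$f''\Big(\tfrac{|x+tv|^2}{2}\Big)\ge C>0,\qquad f'''\Big(\tfrac{|x+tv|^2}{2}\Big)\ge0,\qquad f^{(4)}\Big(\tfrac{|x+tv|^2}{2}\Big)\ge0$$ for all $t\in[0,1]$ and all $(x,v)\in\mathcal U$. Then for all small enough $\varepsilon>0$ the cost $c_\varepsilon$ satisfies the strong Ma-Trudinger-Wang condition (A3s) on the set $$\mathcal K_\varepsilon=\{(x,\Phi_1^\varepsilon(x,\alpha)):(x,\alpha)\in\mathcal U_\varepsilon\cap\mathcal U\}.$$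
   Context: Tangent and cotangent spaces of $\mathbb{R}^n$ are identified by the Euclidean inner product. Let $H_\varepsilon(x,v)=\frac12|v|^2+\varepsilon V(x)$ be the Hamiltonian of $L_\varepsilon$, $e^{t\vec H_\varepsilon}$ its Hamiltonian flow (where defined), $\pi(x,\alpha)=x$, and $\Phi_t^\varepsilon(x,\alpha)=\pi(e^{t\vec H_\varepsilon}(x,\alpha))$. An element $(x,\alpha)$ is regular if $t\in[0,1]\mapsto\Phi_t^\varepsilon(x,\alpha)$ is the unique path attaining the infimum defining $c_\varepsilon$ between its endpoints; it is in the conjugate locus if the map $\Phi_1^\varepsilon(x,\cdot)$ does not have full rank at $\alpha$. On $\mathcal K_\varepsilon$ the cost $c=c_\varepsilon$ is smooth. For $(x,\alpha)\in\mathcal U_\varepsilon\cap\mathcal U$, the $c$-exponential $\exp^c(x,\alpha)$ is the point $y$ with $(x,y)\in\mathcal K_\varepsilon$ and $d_xc(x,y)=-\alpha$. The cross-curvature is $$\mathcal C_x(u,\alpha,\alpha_1)=-\frac32\,\partial_s^2\partial_t^2\,c\big(\gamma(t),\exp^c(x,\alpha+s\alpha_1)\big)\Big|_{t=s=0},\quad (x,\alpha)\in\mathcal U_\varepsilon\cap\mathcal U,\ u\in T_x\mathbb{R}^n,\ \alpha_1\in T_x^*\mathbb{R}^n,$$ where $\gamma$ is any curve with $\gamma(0)=x$, $\dot\gamma(0)=u$. The cost satisfies the strong MTW condition (A3s) on $\mathcal K_\varepsilon$ if, for all such arguments with $\alpha_1(u)=0$, one has $\mathcal C_x(u,\alpha,\alpha_1)\ge0$,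 with equality only if $u=0$ or $\alpha_1=0$. *)

(* Defs.v *)
From HB Require Import structures.
From mathcomp Require Import all_boot all_order all_algebra.
From mathcomp Require Import all_classical all_reals all_analysis.

Set Implicit Arguments.
Unset Strict Implicit.
Unset Printing Implicit Defensive.

Import Order.TTheory GRing.Theory Num.Theory.
Import numFieldNormedType.Exports.

Local Open Scope classical_set_scope.
Local Open Scope ring_scope.

(* The norm carried by 'rV[R]_n in the library is the sup norm; it is used only
   for topology, differentiability and boundedness.  Lengths and the
   identification of tangent and cotangent vectors use [dot]. *)
Definition dot (R : realType) (n : nat) (u v : 'rV[R]_n) : R :=
  \sum_i u 0 i * v 0 i.

Definition grad (R : realType) (n : nat) (F : 'rV[R]_n -> R) (x : 'rV[R]_n) :
    'rV[R]_n :=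
  \row_i 'D_(delta_mx 0 i) F x.

Definition diff_quot (R : realType) (W : normedModType R) (g : R -> W)
    (x y : R) : W :=
  (y - x)^-1 *: (g y - g x).

(* Derivative relative to the domain [D]: one-sided at an endpoint of an
   interval that belongs to it, and insensitive to the values of [g] outside
   [D] at points of [D]. *)
Definition deriv_within (R : realType) (W : normedModType R) (D : set R)
    (g : R -> W) (x : R) : W :=
  lim (diff_quot g x @ within D x^').

Definition smooth_on (R : realType) (W : normedModType R) (D : set R)
    (g : R -> W) : Prop :=
  forall (k : nat) (x : R), D x ->
    cvg (diff_quot (iter k (deriv_within D) g) x @ within D x^').

Section mechanics.
Variables (R : realType) (n : nat).
Local Notation E := 'rV[R]_n.

Definition lagrangian (V : E -> R) (eps : R) (x v : E) : R :=
  2^-1 * dot v v - eps * V x.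

Definition hamiltonian (V : E -> R) (eps : R) (x v : E) : R :=
  2^-1 * dot v v + eps * V x.

Definition action (L : E -> E -> R) (g : R -> E) : R :=
  \int[lebesgue_measure]_(t in `[0, 1]) L (g t) (deriv_within `[0, 1] g t).

Definition smooth_path (x y : E) (g : R -> E) : Prop :=
  [/\ smooth_on `[0, 1] g, g 0 = x & g 1 = y].

Definition cost (L : E -> E -> R) (x y : E) : R :=
  inf [set action L g | g in smooth_path x y].

Definition ham_field (H : E -> E -> R) (z : E * E) : E * E :=
  (grad (H z.1) z.2, - grad (H^~ z.2) z.1).

(* [g] solves Hamilton's equations from [z] on an open interval containing 0
   and [t]. *)
Definition ham_curve (H : E -> E -> R) (z : E * E) (t : R) (g : R -> E * E) :
    Prop :=
  exists a b : R,
    [/\ a < 0 < b, a < t < b, g 0 = z &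
        forall s, a < s < b -> is_derive s 1 g (ham_field H (g s))].

Definition flow_defined (H : E -> E -> R) (t : R) (z : E * E) : Prop :=
  exists g, ham_curve H z t g.

(* The flow may be incomplete; the default value [z] is taken outside its
   domain [flow_defined]. *)
Definition ham_flow (H : E -> E -> R) (t : R) (z : E * E) : E * E :=
  xget z [set w | exists2 g, ham_curve H z t g & g t = w].

Definition Phi (V : E -> R) (eps t : R) (x a : E) : E :=
  (ham_flow (hamiltonian V eps) t (x, a)).1.

Definition regular (V : E -> R) (eps : R) (z : E * E) : Prop :=
  let L := lagrangian V eps in
  let p := fun t => Phi V eps t z.1 z.2 in
  [/\ flow_defined (hamiltonian V eps) 1 z,
      smooth_path z.1 (p 1) p,
      action L p = cost L z.1 (p 1) &
      forall g, smooth_path z.1 (p 1) g -> action L g = cost L z.1 (p 1) ->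
        {in `[0, 1], g =1 p}].

Definition conjugate_locus (V : E -> R) (eps : R) : set (E * E) :=
  [set z | \rank (jacobian (Phi V eps 1 z.1) z.2) <> n].

(* [d_x c (x, y) = - a] as linear forms. *)
Definition cost_diff_eq (c : E -> E -> R) (x y a : E) : Prop :=
  differentiable (c^~ y) x /\ forall u, 'd (c^~ y) x u = - dot a u.

Definition cexp (c : E -> E -> R) (K : set (E * E)) (x a : E) : E :=
  xget 0 [set y | K (x, y) /\ cost_diff_eq c x y a].

Definition curve_at (x u : E) (g : R -> E) : Prop :=
  [/\ exists2 d : R, 0 < d & smooth_on `]- d, d[ g, g 0 = x & is_derive (0 : R) 1 g u].

Definition cross_curvature (c : E -> E -> R) (K : set (E * E)) (x : E)
    (g : R -> E) (a a1 : E) : R :=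
  - (3 / 2) *
    derive1n 2 (fun s : R =>
      derive1n 2 (fun t : R => c (g t) (cexp c K x (a + s *: a1))) 0) 0.

(* [W] is the set of base points (x, alpha) at which the cross-curvature is
   taken, and [g] ranges over all curves with position [x] and velocity [u]. *)
Definition A3s (c : E -> E -> R) (W K : set (E * E)) : Prop :=
  forall x a u a1 g, W (x, a) -> curve_at x u g -> dot a1 u = 0 ->
    let C := cross_curvature c K x g a a1 in
    0 <= C /\ (C = 0 -> u = 0 \/ a1 = 0).

Definition Kset (V : E -> R) (eps : R) (W : set (E * E)) : set (E * E) :=
  [set (z.1, Phi V eps 1 z.1 z.2) | z in W].

End mechanics.

Definition radial_potential (R : realType) (n : nat) (f : R -> R)
    (x : 'rV[R]_n) : R :=
  f (dot x x / 2).

Definition hderiv (R : realType) (k : nat) (f : R -> R) : R -> R :=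
  iter k (deriv_within `[0, +oo[) f.

(* Main.v *)
Require Import Defs.
From HB Require Import structures.
From mathcomp Require Import all_boot all_order all_algebra.
From mathcomp Require Import all_classical all_reals all_analysis.
From mathcomp Require Import ring lra.

(** Small [eps] makes trajectories with bounded initial data perturbations of
    straight lines: they solve [X t = x + t a - eps (T (grad V o X)) t] with [T]
    the double integral, and this fixed-point equation is a contraction.  Hence
    trajectories depend differentiably on the data with uniform bounds, and
    [alpha |-> Phi_1 (x, alpha)] is locally invertible.  Comparing the cost from
    nearby base points along sheared minimizers gives [d_x c (x, y) = - alpha].

    With [y = exp^c (x, alpha)] fixed, [c (g t, y)] thus has second derivative
    [|u|^2 - eps <T (J Hess V (X)) 1, u> - <alpha, g'' 0>] at 0, where [J] is the
    Jacobi field along [X] with [J 0 = u] and [J 1 = 0].  For [alpha] moving along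
    [alpha + s alpha1], the first and last terms are affine in [s], and to leading
    order [J = (1 - t) u] and [X = x + t (alpha + s alpha1)].  The
    cross-curvature is therefore [3/2 eps] times the double integral over
    [0 <= r <= t <= 1] of
    [(1 - r) r^2 D^4 V (x + r alpha) (u, u, alpha1, alpha1)], up to
    [O(eps^2 |u|^2 |alpha1|^2)].  When [<alpha1, u> = 0], the assumptions on [f]
    bound that fourth derivative below by [C |u|^2 |alpha1|^2]. *)

Import Order.TTheory GRing.Theory Num.Theory.
Import numFieldNormedType.Exports.

Local Open Scope classical_set_scope.
Local Open Scope ring_scope.

Set Implicit Arguments.
Unset Strict Implicit.
Unset Printing Implicit Defensive.

(** * Linear identities in modules *)

(** The condition (A3s) concerns every [u] and [alpha1], while the threshold on [eps] may depend on
    neither. Errors must therefore be homogeneous in [u] and [alpha1], so these sizes are carried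
    through all estimates together with the powers of [eps]; the constants depend only on [n], [f]
    and a bound for [U].

    The cost is only an infimum, so its gradient is squeezed. The sheared curve bounds the cost at
    [x + v] from above; the same bound based at [x + v] and shifted by [- v] is the bound from
    below. The two agree to second order because the covectors reaching one endpoint are Lipschitz
    in the base point.

    Since the gradient is exactly [- alpha], the second derivative of the cost takes only one
    derivative of [alpha] in the base point. At time 1 the trajectory equation can be solved for
    [alpha]; substituting turns the initial value problem into a two-point problem, still a
    contraction, whose derivative is [J].

    Differentiability of families of paths is expressed by remainders [O(h^2)] uniform in time.
    These pass through products, integrals and contraction fixed points by elementary estimates. *)

Section linear_identities.
Variables (R : nzRingType) (V : lmodType R).

Inductive lexp :=
  LAtom of nat | LZero | LAdd of lexp & lexp | LOpp of lexp | LScale of R &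
    lexp.

Fixpoint leval (env : seq V) (e : lexp) : V :=
  match e with
  | LAtom i => nth 0 env i
  | LZero => 0
  | LAdd a b => leval env a + leval env b
  | LOpp a => - leval env a
  | LScale k a => k *: leval env a
  end.

Fixpoint lcoef (i : nat) (e : lexp) : R :=
  match e with
  | LAtom j => if Nat.eqb j i then 1 else 0
  | LZero => 0
  | LAdd a b => lcoef i a + lcoef i b
  | LOpp a => - lcoef i a
  | LScale k a => k * lcoef i a
  end.

(** Recursion on a numeral, so that [cbn] leaves one ring equation per atom. [Nat.eqb] in [lcoef]
    has the same purpose: it reduces on closed indices. *)
Fixpoint all_below (n : nat) (P : nat -> Prop) : Prop :=
  match n with 0 => True | m.+1 => P m /\ all_below m P end.

Lemma levalE env e : leval env e = \sum_(i < size env) lcoef i e *: nth 0 env i.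
Proof.
elim: e => [j||a IHa b IHb|a IHa|k a IHa] /=.
- have E i : Nat.eqb j i = (j == i) by elim: j i => [|j IH] [|i] //=;
  rewrite IH eqSS.
  have [jlt|jge] := ltnP j (size env).
    rewrite (bigD1 (Ordinal jlt))//= E eqxx scale1r big1 ?addr0// => i ij.
    rewrite E ifN ?scale0r//; apply: contra ij => /eqP ji.
    by apply/eqP/val_inj.
  rewrite nth_default// big1// => i _; rewrite E ifN ?scale0r//.
  by apply: contraTneq (ltn_ord i) => <-; rewrite -leqNgt.
- by rewrite big1// => i _; rewrite scale0r.
- by rewrite IHa IHb -big_split; apply: eq_bigr => i _; rewrite scalerDl.
- by rewrite IHa -sumrN; apply: eq_bigr => i _; rewrite scaleNr.
- by rewrite IHa scaler_sumr; apply: eq_bigr => i _; rewrite scalerA.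
Qed.

Lemma leval_eq env a b :
  all_below (size env) (fun i => lcoef i a = lcoef i b) ->
  leval env a = leval env b.
Proof.
move=> H; rewrite !levalE; apply: eq_bigr => -[i /= ilt] _; congr (_ *: _).
by move: ilt H; elim: (size env) => // m IH; rewrite ltnS leq_eqVlt =>
  /orP[/eqP->[]|/IH{}IH [_ /IH]].
Qed.

End linear_identities.

Ltac lmod_index same x l :=
  lazymatch l with
  | ?y :: ?l' =>
      match goal with
      | _ => let _ := match goal with _ => same x y end in constr:(O)
      | _ => let k := lmod_index same x l' in constr:(S k)
      end
  end.

Ltac lmod_mem same x l :=
  lazymatch l with
  | ?y :: ?l' =>
      match goal with
      | _ => let _ := match goal with _ => same x y end in constr:(true)
      | _ => lmod_mem same x l'
      end
  | _ => constr:(false)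
  end.

Ltac lmod_atoms same t l :=
  lazymatch t with
  | (?a + ?b)%R => let l1 := lmod_atoms same a l in lmod_atoms same b l1
  | (- ?a)%R => lmod_atoms same a l
  | (_ *: ?a)%R => lmod_atoms same a l
  | 0%R => l
  | _ => lazymatch lmod_mem same t l with
         | true => l
         | _ => constr:(t :: l)
         end
  end.

Ltac lmod_reify same R t l :=
  lazymatch t with
  | (?a + ?b)%R =>
      let a' := lmod_reify same R a l in let b' := lmod_reify same R b l in
      constr:(@LAdd R a' b')
  | (- ?a)%R => let a' := lmod_reify same R a l in constr:(@LOpp R a')
  | (?k *: ?a)%R => let a' := lmod_reify same R a l in constr:(@LScale R k a')
  | 0%R => constr:(@LZero R)
  | _ => let i := lmod_index same t l in constr:(@LAtom R i)
  end.

Ltac lmod_with same R V :=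
  lazymatch goal with
  | |- ?a = ?b =>
      let l := lmod_atoms same a constr:(@nil V) in
      let l := lmod_atoms same b l in
      let a' := lmod_reify same R a l in
      let b' := lmod_reify same R b l in
      refine (@leval_eq R V l a' b' _);
      cbn [all_below size lcoef Nat.eqb]; repeat split;
      first [ring | field]
  end.

(* Proves an identity between linear combinations in a module by comparing the
   coefficients of each atom.  If this fails, atoms are compared up to
   conversion: one operation may be inferred along different instance paths. *)
Ltac lmod R V :=
  first [ lmod_with ltac:(fun x y => constr_eq x y) R V
        | lmod_with ltac:(fun x y => unify x y) R V ].

(** Row vectors as a complete normed module: needed for the Cauchy argument on difference quotients
    of paths and for the Banach fixed point theorem. *)
HB.instance Definition _ (R : realType) (m n : nat) := Complete.on 'M[R]_(m, n).

(** * Derivatives and continuity in epsilon-delta form *)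

Section eps_delta.
Context {R : realType} {W : normedModType R}.

(** Clearing the denominator includes the increment 0 and leaves an inequality that is stable under
    linear combinations. *)
Lemma is_derive_eps (g : R -> W) (t : R) (v : W) :
  is_derive t 1 g v <->
  forall e : R, 0 < e -> exists2 d : R, 0 < d &
    forall h : R, `|h| < d -> `|g (t + h) - g t - h *: v| <= e * `|h|.
Proof.
have E (h : R) : h != 0 ->
    `|v - h^-1 *: (g (h *: 1 + t) - g t)| * `|h| = `|g (t + h) - g t - h *: v|.
  move=> h0; rewrite mulrC -normrZ scalerBr scalerA divff// scale1r.
  by rewrite -normrN opprB [h *: 1]mulr1 (addrC h t).
split=> [[dg gv] e e0|H].
- have : h^-1 *: ((g \o shift t) (h *: 1) - g t) @[h --> 0^'] --> v.
    by rewrite -gv; exact: dg.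
  move=> /cvgrPdist_le/(_ _ e0); rewrite near_withinE/=.
  move=> /nbhs_ballP[d /= d0 dP]; exists d => // h hd.
  have [->|h0] := eqVneq h 0.
    by rewrite addr0 subrr scale0r subr0 !normr0 mulr0.
  rewrite -E// ler_wpM2r//; apply: dP => //=.
  by rewrite /ball/= sub0r normrN.
- have cg : h^-1 *: ((g \o shift t) (h *: 1) - g t) @[h --> 0^'] --> v.
    apply/cvgrPdist_le => e /H[d d0 dP]; rewrite near_withinE/=.
    apply/nbhs_ballP; exists d => //= h; rewrite /ball/= sub0r normrN => hd h0.
    by rewrite -(@ler_pM2r _ `|h|) ?normr_gt0// E//; exact: dP.
  split; first by apply/cvg_ex; exists v.
  exact: cvg_lim cg.
Qed.

Lemma continuousP_eps (g : R -> W) (t : R) :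
  {for t, continuous g} <->
  forall e : R, 0 < e -> exists2 d : R, 0 < d &
    forall h : R, `|h| < d -> `|g (t + h) - g t| <= e.
Proof.
split=> [/cvgrPdist_le H e /H/nbhs_ballP[d /= d0 dP]|H].
  exists d => // h hd; rewrite distrC; apply: dP.
  by rewrite /ball/= opprD addrA subrr sub0r normrN.
apply/cvgrPdist_le => e /H[d d0 dP]; apply/nbhs_ballP; exists d => //= s.
rewrite /ball/= distrC => std; rewrite distrC.
by have := dP _ std; rewrite (_ : t + (s - t) = s) 1?addrC ?subrK.
Qed.

Lemma is_derive_unique (g : R -> W) (t : R) (v w : W) :
  is_derive t 1 g v -> is_derive t 1 g w -> v = w.
Proof. by move=> [_ <-] [_ <-]. Qed.

End eps_delta.

(* A bounded quantity that halves its own bound up to [A]: the form in which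
   contraction estimates in the sup norm are used. *)
Lemma bound_of_self_improvement (R : realType) (T : Type) (w : T -> R) (A : R) :
  (exists B, forall t, w t <= B) ->
  (forall B, 0 <= B -> (forall t, w t <= B) -> forall t, w t <= A + B / 2) ->
  (forall t, 0 <= w t) -> forall t, w t <= 2 * A.
Proof.
move=> [B0 wB0] H w0 t0.
pose S := range w.
have S0 : S !=set0 by exists (w t0), t0.
have ubS : has_ubound S by exists B0 => _ [t _ <-].
have supS : has_sup S by split.
have wS t : w t <= sup S by apply: ub_le_sup => //; exists t.
have S_ge0 : 0 <= sup S by apply: le_trans (w0 t0) (wS t0).
have : sup S <= A + sup S / 2.
  by apply: ge_sup => // _ [t _ <-]; exact: H.
by move=> SA; apply: (le_trans (wS t0)); lra.
Qed.

(** * Integrals of continuous functions over [0, 1] *)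

Section integral_operator.
Context {R : realType}.
Implicit Types (w v : R -> R) (t : R).
Local Notation mu := (@lebesgue_measure R).

(** Retraction onto [[0, 1]]. Paths on [[0, 1]] become total functions that are constant outside, so
    that continuity is global and sup bounds run over all of [R]. *)
Definition clamp t : R := Num.max 0 (Num.min 1 t).

Lemma clamp_itv t : 0 <= clamp t <= 1.
Proof. by rewrite /clamp le_max lexx ge_max ler01 ge_min lexx. Qed.

Lemma clamp_id t : 0 <= t <= 1 -> clamp t = t.
Proof. by move=> /andP[t0 t1]; rewrite /clamp min_r// max_r. Qed.

Lemma clampK t : clamp (clamp t) = clamp t.
Proof. by rewrite clamp_id ?clamp_itv. Qed.

Lemma clamp0 : clamp 0 = 0. Proof. by rewrite clamp_id// lexx ler01. Qed.
Lemma clamp1 : clamp 1 = 1. Proof. by rewrite clamp_id// lexx ler01. Qed.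

Lemma norm_clamp t : `|clamp t| <= 1.
Proof. by have /andP[t0 t1] := clamp_itv t; rewrite ger0_norm. Qed.

Lemma clamp_lip s t : `|clamp s - clamp t| <= `|s - t|.
Proof.
wlog st : s t / s <= t => [H|].
  have [/H//|/ltW/H] := leP s t; by rewrite distrC (distrC t).
rewrite distrC (distrC s) [leRHS]ger0_norm ?subr_ge0//.
rewrite /clamp /Num.max /Num.min.
by repeat case: ifPn; rewrite -?leNgt => *; rewrite ?subrr ?normr0 ?subr_ge0//;
  rewrite ger0_norm; lra.
Qed.

Lemma continuous_clamp : continuous clamp.
Proof.
move=> t; apply/continuousP_eps => e e0; exists e => // h hd.
by apply: le_trans (clamp_lip _ _) _; rewrite (addrC t) addrK ltW.
Qed.

Definition I w t := \int[mu]_(s in `[0, clamp t]) w s.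

Lemma integrable_continuous w (a b : R) : continuous w ->
  mu.-integrable `[a, b] (EFin \o w).
Proof.
move=> cw; apply: continuous_compact_integrable; first exact: segment_compact.
exact: continuous_subspaceT.
Qed.

Lemma I_clamp w t : I w (clamp t) = I w t.
Proof. by rewrite /I clampK. Qed.

Lemma eq_I w v t : (forall s : R, 0 <= s <= 1 -> w s = v s) -> I w t = I v t.
Proof.
move=> wv; apply: eq_Rintegral => s; rewrite inE/= in_itv/= => /andP[s0 st].
by apply: wv; rewrite s0 (le_trans st)//; have /andP[] := clamp_itv t.
Qed.

Lemma I_lin (a : R) w v t : continuous w -> continuous v ->
  I (fun s => a * w s + v s) t = a * I w t + I v t.
Proof.
move=> cw cv; rewrite /I RintegralD//.
- by rewrite RintegralZl//; exact: integrable_continuous.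
- by apply: integrable_continuous => x; apply: cvgM; [exact: cvg_cst|exact: cw].
- exact: integrable_continuous.
Qed.

Lemma I_le w v t : continuous w -> continuous v ->
  (forall s : R, 0 <= s <= 1 -> w s <= v s) -> I w t <= I v t.
Proof.
move=> cw cv wv; apply: le_Rintegral => //; try exact: integrable_continuous.
move=> s; rewrite /= in_itv/= => /andP[s0 st].
by apply: wv; rewrite s0 (le_trans st)//; have /andP[] := clamp_itv t.
Qed.

Lemma Rintegral_cst_itv (B a b : R) (c : bool) : a <= b ->
  \int[mu]_(_ in [set` Interval (BSide c a) (BRight b)]) B = B * (b - a).
Proof.
move=> ab; rewrite Rintegral_cst//; congr (_ * _).
rewrite [X in fine X](lebesgue_measure_itv (Interval (BSide c a) (BRight b))).
rewrite /= lte_fin.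
by case: ltP => [_|H] //=; lra.
Qed.

Lemma I_cst (a : R) t : I (fun=> a) t = a * clamp t.
Proof.
by rewrite /I Rintegral_cst_itv ?subr0//; have /andP[] := clamp_itv t.
Qed.

Lemma I_bound w (B : R) t : continuous w ->
  (forall s : R, 0 <= s <= 1 -> `|w s| <= B) -> `|I w t| <= B.
Proof.
move=> cw wB; have /andP[t0 t1] := clamp_itv t.
have B0 : 0 <= B by apply: le_trans (wB 0 _); rewrite ?lexx ?ler01.
have cc (a : R) : continuous (fun _ : R => a) by move=> x; exact: cvg_cst.
rewrite ler_norml; apply/andP; split.
  apply: (@le_trans _ _ (I (fun=> - B) t)).
    by rewrite I_cst mulNr lerN2 ler_piMr.
  by apply: I_le => // s /wB; rewrite ler_norml => /andP[].
apply: (@le_trans _ _ (I (fun=> B) t)); last by rewrite I_cst ler_piMr.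
by apply: I_le => // s /wB; rewrite ler_norml => /andP[].
Qed.

Lemma I_FTC (F w : R -> R) (t : R) : continuous w ->
  (forall s : R, 0 <= s <= 1 -> is_derive s 1 F (w s)) ->
  I w t = F (clamp t) - F 0.
Proof.
move=> cw Fw; have /andP[t0 t1] := clamp_itv t.
rewrite /I; move: t0 t1; set T := clamp t.
(* The fundamental theorem is applied on a nondegenerate interval; when the upper limit is 0 both
   sides vanish. *)
rewrite le_eqVlt => /orP[/eqP<- _|T0 T1].
  by rewrite set_itv1 Rintegral_set1 subrr.
have Fc s : 0 <= s <= 1 -> {for s, continuous F}.
  by move=> /Fw[dF _]; exact/differentiable_continuous/derivable1_diffP.
rewrite /Rintegral (@continuous_FTC2 _ w F)//.
- exact: continuous_subspaceT.
- split.
  + move=> s; rewrite in_itv/= => /andP[s0 sT].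
    by have [|] := Fw s _ => //; rewrite ltW//= ltW// (lt_le_trans sT).
  + by apply: cvg_at_right_filter; apply: Fc; rewrite lexx ler01.
  + by apply: cvg_at_left_filter; apply: Fc; rewrite ltW.
- move=> s; rewrite in_itv/= => /andP[s0 sT]; rewrite derive1E.
  by have [|] := Fw s _ => //; rewrite ltW//= ltW// (lt_le_trans sT).
Qed.

Lemma I_lip w (B : R) s t : continuous w ->
  (forall r : R, 0 <= r <= 1 -> `|w r| <= B) -> `|I w s - I w t| <=
    B * `|s - t|.
Proof.
move=> cw wB.
have B0 : 0 <= B by apply: le_trans (wB 0 _); rewrite ?lexx ?ler01.
suff H : `|I w s - I w t| <= B * `|clamp s - clamp t|.
  by apply: (le_trans H); rewrite ler_wpM2l// clamp_lip.
wlog st : s t / clamp s <= clamp t => [H|].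
  have [/H//|/ltW/H] := leP (clamp s) (clamp t);
    by rewrite distrC (distrC (clamp t)).
have /andP[s0 s1] := clamp_itv s; have /andP[t0 t1] := clamp_itv t.
have iw : mu.-integrable `[0, clamp t] (EFin \o w) by exact:
  integrable_continuous.
rewrite distrC /I (@Rintegral_itvB _ w (BLeft 0) (BRight (clamp t)) (clamp
  s))//; last first.
rewrite distrC (ger0_norm (x := clamp t - _)) ?subr_ge0//.
apply: le_trans (le_normr_Rintegral _ _) _ => //=.
  by apply: (integrableS _ _ _ iw) => //; move=> x /=; rewrite !in_itv/= =>
    /andP[sx ->]; rewrite ltW// (le_lt_trans s0).
apply: (@le_trans _ _ (\int[mu]_(x in `]clamp s, clamp t]) B)).
  apply: le_Rintegral => //=.
  - apply: (integrableS _ _ _ (@integrable_continuous (fun x =>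
    `|w x|) 0 (clamp t) _)) => //.
      by move=> x /=; rewrite !in_itv/= => /andP[sx ->];
        rewrite ltW// (le_lt_trans s0).
    by move=> x; apply: cvg_norm; exact: cw.
  - apply: (integrableS _ _ _ (@integrable_continuous (fun x =>
    B) 0 (clamp t) _)) => //.
      by move=> x /=; rewrite !in_itv/= => /andP[sx ->];
        rewrite ltW// (le_lt_trans s0).
    by move=> x; exact: cvg_cst.
  - move=> x; rewrite /= in_itv/= => /andP[sx xt]; apply: wB.
    by rewrite ltW/= ?(le_trans xt)// (le_lt_trans s0).
by rewrite Rintegral_cst_itv.
Qed.

Lemma continuous_bounded01 w : continuous w ->
  exists B, forall r : R, 0 <= r <= 1 -> `|w r| <= B.
Proof.
move=> cw.
have [|r _ rP] := @EVT_max R (fun x => `|w x|) 0 1 ler01.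
  by apply: continuous_subspaceT => x; apply: cvg_norm; exact: cw.
by exists `|w r| => s s01; apply: rP; rewrite in_itv.
Qed.

Lemma continuous_I w : continuous w -> continuous (I w).
Proof.
move=> cw; have [B wB] := continuous_bounded01 cw.
have B0 : 0 <= B by apply: le_trans (wB 0 _); rewrite ?lexx ?ler01.
move=> t; apply/continuousP_eps => e e0; exists (e / (B + 1)).
  by rewrite divr_gt0// ltr_wpDl.
move=> h hd; apply: le_trans (I_lip _ _ cw wB) _.
rewrite (addrC t) addrK; apply: (@le_trans _ _ (B * (e / (B + 1)))).
  by rewrite ler_wpM2l// ltW.
by rewrite mulrCA ler_piMr ?(ltW e0)// ler_pdivrMr ?mul1r ?lerDl// ltr_wpDl.
Qed.

End integral_operator.

(** * Differentiable families of paths *)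

Section families.
Context {R : realType}.
Implicit Types (W : normedModType R) (d : R).

Definition bounded_family W d (a : R -> R -> W) :=
  exists C, forall s : R, `|s| < d -> continuous (a s) /\ forall t, `|a s t| <=
    C.

(** [s] is the parameter and [t] the time. The remainder is quadratic and uniform in both, which is
    what lets differentiation in [s] commute with integration in [t] without a convergence
    theorem. *)
Definition family_deriv W d (a a' : R -> R -> W) :=
  [/\ bounded_family d a, bounded_family d a' &
    exists C : R, forall s h t : R, `|s| < d -> `|s + h| < d ->
      `|a (s + h) t - a s t - h *: a' s t| <= C * h ^+ 2].

(** A linear operator of sup norm at most [k]. Linearity and the bound are asked on continuous paths
    only, where the integral operators have them. *)
Definition path_operator W (k : R) (T : (R -> W) -> R -> W) :=
  [/\ forall (c : R) w v, continuous w -> continuous v ->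
        forall t, T (fun s => c *: w s + v s) t = c *: T w t + T v t,
      forall w, continuous w -> continuous (T w) &
      forall w B, continuous w -> (forall t, `|w t| <= B) ->
        forall t, `|T w t| <= k * B].

Definition bounded_bilinear (W1 W2 W3 : normedModType R)
    (B : W1 -> W2 -> W3) :=
  [/\ forall c u u' v, B (c *: u + u') v = c *: B u v + B u' v,
      forall c u v v', B u (c *: v + v') = c *: B u v + B u v' &
      exists K, forall u v, `|B u v| <= K * `|u| * `|v|].

Lemma ex_ge0 (P : R -> Prop) : (exists C, P C) ->
  (forall C D, C <= D -> P C -> P D) -> exists2 C : R, 0 <= C & P C.
Proof.
move=> [C PC] mon; exists (Num.max 0 C); first by rewrite le_max lexx.
by apply: mon PC; rewrite le_max lexx orbT.
Qed.

Lemma bounded_family_ge0 W d (a : R -> R -> W) : bounded_family d a ->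
  exists2 C : R, 0 <= C &
    forall s : R, `|s| < d -> continuous (a s) /\ forall t, `|a s t| <= C.
Proof.
move=> /ex_ge0; apply=> C D CD H s /H[ca aC]; split=> // t.
exact: le_trans (aC t) CD.
Qed.

Lemma family_deriv_ge0 W d (a a' : R -> R -> W) : family_deriv d a a' ->
  exists2 C : R, 0 <= C & forall s h t : R, `|s| < d -> `|s + h| < d ->
      `|a (s + h) t - a s t - h *: a' s t| <= C * h ^+ 2.
Proof.
move=> [_ _ /ex_ge0]; apply=> C D CD H s h t sd shd.
by apply: le_trans (H _ _ _ sd shd) _; rewrite ler_wpM2r// sqr_ge0.
Qed.

Lemma step_lt d (s h : R) : `|s| < d -> `|s + h| < d -> `|h| <= 2 * d.
Proof.
move=> sd shd; have -> : h = (s + h) - s by rewrite addrC addKr.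
by rewrite (le_trans (ler_normB _ _))//; lra.
Qed.

Lemma normrX2 (h : R) : h ^+ 2 = `|h| * `|h|.
Proof. by rewrite -normrM -expr2 ger0_norm ?sqr_ge0. Qed.

(** Admissible increments satisfy [|h| <= 2 d], so the quadratic remainder is absorbed into a linear
    one. For [d <= 0] there is no admissible [s]. *)
Lemma family_deriv_lip W d (a a' : R -> R -> W) : family_deriv d a a' ->
  exists2 C : R, 0 <= C & forall s h t : R, `|s| < d -> `|s + h| < d ->
    `|a (s + h) t - a s t| <= C * `|h|.
Proof.
move=> ad; have [C C0 HC] := family_deriv_ge0 ad.
case: ad => _ /bounded_family_ge0[D D0 HD] _.
have [d0|d0] := leP d 0.
  by exists 0 => // s h t sd; have := normr_ge0 s; lra.
exists (C * (2 * d) + D) => [|s h t sd shd].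
  by rewrite addr_ge0// mulr_ge0// mulr_ge0// ltW.
have -> : a (s + h) t - a s t =
    (a (s + h) t - a s t - h *: a' s t) + h *: a' s t by rewrite subrK.
apply: le_trans (ler_normD _ _) _; rewrite mulrDl; apply: lerD.
  apply: le_trans (HC _ _ _ sd shd) _; rewrite normrX2 [leLHS]mulrA.
  by apply: ler_wpM2r => //; rewrite ler_wpM2l// (step_lt sd shd).
rewrite normrZ mulrC ler_wpM2r//; exact: (HD s sd).2.
Qed.

Lemma family_deriv_is_derive W d (a a' : R -> R -> W) (s t : R) :
  family_deriv d a a' -> `|s| < d -> is_derive s 1 (a^~ t) (a' s t).
Proof.
move=> /family_deriv_ge0[C C0 HC] sd; apply/is_derive_eps => e e0.
exists (Num.min (d - `|s|) (e / (C + 1))).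
  by rewrite lt_min subr_gt0 sd divr_gt0// ltr_wpDl.
move=> h; rewrite lt_min => /andP[hd he].
have shd : `|s + h| < d by rewrite (le_lt_trans (ler_normD _ _))//; lra.
apply: le_trans (HC _ _ _ sd shd) _; rewrite normrX2 mulrA ler_wpM2r//.
apply: (@le_trans _ _ (C * (e / (C + 1)))); first by rewrite ler_wpM2l// ltW.
by rewrite mulrCA ler_piMr ?(ltW e0)// ler_pdivrMr ?mul1r ?lerDl// ltr_wpDl.
Qed.

(** Allows an equation between families to be differentiated: once both sides have derivatives,
    these coincide. This is how the linearized equations are obtained. *)
Lemma family_deriv_uniq W d (a b a' b' : R -> R -> W) (s t : R) :
  family_deriv d a a' -> family_deriv d b b' ->
  (forall s t : R, `|s| < d -> a s t = b s t) -> `|s| < d -> a' s t = b' s t.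
Proof.
move=> ad bd ab sd; apply: (is_derive_unique (family_deriv_is_derive t ad sd)).
apply: near_eq_is_derive (family_deriv_is_derive t bd sd).
near=> r; apply/esym/ab; near: r.
apply/nbhs_ballP; exists (d - `|s|); first by rewrite /= subr_gt0.
move=> r; rewrite /ball/= => sr.
have -> : r = s - (s - r) by rewrite opprB addrC subrK.
by rewrite (le_lt_trans (ler_normB _ _))//; lra.
Unshelve. all: by end_near. Qed.

Lemma eq_bounded_family W d (a b : R -> R -> W) :
  (forall s t : R, `|s| < d -> a s t = b s t) ->
  bounded_family d a -> bounded_family d b.
Proof.
move=> ab [C HC]; exists C => s sd; have [ca aC] := HC s sd.
have <- : a s = b s by apply/funext => t; exact: ab.
by [].
Qed.

Lemma eq_family_deriv W d (a b a' b' : R -> R -> W) :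
  (forall s t : R, `|s| < d -> a s t = b s t) ->
  (forall s t : R, `|s| < d -> a' s t = b' s t) ->
  family_deriv d a a' -> family_deriv d b b'.
Proof.
move=> ab ab' [fa fa' [C HC]]; split; try exact: eq_bounded_family _ fa.
  exact: eq_bounded_family fa'.
by exists C => s h t sd shd; rewrite -!ab// -ab'//; exact: HC.
Qed.

Lemma bounded_family_lin W d (c : R) (a b : R -> R -> W) :
  bounded_family d a -> bounded_family d b ->
  bounded_family d (fun s t => c *: a s t + b s t).
Proof.
move=> [C HC] [D HD]; exists (`|c| * C + D) => s sd.
have [ca aC] := HC s sd; have [cb bD] := HD s sd; split=> [t|t].
  apply: cvgD; last exact: cb.
  by apply: cvgZr; exact: ca.
by rewrite (le_trans (ler_normD _ _))// lerD// normrZ ler_wpM2l.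
Qed.

Lemma family_deriv_lin W d (c : R) (a b a' b' : R -> R -> W) :
  family_deriv d a a' -> family_deriv d b b' ->
  family_deriv d (fun s t => c *: a s t + b s t)
    (fun s t => c *: a' s t + b' s t).
Proof.
move=> [fa fa' [C HC]] [fb fb' [D HD]]; split; try exact: bounded_family_lin.
exists (`|c| * C + D) => s h t sd shd.
have -> : c *: a (s + h) t + b (s + h) t - (c *: a s t + b s t) -
    h *: (c *: a' s t + b' s t) =
    c *: (a (s + h) t - a s t - h *: a' s t) +
    (b (s + h) t - b s t - h *: b' s t) by lmod R W.
rewrite (le_trans (ler_normD _ _))// mulrDl lerD ?HD// normrZ -mulrA.
by rewrite ler_wpM2l// HC.
Qed.

Lemma bounded_bilinear_ge0 (W1 W2 W3 : normedModType R) (B : W1 -> W2 -> W3) :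
  bounded_bilinear B ->
  exists2 K : R, 0 <= K & forall u v, `|B u v| <= K * `|u| * `|v|.
Proof.
move=> [_ _ /ex_ge0]; apply=> C D CD H u v; apply: le_trans (H u v) _.
by rewrite ler_wpM2r// ler_wpM2r.
Qed.

Lemma bilinear_sub (W1 W2 W3 : normedModType R) (B : W1 -> W2 -> W3) :
  bounded_bilinear B ->
  (forall u u' v, B (u - u') v = B u v - B u' v) /\
  (forall u v v', B u (v - v') = B u v - B u v').
Proof.
move=> [Bl Br _]; split=> [u u' v|u v v'].
  have -> : u - u' = (-1) *: u' + u by lmod R W1.
  by rewrite Bl; lmod R W3.
have -> : v - v' = (-1) *: v' + v by lmod R W2.
by rewrite Br; lmod R W3.
Qed.

Lemma bounded_family_bilinear (W1 W2 W3 : normedModType R)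
    (B : W1 -> W2 -> W3) d (a : R -> R -> W1) (b : R -> R -> W2) :
  bounded_bilinear B -> bounded_family d a -> bounded_family d b ->
  bounded_family d (fun s t => B (a s t) (b s t)).
Proof.
move=> Bb; have [K K0 HK] := bounded_bilinear_ge0 Bb.
have [Bl Br] := bilinear_sub Bb.
move=> /bounded_family_ge0[C C0 HC] /bounded_family_ge0[D D0 HD].
exists (K * C * D) => s sd.
have [ca aC] := HC s sd; have [cb bD] := HD s sd; split=> [t|t]; last first.
  rewrite (le_trans (HK _ _))// ler_pM ?mulr_ge0// ler_wpM2l//.
apply/continuousP_eps => e e0.
pose q := e / (K * (C + D) + 1).
have q0 : 0 < q by rewrite divr_gt0// ltr_wpDl// mulr_ge0// addr_ge0.
have /continuousP_eps/(_ _ q0)[d1 d10 H1] := ca t.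
have /continuousP_eps/(_ _ q0)[d2 d20 H2] := cb t.
exists (Num.min d1 d2); first by rewrite lt_min d10.
move=> h; rewrite lt_min => /andP[/H1{}H1 /H2{}H2].
have -> : B (a s (t + h)) (b s (t + h)) - B (a s t) (b s t) =
  B (a s (t + h) - a s t) (b s (t + h)) + B (a s t) (b s (t + h) - b s t).
  by rewrite Bl Br; lmod R W3.
apply: (@le_trans _ _ (K * q * D + K * C * q)).
  rewrite (le_trans (ler_normD _ _))// lerD// (le_trans (HK _ _))//.
    by rewrite ler_pM ?mulr_ge0// ler_wpM2l.
  by rewrite ler_pM ?mulr_ge0// ler_wpM2l.
have -> : K * q * D + K * C * q = K * (C + D) * q by ring.
rewrite /q mulrCA ler_piMr ?(ltW e0)// ler_pdivrMr ?mul1r ?lerDl//.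
by rewrite ltr_wpDl// mulr_ge0// addr_ge0.
Qed.

Lemma family_deriv_bilinear (W1 W2 W3 : normedModType R)
    (B : W1 -> W2 -> W3) d (a a' : R -> R -> W1) (b b' : R -> R -> W2) :
  bounded_bilinear B -> family_deriv d a a' -> family_deriv d b b' ->
  family_deriv d (fun s t => B (a s t) (b s t))
    (fun s t => B (a' s t) (b s t) + B (a s t) (b' s t)).
Proof.
move=> Bb ad bd.
have [fa fa' _] := ad; have [fb fb' _] := bd.
have [K K0 HK] := bounded_bilinear_ge0 Bb.
have [Bl Br] := bilinear_sub Bb.
have [A A0 HA] := family_deriv_ge0 ad; have [C C0 HC] := family_deriv_ge0 bd.
have [E E0 HE] := family_deriv_lip bd.
have [F F0 HF] := bounded_family_ge0 fa.
have [F' F'0 HF'] := bounded_family_ge0 fa'.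
have [G G0 HG] := bounded_family_ge0 fb.
split; first exact: bounded_family_bilinear.
  have -> : (fun s t => B (a' s t) (b s t) + B (a s t) (b' s t)) =
    (fun s t => 1 *: B (a' s t) (b s t) + B (a s t) (b' s t)).
    by apply/funext => s; apply/funext => t; rewrite scale1r.
  by apply: bounded_family_lin; exact: bounded_family_bilinear.
exists (K * A * G + K * F * C + K * F' * E) => s h t sd shd.
have {}HA := HA _ _ t sd shd; have {}HC := HC _ _ t sd shd.
have {}HE := HE _ _ t sd shd.
have [_ /(_ t) {}HF] := HF _ sd; have [_ /(_ t) {}HF'] := HF' _ sd.
have [_ /(_ t) {}HG] := HG _ shd.
have BZl k u v : B (k *: u) v = k *: B u v.
  have [Bl' _ _] := Bb; have := Bl' k u 0 v; rewrite addr0 => ->.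
  by have := Bl 0 0 v; rewrite !subrr => ->; rewrite addr0.
have BZr k u v : B u (k *: v) = k *: B u v.
  have [_ Br' _] := Bb; have := Br' k u v 0; rewrite addr0 => ->.
  by have := Br u 0 0; rewrite !subrr => ->; rewrite addr0.
(* Leibniz rule with remainder: one Taylor remainder for each factor, and a product of two
   first-order increments. *)
have -> : B (a (s + h) t) (b (s + h) t) - B (a s t) (b s t) -
    h *: (B (a' s t) (b s t) + B (a s t) (b' s t)) =
  B (a (s + h) t - a s t - h *: a' s t) (b (s + h) t) +
  B (a s t) (b (s + h) t - b s t - h *: b' s t) +
  h *: B (a' s t) (b (s + h) t - b s t).
  by rewrite !Bl !Br BZl BZr; lmod R W3.
rewrite !mulrDl; apply: le_trans (ler_normD _ _) _; apply: lerD.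
  apply: le_trans (ler_normD _ _) _; apply: lerD.
    apply: (le_trans (HK _ _)); rewrite -!mulrA ler_wpM2l// [G * _]mulrC mulrA.
    by rewrite ler_pM.
  apply: (le_trans (HK _ _)); rewrite -!mulrA ler_wpM2l//.
  by rewrite ler_pM.
rewrite normrZ; apply: (@le_trans _ _ (`|h| * (K * F' * (E * `|h|)))).
  rewrite ler_wpM2l//; apply: (le_trans (HK _ _)).
  by rewrite ler_pM ?mulr_ge0// ler_wpM2l.
by rewrite normrX2 le_eqVlt; apply/orP; left; apply/eqP; ring.
Qed.

Lemma bounded_family_cst W d (w : R -> W) (C : R) :
  continuous w -> (forall t, `|w t| <= C) -> bounded_family d (fun=> w).
Proof. by move=> cw wC; exists C. Qed.

Lemma family_deriv_cst W d (w : R -> W) (C : R) :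
  continuous w -> (forall t, `|w t| <= C) ->
  family_deriv d (fun=> w) (fun _ _ => 0).
Proof.
move=> cw wC; split; first exact: bounded_family_cst wC.
  by exists 0 => s sd; split=> [t|t]; [exact: cvg_cst|rewrite normr0].
by exists 0 => s h t _ _; rewrite subrr scaler0 subrr normr0 mul0r.
Qed.

(** The bounds that composition with a scalar family consumes. They are taken on a compact interval,
    where the derivatives of a smooth function are bounded. *)
Definition C11_on (p q : R) (f f' : R -> R) :=
  exists C : R, forall x y : R, p <= x <= q -> p <= y <= q ->
    [/\ `|f x| <= C, `|f' x| <= C, `|f x - f y| <= C * `|x - y|,
        `|f' x - f' y| <= C * `|x - y| &
        `|f x - f y - (x - y) * f' y| <= C * (x - y) ^+ 2].

Lemma bounded_family_comp d (p q : R) (f : R -> R) (a : R -> R -> R) (C : R) :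
  (forall x y : R, p <= x <= q -> p <= y <= q ->
    `|f x| <= C /\ `|f x - f y| <= C * `|x - y|) ->
  (forall s t : R, `|s| < d -> p <= a s t <= q) ->
  bounded_family d a -> bounded_family d (fun s t => f (a s t)).
Proof.
move=> H aQ [D HD]; exists C => s sd; have [ca _] := HD s sd.
split=> [t|t]; last by have [] := H (a s t) (a s t) (aQ s t sd) (aQ s t sd).
have C0 : 0 <= C.
  have [+ _] := H (a s t) (a s t) (aQ s t sd) (aQ s t sd).
  by apply: le_trans.
apply/continuousP_eps => e e0.
have e1 : 0 < e / (C + 1) by rewrite divr_gt0// ltr_wpDl.
have /continuousP_eps/(_ _ e1)[r r0 Hr] := ca t.
exists r => // h /Hr {}Hr.
have [_ /le_trans] := H (a s (t + h)) (a s t) (aQ s _ sd) (aQ s t sd); apply.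
apply: (@le_trans _ _ (C * (e / (C + 1)))); first by rewrite ler_wpM2l.
by rewrite mulrCA ler_piMr ?(ltW e0)// ler_pdivrMr ?mul1r ?lerDl// ltr_wpDl.
Qed.

Lemma family_deriv_comp d (p q : R) (f f' : R -> R) (a a' : R -> R -> R) :
  C11_on p q f f' -> (forall s t : R, `|s| < d -> p <= a s t <= q) ->
  family_deriv d a a' ->
  family_deriv d (fun s t => f (a s t)) (fun s t => f' (a s t) * a' s t).
Proof.
move=> [C HC] aQ ad; have [fa fa' _] := ad.
have [E E0 HE] := family_deriv_lip ad.
have [A A0 HA] := family_deriv_ge0 ad.
split.
- apply: (@bounded_family_comp _ p q _ _ C) => // x y xQ yQ.
  by have [] := HC x y xQ yQ.
- apply: (@bounded_family_bilinear R^o R^o R^o *%R) => //.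
    split=> [c u u' v|c u v v'|].
    + by rewrite mulrDl scalerAl.
    + by rewrite mulrDr scalerAr.
    + by exists 1 => u v; rewrite mul1r normrM.
  apply: (@bounded_family_comp _ p q _ _ C) => // x y xQ yQ.
  by have [] := HC x y xQ yQ.
exists (C * (E * E) + C * A) => s h t sd shd.
have [_ f'C _ _ H] := HC _ _ (aQ _ t shd) (aQ _ t sd).
have [_ f'C' _ _ _] := HC _ _ (aQ _ t sd) (aQ _ t sd).
have C0 : 0 <= C by exact: le_trans f'C'.
have {}HE := HE _ _ t sd shd; have {}HA := HA _ _ t sd shd.
rewrite scalerAr -/(_ *: _) /GRing.scale/=.
have -> : f (a (s + h) t) - f (a s t) - f' (a s t) * (h * a' s t) =
  (f (a (s + h) t) - f (a s t) - (a (s + h) t - a s t) * f' (a s t)) +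
  f' (a s t) * (a (s + h) t - a s t - h * a' s t) by ring.
apply: le_trans (ler_normD _ _) _; rewrite [leRHS]mulrDl; apply: lerD.
  apply: (le_trans H); rewrite -mulrA ler_wpM2l// !normrX2.
  by rewrite mulrACA ler_pM.
by rewrite normrM -mulrA ler_pM.
Qed.

Lemma bounded_family_operator W d k (T : (R -> W) -> R -> W) a :
  0 <= k -> path_operator k T -> bounded_family d a ->
  bounded_family d (fun s => T (a s)).
Proof.
move=> k0 [_ Tc Tb] [C HC]; exists (k * C) => s /HC[ca aC].
by split; [exact: Tc|move=> t; exact: Tb].
Qed.

Lemma path_operator_comb W k (T : (R -> W) -> R -> W) (x y : R) u v w :
  path_operator k T -> continuous u -> continuous v -> continuous w ->
  forall t, T (fun s => x *: u s + (y *: v s + w s)) t =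
    x *: T u t + (y *: T v t + T w t).
Proof.
move=> [Tl _ _] cu cv cw t; rewrite Tl// ?Tl// => s.
by apply: cvgD; [apply: cvgZr; exact: cv|exact: cw].
Qed.

(** By linearity the remainder of [T a] is [T] applied to the remainder of [a], and [T] multiplies
    uniform bounds by [k]. *)
Lemma family_deriv_operator W d k (T : (R -> W) -> R -> W) a a' :
  0 <= k -> path_operator k T -> family_deriv d a a' ->
  family_deriv d (fun s => T (a s)) (fun s => T (a' s)).
Proof.
move=> k0 Tk ad; have [fa fa' _] := ad.
split; [exact: bounded_family_operator Tk fa|exact: bounded_family_operator Tk
  fa'|].
have [C C0 HC] := family_deriv_ge0 ad.
case: fa => A HA; case: fa' => A' HA'.
exists (k * C) => s h t sd shd.
have [ca _] := HA s sd; have [cah _] := HA _ shd; have [ca' _] := HA' s sd.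
have -> : T (a (s + h)) t - T (a s) t - h *: T (a' s) t =
    T (fun r => (-1) *: a s r + ((- h) *: a' s r + a (s + h) r)) t.
  by rewrite (path_operator_comb _ _ Tk)//; lmod R W.
rewrite -mulrA; have [_ _ -> //] := Tk.
  move=> r; apply: cvgD; first by apply: cvgZr; exact: ca.
  by apply: cvgD; [apply: cvgZr; exact: ca'|exact: cah].
move=> r; have := HC _ _ r sd shd.
by rewrite (_ : _ - _ = -1 *: a s r + (- h *: a' s r + a (s + h) r))//;
  lmod R W.
Qed.

End families.

(** * Dependence of contraction fixed points on a parameter *)

Section differentiable_solutions.
Context {R : realType} {W : completeNormedModType R}.
Variables (d k L : R) (T : (R -> W) -> R -> W) (w b b' G : R -> R -> W).
Hypotheses (k0 : 0 <= k) (L0 : 0 <= L) (kL : k * L <= 1 / 2).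
Hypotheses (Tk : path_operator k T) (fw : bounded_family d w)
  (fG : bounded_family d G) (bb' : family_deriv d b b').
Hypothesis weq : forall s t : R, `|s| < d -> w s t = b s t + T (G s) t.

Let T_sub u v t : continuous u -> continuous v ->
  T u t - T v t = T (fun s => u s - v s) t.
Proof.
move=> cu cv; have [Tl _ _] := Tk.
rewrite (_ : (fun s => _) = (fun s => -1 *: v s + u s)).
  by rewrite Tl//; lmod R W.
by apply/funext => s; lmod R W.
Qed.

(** The increment of [w] satisfies the same relation with data of size [O(|h|)], and
    [k * L <= 1 / 2] lets its sup norm be absorbed. *)
Lemma fixed_family_lip (C : R) :
  (forall s h t : R, `|s| < d -> `|s + h| < d ->
    `|G (s + h) t - G s t| <= L * `|w (s + h) t - w s t| + C * `|h|) ->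
  exists2 D : R, 0 <= D & forall s h t : R, `|s| < d -> `|s + h| < d ->
    `|w (s + h) t - w s t| <= D * `|h|.
Proof.
move=> HG.
have [E E0 HE] := family_deriv_lip bb'.
have [D D0 HD] := bounded_family_ge0 fw.
have [cG cGP] := fG.
exists (2 * (E + k * `|C|)) => [|s h t sd shd].
  by rewrite mulr_ge0// addr_ge0// mulr_ge0.
have [cGs _] := cGP s sd; have [cGh _] := cGP _ shd.
rewrite -mulrA.
apply: (@bound_of_self_improvement R R (fun t => `|w (s + h) t - w s t|)) => //.
  exists (D + D) => r; rewrite (le_trans (ler_normB _ _))//.
  by rewrite lerD//; [case: (HD _ shd)|case: (HD _ sd)].
move=> B B0 HB r; rewrite !weq//.
have -> : b (s + h) r + T (G (s + h)) r - (b s r + T (G s) r) =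
  b (s + h) r - b s r + (T (G (s + h)) r - T (G s) r) by lmod R W.
rewrite T_sub//; apply: le_trans (ler_normD _ _) _.
have : `|T (fun x => G (s + h) x - G s x) r| <= k * (L * B + `|C| * `|h|).
  have [_ _ ->//] := Tk.
    by move=> x; apply: cvgB; [exact: cGh|exact: cGs].
  move=> x; apply: le_trans (HG _ _ _ sd shd) _; apply: lerD.
    by rewrite ler_wpM2l.
  by rewrite ler_wpM2r// ler_norm.
have : k * L * B <= 1 / 2 * B by rewrite ler_wpM2r.
have := HE s h r sd shd.
rewrite !mulrDl !mulrDr !mulrA; lra.
Qed.

(** [M] is the linearization of [G] in [w], and [err] its explicit dependence on the parameter. The
    derivative is constructed as a limit of difference quotients, which are uniformly Cauchy by the
    contraction estimate. *)
Lemma fixed_family_deriv (M : R -> R -> W -> W) (err : R -> R -> W) (C : R) :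
  (forall s t : R, `|s| < d -> forall c u v,
    M s t (c *: u + v) = c *: M s t u + M s t v) ->
  (forall s t : R, `|s| < d -> forall v, `|M s t v| <= L * `|v|) ->
  bounded_family d err ->
  (forall s h t : R, `|s| < d -> `|s + h| < d ->
    `|G (s + h) t - G s t - M s t (w (s + h) t - w s t) - h *: err s t| <=
    C * h ^+ 2) ->
  exists w', family_deriv d w w'.
Proof.
move=> Ml ML fe HG.
have [d0|d0] := leP d 0.
  by exists w; split=> //; exists 0 => s h t sd; have := normr_ge0 s; lra.
have [E E0 HE] := bounded_family_ge0 fe.
have [Lw Lw0 wL] : exists2 D : R, 0 <= D &
    forall s h t : R, `|s| < d -> `|s + h| < d ->
    `|w (s + h) t - w s t| <= D * `|h|.
  apply: (@fixed_family_lip (`|C| * (2 * d) + E)) => s h t sd shd.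
  have -> : G (s + h) t - G s t =
      G (s + h) t - G s t - M s t (w (s + h) t - w s t) - h *: err s t +
      (M s t (w (s + h) t - w s t) + h *: err s t) by lmod R W.
  apply: le_trans (ler_normD _ _) _; rewrite addrC mulrDl addrA addrAC.
  apply: lerD; last first.
    apply: le_trans (HG _ _ _ sd shd) _; rewrite normrX2 mulrA ler_wpM2r//.
    rewrite (le_trans (ler_norm _))// normrM normr_id ler_wpM2l//.
    exact: step_lt sd shd.
  apply: le_trans (ler_normD _ _) _; rewrite lerD ?ML// normrZ mulrC.
  by rewrite ler_wpM2r//; case: (HE s sd).
have [A A0 HA] := family_deriv_ge0 bb'.
pose D (s h t : R) : W := h^-1 *: (w (s + h) t - w s t).
pose K := 2 * (A + k * `|C|).
have K0 : 0 <= K by rewrite mulr_ge0// addr_ge0// mulr_ge0.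
have [cw cwP] := fw; have [cG cGP] := fG.
(* Subtracting the equations of two quotients cancels [b'] and [err]. There remains [M] applied to
   their difference, absorbed by the factor 1/2, and an error [O(|h| + |l|)]. *)
have D_cauchy (s h l t : R) : `|s| < d -> `|s + h| < d -> `|s + l| < d ->
    h != 0 -> l != 0 -> `|D s h t - D s l t| <= K * (`|h| + `|l|).
  move=> sd shd sld h0 l0.
  rewrite -mulrA.
  apply: (@bound_of_self_improvement R R (fun t => `|D s h t - D s l t|)) => //.
    exists (Lw + Lw) => r; rewrite (le_trans (ler_normB _ _))//.
    suff H p : `|s + p| < d -> p != 0 -> `|D s p r| <= Lw by rewrite lerD ?H.
    move=> spd p0; rewrite normrZ normfV mulrC ler_pdivrMr ?normr_gt0//.
    exact: wL.
  move=> B B0 HB r.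
  pose g (p x : R) := p^-1 *: (G (s + p) x - G s x).
  have cg (p : R) : `|s + p| < d -> continuous (g p).
    move=> spd x; apply: cvgZr; apply: cvgB.
      by have [cc _] := cGP _ spd; exact: cc.
    by have [cc _] := cGP _ sd; exact: cc.
  have DE (p : R) : `|s + p| < d ->
      D s p r = p^-1 *: (b (s + p) r - b s r) + T (g p) r.
    move=> spd; have [c1 _] := cGP _ spd; have [c2 _] := cGP _ sd.
    rewrite /D !weq//.
    have -> : T (g p) r = p^-1 *: (T (G (s + p)) r - T (G s) r).
      rewrite T_sub//; have [Tl _ _] := Tk.
      set u := fun x => G (s + p) x - G s x.
      have cu : continuous u by move=> x; apply: cvgB; [exact: c1|exact: c2].
      rewrite (_ : g p = fun x => (p^-1 - 1) *: u x + u x); last first.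
        by apply/funext => x; rewrite /g -/(u x); lmod R W.
      by rewrite Tl//; lmod R W.
    by lmod R W.
  rewrite !DE//.
  have -> : h^-1 *: (b (s + h) r - b s r) + T (g h) r -
      (l^-1 *: (b (s + l) r - b s r) + T (g l) r) =
      (h^-1 *: (b (s + h) r - b s r - h *: b' s r) -
       l^-1 *: (b (s + l) r - b s r - l *: b' s r)) +
      (T (g h) r - T (g l) r) by lmod R W; rewrite ?h0 ?l0.
  rewrite T_sub; [|exact: cg|exact: cg].
  have quot p (v : W) (c : R) : p != 0 -> `|v| <= c * p ^+ 2 ->
      `|p^-1 *: v| <= c * `|p|.
    move=> p0 vc; rewrite normrZ normfV mulrC ler_pdivrMr ?normr_gt0//.
    by rewrite -mulrA -normrX2.
  have bq : `|h^-1 *: (b (s + h) r - b s r - h *: b' s r) -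
       l^-1 *: (b (s + l) r - b s r - l *: b' s r)| <= A * (`|h| + `|l|).
    by rewrite (le_trans (ler_normB _ _))// mulrDr lerD// quot// HA.
  have : `|T (fun x => g h x - g l x) r| <=
      k * (L * B + `|C| * (`|h| + `|l|)).
    have [_ _ ->//] := Tk.
      by move=> x; apply: cvgB; apply: cg.
    move=> x.
    have ME : M s x (D s h x - D s l x) =
        h^-1 *: M s x (w (s + h) x - w s x) - l^-1 *: M s x (w (s + l) x - w s
          x).
      have M0 : M s x 0 = 0.
        have := Ml s x sd (-1) 0 0; rewrite scaler0 addr0 scaleN1r => ->.
        by rewrite addNr.
      rewrite (_ : D s h x - D s l x = (- l^-1) *: (w (s + l) x - w s x) +
        (h^-1 *: (w (s + h) x - w s x) + 0)); last by rewrite /D; lmod R W.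
      by rewrite Ml// Ml// M0; lmod R W.
    have -> : g h x - g l x = M s x (D s h x - D s l x) +
      (h^-1 *: (G (s + h) x - G s x - M s x (w (s + h) x - w s x) - h *: err s
        x) -
       l^-1 *: (G (s + l) x - G s x - M s x (w (s + l) x - w s x) - l *: err s
         x)).
      by rewrite ME /g; lmod R W; rewrite ?h0 ?l0.
    apply: le_trans (ler_normD _ _) _; apply: lerD.
      by apply: le_trans (ML _ _ sd _) _; rewrite ler_wpM2l.
    have HG' p : `|s + p| < d ->
      `|G (s + p) x - G s x - M s x (w (s + p) x - w s x) - p *: err s x| <=
      `|C| * p ^+ 2.
      move=> spd; apply: le_trans (HG _ _ _ sd spd) _.
      by rewrite ler_wpM2r ?sqr_ge0 ?ler_norm.
    by rewrite (le_trans (ler_normB _ _))// mulrDr lerD// quot// HG'.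
  have : k * L * B <= 1 / 2 * B by rewrite ler_wpM2r.
  move=> H1 H2; apply: le_trans (ler_normD _ _) _.
  have -> : (A + k * `|C|) * (`|h| + `|l|) + B / 2 =
    A * (`|h| + `|l|) + (k * `|C| * (`|h| + `|l|) + 1 / 2 * B) by ring.
  apply: lerD => //; apply: le_trans H2 _.
  by rewrite mulrDr addrC !mulrA lerD2l.
(* Letting [l] tend to 0 in the Cauchy estimate keeps the rate [K * |h|]; multiplied by [|h|] it
   becomes the quadratic remainder. *)
have Dlim (s t : R) : `|s| < d -> exists v : W, forall h : R, h != 0 ->
  `|s + h| < d ->
    `|D s h t - v| <= K * `|h|.
  move=> sd.
  have near_ok (r : R) : 0 < r ->
      \forall h \near (0 : R)^', [/\ h != 0, `|s + h| < d & `|h| < r].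
    move=> r0; rewrite near_withinE; apply/nbhs_ballP.
    exists (Num.min r (d - `|s|)); first by rewrite /= lt_min r0 subr_gt0.
    move=> h; rewrite /ball/= sub0r normrN lt_min => /andP[hr hd] h0.
    by split=> //; rewrite (le_lt_trans (ler_normD _ _))//; lra.
  have : cvg (D s h t @[h --> (0:R)^']).
    apply/cauchy_cvgP/cauchy_ballP => e e0.
    have r0 : 0 < e / (2 * (K + 1)) by rewrite divr_gt0// mulr_gt0// ltr_wpDl.
    pose N := [set h | [/\ h != 0, `|s + h| < d & `|h| < e / (2 * (K + 1))]].
    exists ([set D s h t | h in N], [set D s h t | h in N]).
      by split; apply: filterS (near_ok _ r0) => h Nh /=; exists h.
    move=> [_ _] [/= [h [h0 shd hr] <-] [l [l0 sld lr] <-]].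
    rewrite -ball_normE /=.
    apply: le_lt_trans (D_cauchy s h l t sd shd sld h0 l0) _.
    apply: (@le_lt_trans _ _ ((K + 1) * (`|h| + `|l|))).
      by rewrite ler_wpM2r ?addr_ge0// lerDl.
    rewrite -ltr_pdivlMl ?ltr_wpDl//.
    have -> : (K + 1)^-1 * e = e / (2 * (K + 1)) + e / (2 * (K + 1)).
      by field; rewrite gt_eqF// ltr_wpDl.
    exact: ltrD.
  move=> /cvg_ex[v Dv]; exists v => h h0 shd.
  apply/ler_addgt0Pr => e e0.
  have [l [[l0 sld lr] Hl]] : exists l : R,
      [/\ l != 0, `|s + l| < d & `|l| < e / 2 / (K + 1)] /\
      `|v - D s l t| <= e / 2.
    have e20 : 0 < e / 2 by rewrite divr_gt0.
    have r0 : 0 < e / 2 / (K + 1) by rewrite divr_gt0// ltr_wpDl.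
    move/cvgrPdist_le : Dv => /(_ _ e20) Dv.
    by have [l [H1 H2]] := filter_ex (filterI (near_ok _ r0) Dv); exists l.
  have -> : D s h t - v = D s h t - D s l t - (v - D s l t) by lmod R W.
  apply: le_trans (ler_normB _ _) _.
  have := D_cauchy s h l t sd shd sld h0 l0.
  have : K * `|l| <= e / 2.
    apply: (@le_trans _ _ ((K + 1) * `|l|)); first by rewrite ler_wpM2r// lerDl.
    by rewrite mulrC -ler_pdivlMr ?ltr_wpDl// ltW.
  rewrite mulrDr; lra.
have /choice[w' w'P] : forall p : R * R, exists v : W, `|p.1| < d ->
    forall h : R, h != 0 -> `|p.1 + h| < d -> `|D p.1 h p.2 - v| <= K * `|h|.
  move=> [s t] /=; have [sd|] := pselect (`|s| < d); last by exists 0.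
  by have [v vP] := Dlim s t sd; exists v.
exists (fun s t => w' (s, t)).
have est (s h t : R) : `|s| < d -> `|s + h| < d ->
    `|w (s + h) t - w s t - h *: w' (s, t)| <= K * h ^+ 2.
  move=> sd shd; have [->|h0] := eqVneq h 0.
    by rewrite addr0 subrr scale0r subrr normr0 mulr_ge0 ?sqr_ge0.
  have -> : w (s + h) t - w s t - h *: w' (s, t) = h *: (D s h t - w' (s, t)).
    by rewrite /D; lmod R W; rewrite ?h0.
  rewrite normrZ normrX2 mulrCA ler_wpM2l//.
  exact: (w'P (s, t) sd h h0 shd).
split=> //; last by exists K => s h t; exact: est.
have small (s r : R) : `|s| < d -> 0 < r -> exists h : R,
    [/\ h != 0, `|s + h| < d & `|h| <= r].
  move=> sd r0; pose q := Num.min r ((d - `|s|) / 2).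
  have q0 : 0 < q by rewrite lt_min r0 divr_gt0// subr_gt0.
  exists q; split; first by rewrite gt_eqF.
    rewrite (le_lt_trans (ler_normD _ _))// (gtr0_norm q0).
    have : q <= (d - `|s|) / 2 by rewrite ge_min lexx orbT.
    lra.
  by rewrite (gtr0_norm q0) ge_min lexx.
exists (Lw + K * d) => s sd; split=> [t|t]; last first.
  have [h [h0 shd hd]] := small s d sd d0.
  have -> : w' (s, t) = D s h t - (D s h t - w' (s, t)) by lmod R W.
  apply: le_trans (ler_normB _ _) _; apply: lerD.
    rewrite normrZ normfV mulrC ler_pdivrMr ?normr_gt0//; exact: wL.
  apply: le_trans (w'P (s, t) sd h h0 shd) _; exact: ler_wpM2l.
(* The quotients are continuous in time and converge uniformly, so the limit is continuous: one
   third of [e] for each of the three differences. *)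
apply/continuousP_eps => e e0.
have r0 : 0 < e / 3 / (K + 1) by rewrite !divr_gt0// ltr_wpDl.
have [h [h0 shd hd]] := small s _ sd r0.
have Kh : K * `|h| <= e / 3.
  apply: (@le_trans _ _ ((K + 1) * `|h|)); first by rewrite ler_wpM2r// lerDl.
  by rewrite mulrC -ler_pdivlMr ?ltr_wpDl.
have cD : {for t, continuous (D s h)}.
  have [c1 _] := cwP _ shd; have [c2 _] := cwP _ sd.
  by apply: cvgZr; apply: cvgB; [exact: c1|exact: c2].
have e30 : 0 < e / 3 by rewrite divr_gt0.
move/continuousP_eps : cD => /(_ _ e30)[q q0 Hq].
exists q => // p /Hq {}Hq.
have -> : w' (s, t + p) - w' (s, t) = (D s h (t + p) - D s h t) +
    ((D s h t - w' (s, t)) - (D s h (t + p) - w' (s, t + p))) by lmod R W.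
apply: le_trans (ler_normD _ _) _.
have := ler_normB (D s h t - w' (s, t)) (D s h (t + p) - w' (s, t + p)).
have /= := w'P (s, t) sd h h0 shd; have /= := w'P (s, t + p) sd h h0 shd.
lra.
Qed.

End differentiable_solutions.

(** * One-sided derivatives *)

Section derivative_within.
Context {R : realType}.
Implicit Types (W : normedModType R) (D : set R).

Definition has_dwithin W D (g : R -> W) (x : R) (v : W) :=
  forall e : R, 0 < e -> exists2 r : R, 0 < r &
    forall h : R, `|h| < r -> D (x + h) ->
      `|g (x + h) - g x - h *: v| <= e * `|h|.

(** Accumulation points of [D]. There the filter of difference quotients is proper, so that
    [deriv_within] is determined by any limit found. *)
Definition clusters_at D (x : R) :=
  forall r : R, 0 < r -> exists2 h : R, h != 0 & `|h| < r /\ D (x + h).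

Lemma diff_quot_norm W (g : R -> W) (x h : R) (v : W) : h != 0 ->
  `|v - diff_quot g x (x + h)| * `|h| = `|g (x + h) - g x - h *: v|.
Proof.
move=> h0; rewrite /diff_quot mulrC -normrZ -normrN; congr (`|_|).
have -> : x + h - x = h by rewrite addrC addKr.
by lmod R W; rewrite ?h0.
Qed.

Lemma has_dwithinP W D (g : R -> W) (x : R) (v : W) :
  has_dwithin D g x v <-> diff_quot g x @ within D x^' --> v.
Proof.
split=> [H|/cvgrPdist_le H e /H].
  apply/cvgrPdist_le => e /H[r r0 Hr].
  rewrite near_withinE near_withinE; apply/nbhs_ballP; exists r => //= y.
  rewrite /ball/= distrC => yr yx Dy.
  have yE : y = x + (y - x) by rewrite addrC subrK.
  have h0 : y - x != 0 by rewrite subr_eq0.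
  rewrite -(@ler_pM2r _ `|y - x|) ?normr_gt0//.
  by rewrite {1}yE diff_quot_norm//; apply: Hr; rewrite -?yE.
rewrite near_withinE near_withinE => /nbhs_ballP[r /= r0 Hr]; exists r => //.
move=> h hr Dxh; have [->|h0] := eqVneq h 0.
  by rewrite addr0 subrr scale0r subr0 !normr0 mulr0.
rewrite -diff_quot_norm// ler_wpM2r//; apply: Hr => //.
  by rewrite /ball/= opprD addrA subrr sub0r normrN.
by rewrite -subr_eq0 addrC addKr.
Qed.

Lemma clusters_at_proper D x : clusters_at D x -> ProperFilter (within D x^').
Proof.
move=> Dx; split; last exact: within_filter.
move=> /nbhs_ballP[r /= r0 Hr].
have [h h0 [hr Dxh]] := Dx r r0.
apply: (Hr (x + h)) => //.
  by rewrite /ball/= opprD addrA subrr sub0r normrN.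
by rewrite -subr_eq0 addrC addKr.
Qed.

Lemma deriv_withinE W D (g : R -> W) (x : R) (v : W) : clusters_at D x ->
  has_dwithin D g x v -> deriv_within D g x = v.
Proof.
move=> /clusters_at_proper PF /has_dwithinP H.
exact: cvg_lim H.
Qed.

Lemma smooth_on_dwithin W D (g : R -> W) k x : smooth_on D g -> D x ->
  has_dwithin D (iter k (deriv_within D) g) x
    (iter k.+1 (deriv_within D) g x).
Proof. by move=> sg /(sg k x) /has_dwithinP. Qed.

Lemma eq_has_dwithin W D (g f : R -> W) (x : R) v : D x ->
  (forall y, D y -> g y = f y) -> has_dwithin D g x v -> has_dwithin D f x v.
Proof.
move=> Dx gf H e /H[r r0 Hr]; exists r => // h hr Dxh.
by rewrite -!gf//; exact: Hr.
Qed.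

(** [deriv_within D] sees only values on [D], so at each order the iterated derivative may be
    replaced by the candidate [G k], with which it agrees on [D]. *)
Lemma smooth_onI W D (g : R -> W) (G : nat -> R -> W) :
  (forall x, D x -> clusters_at D x) ->
  (forall x, D x -> g x = G 0 x) ->
  (forall k x, D x -> has_dwithin D (G k) x (G k.+1 x)) ->
  smooth_on D g /\ forall k x, D x -> iter k (deriv_within D) g x = G k x.
Proof.
move=> Da g0 HG.
have GE k x : D x -> iter k (deriv_within D) g x = G k x.
  elim: k x => [|k IH] x Dx; first exact: g0.
  rewrite iterS; apply: deriv_withinE; first exact: Da.
  by apply: eq_has_dwithin (HG k x Dx) => // y Dy; rewrite IH.
split=> // k x Dx; apply/cvg_ex; exists (G k.+1 x); apply/has_dwithinP.
by apply: eq_has_dwithin (HG k x Dx) => // y Dy; rewrite GE.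
Qed.

Lemma has_dwithin_sub W D D' (g : R -> W) (x : R) v : D' `<=` D ->
  has_dwithin D g x v -> has_dwithin D' g x v.
Proof.
by move=> DD H e /H[r r0 Hr]; exists r => // h hr /DD; exact: Hr.
Qed.

Lemma has_dwithin_lin W D (c : R) (g f : R -> W) x u v :
  has_dwithin D g x u -> has_dwithin D f x v ->
  has_dwithin D (fun y => c *: g y + f y) x (c *: u + v).
Proof.
move=> Hg Hf e e0.
have e1 : 0 < e / (`|c| + 1) by rewrite divr_gt0// ltr_wpDl.
have [r r0 Hr] := Hg _ e1; have [q q0 Hq] := Hf _ e1.
exists (Num.min r q); first by rewrite lt_min r0.
move=> h; rewrite lt_min => /andP[/Hr{}Hr /Hq{}Hq] Dxh.
have -> : c *: g (x + h) + f (x + h) - (c *: g x + f x) - h *: (c *: u + v) =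
  c *: (g (x + h) - g x - h *: u) + (f (x + h) - f x - h *: v) by lmod R W.
apply: le_trans (ler_normD _ _) _; rewrite normrZ.
apply: (@le_trans _ _ ((`|c| + 1) * (e / (`|c| + 1) * `|h|))); last first.
  by rewrite mulrA mulrCA divff ?mulr1// gt_eqF// ltr_wpDl.
by rewrite mulrDl mul1r lerD// ?Hq// ler_wpM2l// Hr.
Qed.

Lemma has_dwithinD W D (g f : R -> W) x u v :
  has_dwithin D g x u -> has_dwithin D f x v ->
  has_dwithin D (fun y => g y + f y) x (u + v).
Proof.
move=> Hg Hf; have := has_dwithin_lin 1 Hg Hf.
rewrite scale1r (_ : (fun y => _) = fun y => g y + f y)//.
by apply/funext => y; rewrite scale1r.
Qed.

Lemma has_dwithin_affine W D (a b : W) x :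
  has_dwithin D (fun y : R => a + y *: b) x b.
Proof.
move=> e e0; exists 1 => // h _ _.
rewrite (_ : _ - _ = 0) ?normr0 ?mulr_ge0 ?(ltW e0)//.
by lmod R W.
Qed.

Lemma has_dwithin_cst W D (a : W) x : has_dwithin D (fun=> a) x 0.
Proof.
move=> e e0; exists 1 => // h _ _.
by rewrite subrr scaler0 subrr normr0 mulr_ge0// ltW.
Qed.

Lemma is_derive_dwithin W D (g : R -> W) (x : R) v :
  is_derive x 1 g v -> has_dwithin D g x v.
Proof.
by move=> /is_derive_eps H e /H[r r0 Hr]; exists r => // h hr _; exact: Hr.
Qed.

Lemma dwithin_is_derive W D (g : R -> W) (x r : R) (v : W) : 0 < r ->
  (forall h : R, `|h| < r -> D (x + h)) -> has_dwithin D g x v ->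
  is_derive x 1 g v.
Proof.
move=> r0 Dr H; apply/is_derive_eps => e /H[q q0 Hq].
exists (Num.min r q); first by rewrite lt_min r0.
by move=> h; rewrite lt_min => /andP[/Dr Dh /Hq]; exact.
Qed.

Lemma has_dwithin_continuous W D (g : R -> W) (x : R) v : has_dwithin D g x v ->
  forall e : R, 0 < e -> exists2 r : R, 0 < r &
    forall h : R, `|h| < r -> D (x + h) -> `|g (x + h) - g x| <= e.
Proof.
move=> H e e0; have [r r0 Hr] := H 1 ltr01.
exists (Num.min r (e / (1 + `|v|))).
  by rewrite lt_min r0 divr_gt0// ltr_wpDr.
move=> h; rewrite lt_min => /andP[/Hr{}Hr he] /Hr {}Hr.
have -> : g (x + h) - g x = g (x + h) - g x - h *: v + h *: v.
  by rewrite subrK.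
apply: le_trans (ler_normD _ _) _; rewrite normrZ.
apply: (@le_trans _ _ ((1 + `|v|) * `|h|)).
  by rewrite mulrDl (mulrC `|v|) lerD.
by rewrite mulrC -ler_pdivlMr ?ltr_wpDr// ltW.
Qed.

Section interval.
Variables p q : R.
Local Notation J := [set` `[p, q]].

Lemma dwithin_continuous (f f' : R -> R) :
  (forall x : R, p <= x <= q -> has_dwithin J f x (f' x)) ->
  {within J, continuous f}.
Proof.
move=> H; apply/subspace_continuousP => x; rewrite /= in_itv/= => xpq.
apply/cvgrPdist_le => e e0.
have [r r0 Hr] := has_dwithin_continuous (H x xpq) e0.
rewrite near_withinE; apply/nbhs_ballP; exists r => //= y.
rewrite /ball/= distrC => yr; rewrite in_itv/= => ypq.
rewrite distrC; have yE : y = x + (y - x) by rewrite addrC subrK.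
by rewrite yE; apply: Hr; rewrite // -yE /= in_itv.
Qed.

(** The bound on [|c - y|] permits a second application, to [f' c - f' y], which turns the mean
    value theorem into a quadratic Taylor estimate. *)
Lemma dwithin_MVT (f f' : R -> R) (x y : R) :
  (forall x : R, p <= x <= q -> has_dwithin J f x (f' x)) ->
  p <= x <= q -> p <= y <= q ->
  exists c : R, [/\ p <= c <= q, `|c - y| <= `|x - y| &
    f x - f y = (x - y) * f' c].
Proof.
move=> H xpq ypq.
have aux (a b : R) : p <= a <= q -> p <= b <= q -> a <= b ->
    exists c : R, [/\ a <= c, c <= b & f b - f a = f' c * (b - a)].
  move=> /andP[pa aq] /andP[pb bq] ab.
  have df z : z \in `]a, b[ -> is_derive z 1 f (f' z).
    rewrite in_itv/= => /andP[az zb].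
    apply: (@dwithin_is_derive _ J _ _ (Num.min (z - a) (b - z))).
    + by rewrite lt_min !subr_gt0 az.
    + move=> h; rewrite lt_min !ltr_norml => /andP[/andP[? ?] /andP[? ?]].
      by rewrite /= in_itv/=; lra.
    + by apply: H; lra.
  have cf : {within `[a, b], continuous f}.
    apply: continuous_subspaceW (dwithin_continuous H) => z /=.
    by rewrite !in_itv/= => /andP[? ?]; lra.
  have [c] := MVT_segment ab df cf.
  by rewrite in_itv/= => /andP[ac cb] E; exists c.
have [xy|/ltW yx] := leP x y.
  have [c [xc cy E]] := aux x y xpq ypq xy.
  exists c; split.
  - by move/andP: xpq => [? ?]; move/andP: ypq => [? ?]; lra.
  - by rewrite !ler0_norm; lra.
  - by rewrite -opprB E; ring.
have [c [yc cx E]] := aux y x ypq xpq yx.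
exists c; split.
- by move/andP: xpq => [? ?]; move/andP: ypq => [? ?]; lra.
- by rewrite !ger0_norm; lra.
- by rewrite E mulrC.
Qed.

Lemma dwithin_bounded (f f' : R -> R) :
  (forall x : R, p <= x <= q -> has_dwithin J f x (f' x)) ->
  exists2 C : R, 0 <= C & forall x : R, p <= x <= q -> `|f x| <= C.
Proof.
move=> H; have [pq|qp] := leP p q; last first.
  by exists 0 => // x /andP[? ?]; lra.
have cf : {within J, continuous (fun x => `|f x|)}.
  move=> x; apply: cvg_norm; exact: dwithin_continuous H x.
have [c cpq cP] := EVT_max pq cf.
by exists `|f c| => // x xpq; apply: cP; rewrite in_itv.
Qed.

(** The existence of [f'''] makes [f''] continuous, hence bounded on the compact interval; that
    bound controls the Taylor remainder of [f]. *)
Lemma dwithin_C11 (f f' f'' f''' : R -> R) :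
  (forall x : R, p <= x <= q -> has_dwithin J f x (f' x)) ->
  (forall x : R, p <= x <= q -> has_dwithin J f' x (f'' x)) ->
  (forall x : R, p <= x <= q -> has_dwithin J f'' x (f''' x)) ->
  C11_on p q f f'.
Proof.
move=> H0 H1 H2.
have [A A0 HA] := dwithin_bounded H0.
have [B B0 HB] := dwithin_bounded H1.
have [C C0 HC] := dwithin_bounded H2.
exists (A + B + C) => x y xpq ypq.
have [c [cpq cy fE]] := dwithin_MVT H0 xpq ypq.
have [c1 [c1pq c1y f'E]] := dwithin_MVT H1 xpq ypq.
have [c2 [c2pq c2y f'E2]] := dwithin_MVT H1 cpq ypq.
split.
- by apply: le_trans (HA _ xpq) _; lra.
- by apply: le_trans (HB _ xpq) _; lra.
- rewrite fE normrM mulrC ler_wpM2r//; apply: le_trans (HB _ cpq) _; lra.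
- rewrite f'E normrM mulrC ler_wpM2r//; apply: le_trans (HC _ c1pq) _; lra.
- rewrite fE -mulrBr f'E2 normrX2 !normrM mulrA mulrAC.
  rewrite -mulrA [leRHS]mulrCA; apply: ler_wpM2l => //; apply: ler_pM => //.
  by apply: le_trans (HC _ c2pq) _; lra.
Qed.

End interval.
End derivative_within.

(** * Inner product and integral operators on paths *)

Section euclidean.
Context {R : realType} {n : nat}.
Implicit Types (u v x y : 'rV[R]_n).

Lemma mx_entry_le m p (A : 'M[R]_(m, p)) i j : `|A i j| <= `|A|.
Proof.
have -> : `|A| = mx_norm A by []; rewrite mx_normrE.
by apply: (le_bigmax _ (fun ij : 'I_m * 'I_p => `|A ij.1 ij.2|) (i, j)).
Qed.

Lemma mx_norm_le m p (A : 'M[R]_(m, p)) (c : R) : 0 <= c ->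
  (forall i j, `|A i j| <= c) -> `|A| <= c.
Proof.
move=> c0 H; have -> : `|A| = mx_norm A by []; rewrite mx_normrE.
by apply: bigmax_le => // -[i j] _; exact: H.
Qed.

Lemma dotC u v : dot u v = dot v u.
Proof. by apply: eq_bigr => i _; rewrite mulrC. Qed.

Lemma dot_linl c u u' v : dot (c *: u + u') v = c * dot u v + dot u' v.
Proof.
rewrite /dot mulr_sumr -big_split; apply: eq_bigr => i _.
by rewrite !mxE mulrDl mulrA.
Qed.

Lemma dot_linr c u v v' : dot u (c *: v + v') = c * dot u v + dot u v'.
Proof. by rewrite dotC dot_linl !(dotC u). Qed.

Lemma norm_dot_le u v : `|dot u v| <= n%:R * `|u| * `|v|.
Proof.
rewrite /dot; apply: le_trans (ler_norm_sum _ _ _) _.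
apply: (@le_trans _ _ (\sum_(i < n) `|u| * `|v|)).
  by apply: ler_sum => i _; rewrite normrM ler_pM// mx_entry_le.
by rewrite sumr_const card_ord -mulrA mulr_natl.
Qed.

Lemma dot_bounded_bilinear :
  @bounded_bilinear R 'rV[R]_n 'rV[R]_n R^o (@dot R n).
Proof.
split=> [c u u' v|c u v v'|].
- exact: dot_linl.
- exact: dot_linr.
- by exists n%:R; exact: norm_dot_le.
Qed.

Lemma dot0l v : dot 0 v = 0.
Proof. by rewrite /dot big1// => i _; rewrite mxE mul0r. Qed.

Lemma dot0r v : dot v 0 = 0. Proof. by rewrite dotC dot0l. Qed.

Lemma dotDl u u' v : dot (u + u') v = dot u v + dot u' v.
Proof. by have := dot_linl 1 u u' v; rewrite scale1r mul1r. Qed.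

Lemma dotZl c u v : dot (c *: u) v = c * dot u v.
Proof. by have := dot_linl c u 0 v; rewrite !addr0 dot0l addr0. Qed.

Lemma dotNl u v : dot (- u) v = - dot u v.
Proof. by rewrite -scaleN1r dotZl mulN1r. Qed.

Lemma dotDr u v v' : dot u (v + v') = dot u v + dot u v'.
Proof. by rewrite dotC dotDl !(dotC u). Qed.

Lemma dotZr c u v : dot u (c *: v) = c * dot u v.
Proof. by rewrite dotC dotZl dotC. Qed.

Lemma dotNr u v : dot u (- v) = - dot u v.
Proof. by rewrite dotC dotNl dotC. Qed.

Lemma dot_ge0 u : 0 <= dot u u.
Proof. by apply: sumr_ge0 => i _; rewrite -expr2 sqr_ge0. Qed.

(** Estimates run in the sup norm, whereas the curvature bound is Euclidean. This comparison
    converts the final error term, and also yields [v = 0] from [dot v v = 0]. *)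
Lemma sqr_norm_le_dot u : `|u| ^+ 2 <= dot u u.
Proof.
rewrite -ler_sqrt ?dot_ge0// sqrtr_sqr normr_id; apply: mx_norm_le => [|i j].
  exact: sqrtr_ge0.
rewrite ord1 -sqrtr_sqr ler_sqrt ?dot_ge0// /dot (bigD1 j)//= expr2 lerDl.
by apply: sumr_ge0 => k _; rewrite -expr2 sqr_ge0.
Qed.

Lemma dot_le_norm u : dot u u <= n%:R * `|u| ^+ 2.
Proof.
by rewrite expr2 mulrA; apply: le_trans (ler_norm _) (norm_dot_le u u).
Qed.

Definition outer x y : 'M[R]_n := x^T *m y.

Lemma outerE x y i j : outer x y i j = x 0 i * y 0 j.
Proof. by rewrite mxE big_ord1 mxE. Qed.

Lemma outer_bounded_bilinear : bounded_bilinear outer.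
Proof.
split=> [c u u' v|c u v v'|].
- apply/matrixP => i j; rewrite [RHS]mxE [X in _ = X + _]mxE !outerE !mxE.
  by rewrite mulrDl mulrA.
- apply/matrixP => i j; rewrite [RHS]mxE [X in _ = X + _]mxE !outerE !mxE.
  by rewrite mulrDr mulrCA.
- exists 1 => u v; rewrite mul1r; apply: mx_norm_le => [|i j].
    by rewrite mulr_ge0.
  by rewrite outerE normrM ler_pM// mx_entry_le.
Qed.

Lemma mul_outer (w x y : 'rV[R]_n) : w *m outer x y = dot w x *: y.
Proof.
apply/rowP => j; rewrite !mxE /dot mulr_suml; apply: eq_bigr => i _.
by rewrite outerE mulrA.
Qed.

Lemma mulmx_bounded_bilinear :
  bounded_bilinear (fun (w : 'rV[R]_n) (A : 'M[R]_n) => w *m A).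
Proof.
split=> [c u u' v|c u v v'|].
- by rewrite mulmxDl scalemxAl.
- by rewrite mulmxDr scalemxAr.
- exists n%:R => w A; apply: mx_norm_le => [|i j].
    by rewrite !mulr_ge0.
  rewrite mxE; apply: le_trans (ler_norm_sum _ _ _) _.
  apply: (@le_trans _ _ (\sum_(i < n) `|w| * `|A|)).
    by apply: ler_sum => k _; rewrite normrM ler_pM// mx_entry_le.
  by rewrite sumr_const card_ord -mulrA mulr_natl.
Qed.

Lemma scale_bounded_bilinear  (W : normedModType R) :
  @bounded_bilinear R R^o W W (fun (c : R) (y : W) => c *: y).
Proof.
split=> [c u u' v|c u v v'|].
- by rewrite scalerDl scalerA.
- by rewrite scalerDr !scalerA mulrC.
- by exists 1 => c v; rewrite mul1r normrZ.
Qed.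

Lemma mulr_bounded_bilinear : @bounded_bilinear R R^o R^o R^o *%R.
Proof.
split=> [c u u' v|c u v v'|].
- by rewrite mulrDl scalerAl.
- by rewrite mulrDr scalerAr.
- by exists 1 => u v; rewrite mul1r normrM.
Qed.

Lemma continuous_rowP (w : R -> 'rV[R]_n) :
  continuous w <-> forall i, continuous (fun t => w t 0 i).
Proof.
split=> [cw i t|cw t].
  by apply: (@continuous_comp _ _ _ w (fun x : 'rV[R]_n => x 0 i));
    [exact: cw|exact: coord_continuous].
apply/continuousP_eps => e e0.
have /choice[r rP] : forall i, exists r : R, 0 < r /\
    forall h : R, `|h| < r -> `|w (t + h) 0 i - w t 0 i| <= e.
  move=> i; have /continuousP_eps/(_ _ e0)[r r0 rP] := cw i t.
  by exists r.
exists (\big[Num.min/1]_(i < n) r i).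
  by apply: lt_bigmin => // i _; case: (rP i).
move=> h hr; apply: mx_norm_le; first exact: ltW.
move=> i j; rewrite ord1 !mxE; apply: (rP j).2.
by apply: lt_le_trans hr _; exact: bigmin_le.
Qed.

Definition VI (w : R -> 'rV[R]_n) (t : R) : 'rV[R]_n :=
  \row_i I (fun s => w s 0 i) t.

Lemma VI_operator : path_operator 1 VI.
Proof.
split=> [c w v cw cv t|w cw|w B cw wB t].
- move/continuous_rowP : cw => cw; move/continuous_rowP : cv => cv.
  apply/rowP => i; rewrite !mxE -I_lin//; congr (I _ t).
  by apply/funext => s; rewrite !mxE.
- move/continuous_rowP : cw => cw.
  apply/continuous_rowP => i.
  rewrite (_ : (fun t => _) = I (fun s => w s 0 i)); last first.
    by apply/funext => t; rewrite mxE.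
  exact: continuous_I.
- rewrite mul1r; apply: mx_norm_le.
    exact: le_trans (normr_ge0 _) (wB 0).
  move=> i j; rewrite ord1 mxE; apply: I_bound.
    by move/continuous_rowP : cw.
  by move=> s _; apply: le_trans (wB s); exact: mx_entry_le.
Qed.

End euclidean.

Section operators.
Context {R : realType} {n : nat}.
Local Notation E := 'rV[R]_n.

(* The solutions of [w'' = - u] with [w 0 = w' 0 = 0], and with
   [w 0 = w 1 = 0]. *)
Definition initial_op (u : R -> E) (t : R) : E := - VI (VI u) t.
Definition boundary_op (u : R -> E) (t : R) : E :=
  initial_op u t - clamp t *: initial_op u 1.

Lemma initial_op_operator : path_operator 1 initial_op.
Proof.
have [Il Ic Ib] := @VI_operator R n.
split=> [k w v cw cv t|w cw|w B cw wB t].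
- rewrite /initial_op.
  have -> : VI (fun s => k *: w s + v s) = fun s => k *: VI w s + VI v s.
    by apply/funext => s; apply: (Il).
  rewrite Il; [|exact: Ic|exact: Ic].
  by lmod R 'rV[R]_n.
- by move=> t; apply: cvgN; apply: (Ic); exact: Ic.
- rewrite normrN; apply: (Ib); first exact: Ic.
  by move=> s; rewrite -[B]mul1r; exact: Ib.
Qed.

Lemma initial_opE (u : R -> E) t : initial_op u t = - VI (VI u) t.
Proof. by []. Qed.

Lemma initial_op_coord (u : R -> E) t i :
  initial_op u t 0 i = - I (I (fun r => u r 0 i)) t.
Proof.
rewrite /initial_op [LHS]mxE [X in - X]mxE; congr (- I _ _).
by apply/funext => s; rewrite mxE.
Qed.

Opaque initial_op.

Lemma boundary_op_operator : path_operator 2 boundary_op.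
Proof.
have [Il Ic Ib] := initial_op_operator.
split=> [k w v cw cv t|w cw|w B cw wB t].
- by rewrite /boundary_op !(Il k w v cw cv); lmod R 'rV[R]_n.
- move=> t; apply: cvgB; first exact: Ic.
  by apply: cvgZl; exact: continuous_clamp.
- have B0 : 0 <= B by exact: le_trans (normr_ge0 _) (wB 0).
  rewrite (le_trans (ler_normB _ _))// mulr2n mulrDl.
  rewrite lerD ?Ib// normrZ -[leRHS]mul1r ler_pM ?norm_clamp//.
  by rewrite mul1r -[B]mul1r Ib.
Qed.

Lemma boundary_opE (u : R -> E) t :
  boundary_op u t = initial_op u t - clamp t *: initial_op u 1.
Proof. by []. Qed.

Opaque boundary_op.

Lemma scaled_operator (W : normedModType R) (c k : R) (T : (R -> W) -> R -> W) :
  0 <= c -> path_operator k T -> path_operator (c * k) (fun u t => c *: T u t).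
Proof.
move=> c0 [Tl Tc Tb]; split=> [a w v cw cv t|w cw t|w B cw wB t].
- by rewrite Tl//; lmod R W.
- by apply: cvgZr; exact: Tc.
- by rewrite normrZ ger0_norm// -mulrA ler_wpM2l// Tb.
Qed.

End operators.

(** * Radial potentials *)

Section radial.
Context {R : realType} {n : nat}.
Variable phi : nat -> R -> R.
Hypothesis phiC11 : forall (Q : R) k, C11_on 0 Q (phi k) (phi k.+1).
Local Notation E := 'rV[R]_n.
Implicit Types x y v : E.

Definition half_sq x : R := dot x x / 2.

Definition gradV x : E := phi 1%N (half_sq x) *: x.

Definition hessV x : 'M[R]_n :=
  phi 1%N (half_sq x) *: 1%:M + phi 2%N (half_sq x) *: outer x x.

Lemma half_sq_bounds x (B : R) : `|x| <= B ->
  0 <= half_sq x <= n%:R * B ^+ 2 / 2.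
Proof.
move=> xB; rewrite /half_sq divr_ge0 ?dot_ge0//= ler_wpM2r//.
apply: le_trans (dot_le_norm _) _; rewrite ler_wpM2l// lerXn2r// nnegrE//.
exact: le_trans xB.
Qed.

Lemma half_sqB x y :
  half_sq x - half_sq y = dot (x - y) y + dot (x - y) (x - y) / 2.
Proof.
rewrite /half_sq !(dotDl, dotDr, dotNl, dotNr) (dotC y x); field; exact: isT.
Qed.

(** One constant for all that is needed on a ball: the contraction (Lipschitz gradient, Hessian
    bound), linearization (Taylor for the gradient), the variation of the action (Taylor for the
    potential) and the confinement of paths (size of the force). *)
Definition radial_estimate (B L : R) := forall x y, `|x| <= B -> `|y| <= B ->
  [/\ `|gradV x - gradV y| <= L * `|x - y|,
      forall v, `|v *m hessV x| <= L * `|v|,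
      `|gradV x - gradV y - (x - y) *m hessV y| <= L * `|x - y| ^+ 2 &
      `|phi 0%N (half_sq x) - phi 0%N (half_sq y) - dot (gradV y) (x - y)|
        <= L * `|x - y| ^+ 2] /\ `|gradV x| <= L.

Lemma ex_radial_estimate (B : R) : 0 <= B ->
  exists2 L : R, 0 <= L & radial_estimate B L.
Proof.
move=> B0; pose Q := n%:R * B ^+ 2 / 2.
have [C C0 HC] : exists2 C : R, 0 <= C & forall k, (k < 3)%N ->
    forall x y : R, 0 <= x <= Q -> 0 <= y <= Q ->
    [/\ `|phi k x| <= C, `|phi k x - phi k y| <= C * `|x - y| &
      `|phi k x - phi k y - (x - y) * phi k.+1 y| <= C * (x - y) ^+ 2].
  have [C1 H1] := phiC11 Q 0; have [C2 H2] := phiC11 Q 1.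
  have [C3 H3] := phiC11 Q 2.
  exists (`|C1| + `|C2| + `|C3|) => [|k k3 x y xQ yQ].
    by rewrite !addr_ge0.
  have := H1 x y xQ yQ; have := H2 x y xQ yQ; have := H3 x y xQ yQ.
  move=> [a1 _ a3 _ a5] [b1 _ b3 _ b5] [c1 _ c3 _ c5].
  have l1 := ler_norm C1; have l2 := ler_norm C2; have l3 := ler_norm C3.
  have p1 := normr_ge0 C1; have p2 := normr_ge0 C2; have p3 := normr_ge0 C3.
  have up (z w c : R) : 0 <= w -> c <= `|C1| + `|C2| + `|C3| -> z <= c * w ->
      z <= (`|C1| + `|C2| + `|C3|) * w.
    by move=> w0 cC /le_trans; apply; rewrite ler_wpM2r.
  case: k k3 => [|[|[|//]]] _; split.
  - by apply: le_trans c1 _; lra.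
  - by apply: up c3 => //; lra.
  - by apply: up c5; rewrite ?sqr_ge0//; lra.
  - by apply: le_trans b1 _; lra.
  - by apply: up b3 => //; lra.
  - by apply: up b5; rewrite ?sqr_ge0//; lra.
  - by apply: le_trans a1 _; lra.
  - by apply: up a3 => //; lra.
  - by apply: up a5; rewrite ?sqr_ge0//; lra.
pose N : R := n%:R; have N0 : 0 <= N by rewrite ler0n.
pose K := 2 * N * B; have K0 : 0 <= K by rewrite !mulr_ge0.
(* The sum of all partial constants, so that each estimate only has to pick its own summands. *)
exists (C + C * B + C * K * B + C * N * B * B + C * K + C * (K * K) * B +
  C * N * B + C * (K * K) + C * N) => [|x y xB yB].
  by rewrite !addr_ge0// !mulr_ge0.
have q1 : 0 <= C * B by rewrite mulr_ge0.
have q2 : 0 <= C * K * B by rewrite !mulr_ge0.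
have q3 : 0 <= C * N * B * B by rewrite !mulr_ge0.
have q4 : 0 <= C * K by rewrite !mulr_ge0.
have q5 : 0 <= C * (K * K) * B by rewrite !mulr_ge0.
have q6 : 0 <= C * N * B by rewrite !mulr_ge0.
have q7 : 0 <= C * (K * K) by rewrite !mulr_ge0.
have q8 : 0 <= C * N by rewrite !mulr_ge0.
have hx := half_sq_bounds xB; have hy := half_sq_bounds yB.
set L := C + _ + _ + _ + _ + _ + _ + _ + _.
set a := half_sq x in hx *; set b := half_sq y in hy *.
have [v0 l0 t0] := HC 0 isT a b hx hy; have [v1 l1 t1] := HC 1 isT a b hx hy.
have [w1 _ _] := HC 1 isT b a hy hx.
have [v2 _ _] := HC 2 isT a b hx hy; have [w2 _ _] := HC 2 isT b a hy hx.
set d := x - y.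
have d0 := normr_ge0 d.
have dB : `|d| <= 2 * B by rewrite (le_trans (ler_normB _ _))//; lra.
have ab : a - b = dot d y + dot d d / 2 by exact: half_sqB.
have dd : `|dot d d / 2| <= N * `|d| ^+ 2.
  rewrite normrM (@ger0_norm _ 2^-1)// -[leRHS]mulr1 ler_pM//; last by lra.
  by rewrite expr2 mulrA norm_dot_le.
have abK : `|a - b| <= K * `|d|.
  rewrite ab; apply: le_trans (ler_normD _ _) _.
  have : `|dot d y| <= N * B * `|d|.
    apply: le_trans (norm_dot_le _ _) _; rewrite -/N -mulrA [leRHS]mulrAC
      -mulrA.
    by rewrite ler_wpM2l// ler_wpM2l.
  have : `|dot d d / 2| <= N * B * `|d|.
    rewrite normrM (@ger0_norm _ 2^-1)//.
    have : `|dot d d| <= N * `|d| * (2 * B).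
      by apply: le_trans (norm_dot_le _ _) _; rewrite ler_wpM2l// mulr_ge0.
    by move=> h; rewrite ler_pdivrMr//; apply: le_trans h _; rewrite le_eqVlt;
      apply/orP; left; apply/eqP; ring.
  by rewrite /K; lra.
have ab2 : (a - b) ^+ 2 <= K * K * `|d| ^+ 2.
  by rewrite normrX2 expr2 mulrACA ler_pM.
have dd0 : 0 <= `|d| ^+ 2 by rewrite sqr_ge0.
have up (z w c : R) : 0 <= w -> c <= L -> z <= c * w -> z <= L * w.
  by move=> w0 cC /le_trans; apply; rewrite ler_wpM2r.
split; last first.
  rewrite /gradV normrZ -/a; apply: (@le_trans _ _ (C * B));
    first exact: ler_pM.
  by rewrite /L; lra.
split.
- have -> : gradV x - gradV y =
      phi 1%N a *: d + (phi 1%N a - phi 1%N b) *: y by rewrite /gradV /d;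
        lmod R 'rV[R]_n.
  apply: (up _ _ (C + C * K * B)) => //; first by rewrite /L; lra.
  rewrite mulrDl; apply: le_trans (ler_normD _ _) _; rewrite !normrZ lerD//.
    by rewrite ler_wpM2r.
  rewrite [leRHS]mulrAC ler_pM// -mulrA; apply: le_trans l1 _.
  by rewrite ler_wpM2l.
- move=> v; rewrite /hessV -/a mulmxDr -!scalemxAr mulmx1 mul_outer.
  apply: (up _ _ (C + C * N * B * B)) => //; first by rewrite /L; lra.
  rewrite mulrDl; apply: le_trans (ler_normD _ _) _; rewrite !normrZ lerD//.
    by rewrite ler_wpM2r.
  have h : `|dot v x| <= N * `|v| * B.
    by apply: le_trans (norm_dot_le _ _) _; rewrite ler_wpM2l// mulr_ge0.
  have -> : C * N * B * B * `|v| = C * (N * `|v| * B * B) by ring.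
  by rewrite ler_pM ?mulr_ge0// ler_pM.
(* The part of [a - b] linear in [d] is absorbed by the Hessian. The rest is of second order: the
   increment of [phi 1] times [d], the Taylor remainder of [phi 1], and [dot d d / 2]. *)
- have -> : gradV x - gradV y - d *m hessV y = (phi 1%N a - phi 1%N b) *: d +
      ((phi 1%N a - phi 1%N b - (a - b) * phi 2%N b) *: y +
      (phi 2%N b * (dot d d / 2)) *: y).
    rewrite ab /hessV -/b mulmxDr -!scalemxAr mulmx1 mul_outer /gradV -/a -/b.
    by rewrite /d; lmod R 'rV[R]_n.
  apply: (up _ _ (C * K + (C * (K * K) * B + C * N * B))) => //.
    by rewrite /L; lra.
  rewrite [leRHS]mulrDl [X in _ <= _ + X]mulrDl.
  apply: le_trans (ler_normD _ _) _; apply: lerD.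
    rewrite normrZ expr2 mulrA ler_wpM2r// -mulrA; apply: le_trans l1 _.
    by rewrite ler_wpM2l.
  apply: le_trans (ler_normD _ _) _; rewrite !normrZ; apply: lerD.
    rewrite [leRHS]mulrAC ler_pM//; apply: le_trans t1 _.
    by rewrite -mulrA ler_wpM2l.
  rewrite [leRHS]mulrAC ler_pM ?mulr_ge0// -normrM -mulrA ler_pM//.
- have -> : phi 0%N a - phi 0%N b - dot (gradV y) d =
      (phi 0%N a - phi 0%N b - (a - b) * phi 1%N b) + phi 1%N b * (dot d d / 2).
    by rewrite ab /gradV dotZl (dotC y) -/b; ring.
  apply: (up _ _ (C * (K * K) + C * N)) => //; first by rewrite /L; lra.
  rewrite [leRHS]mulrDl; apply: le_trans (ler_normD _ _) _; apply: lerD.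
    by apply: le_trans t0 _; rewrite -mulrA ler_wpM2l.
  by rewrite -[leRHS]mulrA normrM ler_pM.
Qed.

Section along_families.
Variables (d B : R).

Lemma family_derivD (W : normedModType R) (a b a' b' : R -> R -> W) :
  family_deriv d a a' -> family_deriv d b b' ->
  family_deriv d (fun s t => a s t + b s t) (fun s t => a' s t + b' s t).
Proof.
move=> fa fb; apply: eq_family_deriv (family_deriv_lin 1 fa fb) => s t _ /=;
  by rewrite scale1r.
Qed.

Lemma family_derivZ (W : normedModType R) (c : R) (a a' : R -> R -> W) :
  family_deriv d a a' ->
  family_deriv d (fun s t => c *: a s t) (fun s t => c *: a' s t).
Proof.
move=> fa; apply: eq_family_deriv (family_deriv_lin (c - 1) fa fa) => s t _ /=;
  by rewrite scalerBl scale1r subrK.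
Qed.

Lemma family_deriv_half_sq (X X' : R -> R -> E) : family_deriv d X X' ->
  @family_deriv R R^o d (fun s t => half_sq (X s t))
    (fun s t => dot (X s t) (X' s t)).
Proof.
move=> fX; have := family_deriv_bilinear dot_bounded_bilinear fX fX.
move=> /(family_derivZ 2^-1); apply: eq_family_deriv => s t _.
  by rewrite /half_sq /GRing.scale/= mulrC.
rewrite /GRing.scale/= (dotC (X' s t)); field; exact: isT.
Qed.

Lemma family_deriv_phi k (X X' : R -> R -> E) :
  (forall s t : R, `|s| < d -> `|X s t| <= B) -> family_deriv d X X' ->
  @family_deriv R R^o d (fun s t => phi k (half_sq (X s t)))
    (fun s t => phi k.+1 (half_sq (X s t)) * dot (X s t) (X' s t)).
Proof.
move=> XB fX.
apply: (family_deriv_comp (phiC11 (n%:R * B ^+ 2 / 2) k)).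
  by move=> s t sd; apply: half_sq_bounds; exact: XB.
exact: family_deriv_half_sq.
Qed.

Lemma family_deriv_dot (X X' Y Y' : R -> R -> E) :
  family_deriv d X X' -> family_deriv d Y Y' ->
  @family_deriv R R^o d (fun s t => dot (X s t) (Y s t))
    (fun s t => dot (X' s t) (Y s t) + dot (X s t) (Y' s t)).
Proof. exact: (family_deriv_bilinear dot_bounded_bilinear). Qed.

Lemma family_deriv_outer (X X' Y Y' : R -> R -> E) :
  family_deriv d X X' -> family_deriv d Y Y' ->
  family_deriv d (fun s t => outer (X s t) (Y s t))
    (fun s t => outer (X' s t) (Y s t) + outer (X s t) (Y' s t)).
Proof. exact: (family_deriv_bilinear outer_bounded_bilinear). Qed.

Lemma family_deriv_mulmx (X X' : R -> R -> E) (A A' : R -> R -> 'M[R]_n) :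
  family_deriv d X X' -> family_deriv d A A' ->
  family_deriv d (fun s t => X s t *m A s t)
    (fun s t => X' s t *m A s t + X s t *m A' s t).
Proof. exact: (family_deriv_bilinear mulmx_bounded_bilinear). Qed.

Lemma family_deriv_scale (W : normedModType R) (a a' : R -> R -> R)
    (X X' : R -> R -> W) :
  @family_deriv R R^o d a a' -> family_deriv d X X' ->
  family_deriv d (fun s t => a s t *: X s t)
    (fun s t => a' s t *: X s t + a s t *: X' s t).
Proof. exact: (family_deriv_bilinear (scale_bounded_bilinear W)). Qed.

Lemma family_derivM (a a' b b' : R -> R -> R) :
  @family_deriv R R^o d a a' -> @family_deriv R R^o d b b' ->
  @family_deriv R R^o d (fun s t => a s t * b s t)
    (fun s t => a' s t * b s t + a s t * b' s t).
Proof. exact: (family_deriv_bilinear (mulr_bounded_bilinear)). Qed.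

Lemma family_deriv_gradV (X X' : R -> R -> E) :
  (forall s t : R, `|s| < d -> `|X s t| <= B) -> family_deriv d X X' ->
  family_deriv d (fun s t => gradV (X s t)) (fun s t =>
    X' s t *m hessV (X s t)).
Proof.
move=> XB fX; have := family_deriv_scale (family_deriv_phi 1 XB fX) fX.
apply: eq_family_deriv => s t _ //.
rewrite /hessV mulmxDr -!scalemxAr mulmx1 mul_outer (dotC (X' s t)).
by rewrite scalerA addrC.
Qed.

Definition dhessV (x x1 : E) : 'M[R]_n :=
  (phi 2%N (half_sq x) * dot x x1) *: 1%:M +
  ((phi 3%N (half_sq x) * dot x x1) *: outer x x +
   phi 2%N (half_sq x) *: (outer x1 x + outer x x1)).

(** Second derivative of the Hessian along a path with velocity [x1] and acceleration [x2]. For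
    [x2 = 0] the quadratic form of this matrix at [u] is the fourth derivative of the potential in
    the directions [u, u, x1, x1]. *)
Definition ddhessV (x x1 x2 : E) : 'M[R]_n :=
  let q1 := dot x x1 in let q2 := dot x1 x1 + dot x x2 in
  let p k := phi k (half_sq x) in
  (p 3%N * q1 * q1 + p 2%N * q2) *: 1%:M +
  ((p 4%N * q1 * q1 + p 3%N * q2) *: outer x x +
   (2 * (p 3%N * q1)) *: (outer x1 x + outer x x1) +
   p 2%N *: (outer x2 x + 2 *: outer x1 x1 + outer x x2)).

Lemma family_deriv_id : @family_deriv R 'M[R]_n d (fun _ _ => 1%:M)
  (fun _ _ => 0).
Proof.
apply: (@family_deriv_cst R 'M[R]_n d (fun=> 1%:M) `|1%:M : 'M[R]_n|) => //.
by move=> ?; exact: cvg_cst.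
Qed.

Lemma family_deriv_hessV (X X' : R -> R -> E) :
  (forall s t : R, `|s| < d -> `|X s t| <= B) -> family_deriv d X X' ->
  family_deriv d (fun s t => hessV (X s t))
    (fun s t => dhessV (X s t) (X' s t)).
Proof.
move=> XB fX.
have := family_derivD
  (family_deriv_scale (family_deriv_phi 1 XB fX) family_deriv_id)
  (family_deriv_scale (family_deriv_phi 2 XB fX) (family_deriv_outer fX fX)).
by apply: eq_family_deriv => s t _ //; rewrite /dhessV scaler0 addr0.
Qed.

Lemma family_deriv_dhessV (X X' X'' : R -> R -> E) :
  (forall s t : R, `|s| < d -> `|X s t| <= B) ->
  family_deriv d X X' -> family_deriv d X' X'' ->
  family_deriv d (fun s t => dhessV (X s t) (X' s t))
    (fun s t => ddhessV (X s t) (X' s t) (X'' s t)).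
Proof.
move=> XB fX fX'.
have f2 := family_deriv_phi 2 XB fX; have f3 := family_deriv_phi 3 XB fX.
have fq := family_deriv_dot fX fX'.
have := family_derivD (family_deriv_scale (family_derivM f2 fq) family_deriv_id)
  (family_derivD
    (family_deriv_scale (family_derivM f3 fq) (family_deriv_outer fX fX))
    (family_deriv_scale f2 (family_derivD (family_deriv_outer fX' fX)
       (family_deriv_outer fX fX')))).
apply: eq_family_deriv => s t _ //; rewrite /ddhessV /=.
by lmod R 'M[R]_n.
Qed.

End along_families.
End radial.

(** * Solutions of the integral equations *)

Section fixed_paths.
Context {R : realType}.

(** Plays the role of a Gronwall inequality. Some bound on [w] must be known beforehand; the
    contraction then replaces it by an explicit one. *)
Lemma fixed_path_bound (W : normedModType R) (k L A D : R)
    (T : (R -> W) -> R -> W) (w b g : R -> W) :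
  0 <= k -> 0 <= L -> k * L <= 1 / 2 -> path_operator k T ->
  continuous g -> (exists C : R, forall t, `|w t| <= C) ->
  (forall t, w t = b t + T g t) -> (forall t, `|b t| <= A) ->
  (forall t, `|g t| <= L * `|w t| + D) ->
  forall t, `|w t| <= 2 * (A + k * D).
Proof.
move=> k0 L0 kL [_ _ Tb] cg wC weq bA gL.
apply: (@bound_of_self_improvement R R (fun t => `|w t|)) => // B B0 wB t.
rewrite weq; apply: le_trans (ler_normD _ _) _.
have : `|T g t| <= k * (L * B + D).
  by apply: Tb => // s; apply: le_trans (gL s) _; rewrite lerD2r ler_wpM2l.
have : k * L * B <= 1 / 2 * B by rewrite ler_wpM2r.
have := bA t; rewrite mulrDr mulrA; lra.
Qed.

Lemma bounded_family_lip (W1 W2 : normedModType R) (d B L : R) (F : W1 -> W2)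
    (a : R -> R -> W1) :
  (forall x y : W1, `|x| <= B -> `|y| <= B ->
    `|F x - F y| <= L * `|x - y| /\ `|F x| <= L) ->
  (forall s t : R, `|s| < d -> `|a s t| <= B) ->
  bounded_family d a -> bounded_family d (fun s t => F (a s t)).
Proof.
move=> FL aB [C HC]; exists L => s sd; have [ca _] := HC s sd.
split=> [t|t]; last by have [] := FL _ _ (aB s t sd) (aB s t sd).
have L0 : 0 <= L.
  have [_] := FL _ _ (aB s t sd) (aB s t sd); exact: le_trans.
apply/continuousP_eps => e e0.
have e1 : 0 < e / (L + 1) by rewrite divr_gt0// ltr_wpDl.
have /continuousP_eps/(_ _ e1)[r r0 Hr] := ca t.
exists r => // h /Hr {}Hr.
have [+ _] := FL _ _ (aB s (t + h) sd) (aB s t sd) => /le_trans; apply.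
apply: (@le_trans _ _ (L * (e / (L + 1)))); first by rewrite ler_wpM2l.
by rewrite mulrCA ler_piMr ?(ltW e0)// ler_pdivrMr ?mul1r ?lerDl// ltr_wpDl.
Qed.

End fixed_paths.

Section radial_fixed_paths.
Context {R : realType} {n : nat}.
Variable phi : nat -> R -> R.
Hypothesis phiC11 : forall (Q : R) k, C11_on 0 Q (phi k) (phi k.+1).
Local Notation E := 'rV[R]_n.
Local Notation gradV := (@gradV R n phi).
Local Notation hessV := (@hessV R n phi).
Local Notation dhessV := (@dhessV R n phi).

Variables (B L k : R) (T : (R -> E) -> R -> E).
Hypotheses (B0 : 0 <= B) (L0 : 0 <= L) (k0 : 0 <= k) (kL : k * L <= 1 / 2).
Hypothesis Tk : path_operator k T.
Hypothesis estL : radial_estimate (n := n) phi B L.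

Lemma continuous_gradV (x : R -> E) : continuous x ->
  (forall t, `|x t| <= B) -> continuous (fun t => gradV (x t)).
Proof.
move=> cx xB.
have : bounded_family 1 (fun (_ : R) t => gradV (x t)).
  apply: (@bounded_family_lip _ _ _ 1 B L gradV (fun=> x)) => //.
    by move=> y z yB zB; have [[? _ _ _] ?] := estL yB zB.
  by exists B.
by move=> [C /(_ 0)]; rewrite normr0 => /(_ ltr01)[].
Qed.

(** Continuous dependence on the data; with [A = 0] it is uniqueness of trajectories. *)
Lemma fixed_path_dist (x y b c : R -> E) (A : R) :
  continuous x -> continuous y ->
  (forall t, `|x t| <= B) -> (forall t, `|y t| <= B) ->
  (forall t, x t = b t + T (fun s => gradV (x s)) t) ->
  (forall t, y t = c t + T (fun s => gradV (y s)) t) ->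
  (forall t, `|b t - c t| <= A) -> forall t, `|x t - y t| <= 2 * A.
Proof.
move=> cx cy xB yB xE yE bcA.
have gx := continuous_gradV cx xB; have gy := continuous_gradV cy yB.
have := @fixed_path_bound R _ k L A 0 T (fun t => x t - y t)
  (fun t => b t - c t) (fun s => (-1) *: gradV (y s) + gradV (x s)) k0 L0 kL Tk.
rewrite mulr0 addr0; apply=> //.
- by move=> t; apply: cvgD; [apply: cvgZr; exact: gy|exact: gx].
- by exists (B + B) => t; rewrite (le_trans (ler_normB _ _))// lerD.
- move=> t; rewrite xE yE.
  by have [Tl _ _] := Tk; rewrite Tl//; lmod R 'rV[R]_n.
- move=> t; rewrite addr0 scaleN1r addrC.
  by have [[]] := estL (xB t) (yB t).
Qed.

(** Serves two problems: with [initial_op] for trajectories of varying covector, and with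
    [boundary_op] for trajectories of varying base point and fixed endpoint. In the second case [w']
    is the Jacobi field. *)
Lemma gradV_family_deriv (d : R) (w b b' : R -> R -> E) :
  bounded_family d w -> (forall s t : R, `|s| < d -> `|w s t| <= B) ->
  family_deriv d b b' ->
  (forall s t : R, `|s| < d -> w s t = b s t + T (fun r => gradV (w s r)) t) ->
  exists2 w', family_deriv d w w' &
    forall s t : R, `|s| < d ->
      w' s t = b' s t + T (fun r => w' s r *m hessV (w s r)) t.
Proof.
move=> fw wB fb weq.
have fG : bounded_family d (fun s r => gradV (w s r)).
  apply: (bounded_family_lip (B := B) (L := L)) => // x y xB yB.
  by have [[? _ _ _] ?] := estL xB yB.
have [Lw Lw0 wL] : exists2 D : R, 0 <= D & forall s h t : R, `|s| < d ->
    `|s + h| < d -> `|w (s + h) t - w s t| <= D * `|h|.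
  apply: (fixed_family_lip k0 L0 kL Tk fw fG fb weq (C := 0)).
  move=> s h t sd shd; rewrite mul0r addr0.
  by have [[]] := estL (wB _ t shd) (wB _ t sd).
have [w' fw'] : exists w', family_deriv d w w'.
  apply: (fixed_family_deriv k0 L0 kL Tk fw fG fb weq
    (M := fun s t v => v *m hessV (w s t)) (err := fun _ _ => 0)
    (C := L * (Lw * Lw))).
  - by move=> s t sd c u v; rewrite mulmxDl scalemxAl.
  - by move=> s t sd v; have [[_ ? _ _] _] := estL (wB s t sd) (wB s t sd).
  - by exists 0 => s sd; split=> [t|t]; [exact: cvg_cst|rewrite normr0].
  - move=> s h t sd shd; rewrite scaler0 subr0.
    have [[_ _ + _] _] := estL (wB _ t shd) (wB _ t sd) => /le_trans; apply.
    rewrite -mulrA ler_wpM2l// expr2 normrX2 mulrACA.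
    by rewrite ler_pM// wL.
exists w' => // s t sd.
have fGd := family_deriv_gradV phiC11 wB fw'.
have := family_derivD fb (family_deriv_operator k0 Tk fGd).
move/(family_deriv_uniq t fw'); apply=> //.
Qed.

(** Differentiates a linearized equation once more. It is applied to the first variation of the
    trajectory, to the Jacobi field, and to the derivative of the Jacobi field; the source [c] is
    what the third case requires. *)
Lemma linear_family_deriv (d : R) (X X' J b b' c c' : R -> R -> E) :
  (forall s t : R, `|s| < d -> `|X s t| <= B) -> family_deriv d X X' ->
  bounded_family d J -> family_deriv d b b' -> family_deriv d c c' ->
  (forall s t : R, `|s| < d ->
    J s t = b s t + T (fun r => J s r *m hessV (X s r) + c s r) t) ->
  exists2 J', family_deriv d J J' &
    forall s t : R, `|s| < d -> J' s t = b' s t +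
      T (fun r => J' s r *m hessV (X s r) + J s r *m dhessV (X s r) (X' s r) +
                  c' s r) t.
Proof.
move=> XB fX fJ fb fc Jeq.
have fH := family_deriv_hessV phiC11 XB fX.
have [fH0 fH1 _] := fH; have [fc0 fc1 _] := fc.
have fG : bounded_family d (fun s r => J s r *m hessV (X s r) + c s r).
  have H := bounded_family_bilinear mulmx_bounded_bilinear fJ fH0.
  apply: eq_bounded_family (bounded_family_lin 1 H fc0) => s t _.
  by rewrite scale1r.
have [K K0 mulK] := bounded_bilinear_ge0 (@mulmx_bounded_bilinear R n).
have [D D0 HD] := bounded_family_ge0 fJ.
have [Lh Lh0 HLh] := family_deriv_lip fH; have [Lc Lc0 HLc] :=
  family_deriv_lip fc.
have Hlin s t : `|s| < d -> forall v : E, `|v *m hessV (X s t)| <= L * `|v|.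
  by move=> sd v; have [[_ ? _ _] _] := estL (XB s t sd) (XB s t sd).
(* The increment of [J] is paired with the Hessian at [s], the fixed linear operator of the
   contraction; the increment of the Hessian goes into the source. *)
have split1 s h t : J (s + h) t *m hessV (X (s + h) t) + c (s + h) t -
    (J s t *m hessV (X s t) + c s t) =
    (J (s + h) t - J s t) *m hessV (X s t) +
    (J (s + h) t *m (hessV (X (s + h) t) - hessV (X s t)) +
     (c (s + h) t - c s t)).
  by rewrite mulmxBl mulmxBr; lmod R 'rV[R]_n.
have [LJ LJ0 JL] : exists2 D : R, 0 <= D & forall s h t : R, `|s| < d ->
    `|s + h| < d -> `|J (s + h) t - J s t| <= D * `|h|.
  apply: (fixed_family_lip k0 L0 kL Tk fJ fG fb Jeq (C := K * D * Lh + Lc)).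
  move=> s h t sd shd; rewrite split1.
  apply: le_trans (ler_normD _ _) _; apply: lerD; first exact: Hlin.
  rewrite mulrDl; apply: le_trans (ler_normD _ _) _; apply: lerD;
    last exact: HLc.
  apply: le_trans (mulK _ _) _; rewrite -[leRHS]mulrA ler_pM ?mulr_ge0//.
    by rewrite ler_wpM2l//; have [_] := HD _ shd.
  exact: HLh.
have [A A0 HA] := family_deriv_ge0 fH; have [A' A'0 HA'] := family_deriv_ge0 fc.
have [D1 D10 HD1] := bounded_family_ge0 fH1.
have [J' fJ'] : exists J', family_deriv d J J'.
  apply: (fixed_family_deriv k0 L0 kL Tk fJ fG fb Jeq
    (M := fun s t v => v *m hessV (X s t))
    (err := fun s t => J s t *m dhessV (X s t) (X' s t) + c' s t)
    (C := K * D * A + K * LJ * D1 + A')).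
  - by move=> s t sd x u v; rewrite mulmxDl scalemxAl.
  - by move=> s t sd v; exact: Hlin.
  - have H := bounded_family_bilinear mulmx_bounded_bilinear fJ fH1.
    apply: eq_bounded_family (bounded_family_lin 1 H fc1) => s t _.
    by rewrite scale1r.
  - move=> s h t sd shd; rewrite split1.
    have -> : (J (s + h) t - J s t) *m hessV (X s t) +
      (J (s + h) t *m (hessV (X (s + h) t) - hessV (X s t)) +
       (c (s + h) t - c s t)) - (J (s + h) t - J s t) *m hessV (X s t) -
       h *: (J s t *m dhessV (X s t) (X' s t) + c' s t) =
      J (s + h) t *m (hessV (X (s + h) t) - hessV (X s t) -
        h *: dhessV (X s t) (X' s t)) +
      h *: ((J (s + h) t - J s t) *m dhessV (X s t) (X' s t)) +
      (c (s + h) t - c s t - h *: c' s t).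
      rewrite !(mulmxBr, mulmxBl) -scalemxAr; lmod R 'rV[R]_n.
    rewrite !mulrDl; apply: le_trans (ler_normD _ _) _; apply: lerD;
      last exact: HA'.
    apply: le_trans (ler_normD _ _) _; apply: lerD.
      apply: le_trans (mulK _ _) _; rewrite -[leRHS]mulrA ler_pM ?mulr_ge0//.
        by rewrite ler_wpM2l//; have [_] := HD _ shd.
      exact: HA.
    rewrite normrZ.
    have -> : K * LJ * D1 * h ^+ 2 = `|h| * (K * (LJ * `|h|) * D1).
      by rewrite normrX2; ring.
    rewrite ler_wpM2l//; apply: le_trans (mulK _ _) _.
    rewrite ler_pM ?mulr_ge0//; first by rewrite ler_wpM2l// JL.
    by have [_] := HD1 _ sd.
exists J' => // s t sd.
have fGd := family_derivD (family_deriv_mulmx fJ' fH) fc.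
have := family_derivD fb (family_deriv_operator k0 Tk fGd).
by move/(family_deriv_uniq t fJ'); apply.
Qed.

End radial_fixed_paths.

(** * The second variation of the Jacobi field *)

Section near_families.
Context {R : realType} {Idx : Type}.
Variables (P : Idx -> Prop) (e : Idx -> R).
Hypothesis e0 : forall i, P i -> 0 <= e i.
Implicit Types (W : normedModType R) (S : Idx -> R).

(** [S] is the homogeneous size of a quantity, [a0] its unperturbed value and [e] the perturbation
    parameter. One [K] serves the whole index type, which later contains all data, so the constants
    are uniform in them. *)
Definition near_family W S (a a0 : Idx -> W) :=
  exists2 K : R, 0 <= K & forall i, P i ->
    [/\ `|a i| <= K * S i, `|a0 i| <= K * S i &
        `|a i - a0 i| <= K * (e i * S i)].

Definition nonneg_weight S := forall i, P i -> 0 <= S i.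

Lemma near_familyD W S (a a0 b b0 : Idx -> W) :
  near_family S a a0 -> near_family S b b0 ->
  near_family S (fun i => a i + b i) (fun i => a0 i + b0 i).
Proof.
move=> [K K0 HK] [M M0 HM]; exists (K + M) => [|i Pi];
  first by rewrite addr_ge0.
have [k1 k2 k3] := HK i Pi; have [m1 m2 m3] := HM i Pi.
split; rewrite mulrDl.
- by rewrite (le_trans (ler_normD _ _))// lerD.
- by rewrite (le_trans (ler_normD _ _))// lerD.
- have -> : a i + b i - (a0 i + b0 i) = (a i - a0 i) + (b i - b0 i) by lmod R W.
  by rewrite (le_trans (ler_normD _ _))// lerD.
Qed.

Lemma near_familyZ W S (c : R) (a a0 : Idx -> W) :
  near_family S a a0 ->
  near_family S (fun i => c *: a i) (fun i => c *: a0 i).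
Proof.
move=> [K K0 HK]; exists (`|c| * K) => [|i Pi]; first by rewrite mulr_ge0.
have [k1 k2 k3] := HK i Pi.
by split; rewrite -?scalerBr normrZ -mulrA ler_wpM2l.
Qed.

Lemma near_family_bilinear (W1 W2 W3 : normedModType R) (F : W1 -> W2 -> W3)
    S S' (a a0 : Idx -> W1) (b b0 : Idx -> W2) :
  nonneg_weight S -> nonneg_weight S' ->
  bounded_bilinear F -> near_family S a a0 -> near_family S' b b0 ->
  near_family (fun i => S i * S' i) (fun i => F (a i) (b i))
    (fun i => F (a0 i) (b0 i)).
Proof.
move=> S0 S0' Fb [K K0 HK] [M M0 HM].
have [C C0 HC] := bounded_bilinear_ge0 Fb; have [Fl Fr] := bilinear_sub Fb.
exists (2 * C * K * M) => [|i Pi]; first by rewrite !mulr_ge0.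
have [k1 k2 k3] := HK i Pi; have [m1 m2 m3] := HM i Pi.
have s0 := S0 i Pi; have s0' := S0' i Pi; have ei := e0 Pi.
have bd (u : W1) (v : W2) (x y : R) : 0 <= x -> 0 <= y ->
    `|u| <= K * x -> `|v| <= M * y -> `|F u v| <= C * K * M * (x * y).
  move=> x0 y0 ux vy; apply: le_trans (HC _ _) _.
  have -> : C * K * M * (x * y) = C * (K * x) * (M * y) by ring.
  by rewrite ler_pM ?mulr_ge0// ler_wpM2l.
have bd2 (u : W1) (v : W2) (x y : R) : 0 <= x -> 0 <= y ->
    `|u| <= K * x -> `|v| <= M * y -> `|F u v| <= 2 * C * K * M * (x * y).
  move=> x0 y0 ux vy; apply: le_trans (bd _ _ _ _ x0 y0 ux vy) _.
  by rewrite ler_wpM2r ?mulr_ge0// -!mulrA ler_peMl ?mulr_ge0// ler1n.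
split; [exact: bd2|exact: bd2|].
have -> : F (a i) (b i) - F (a0 i) (b0 i) =
    F (a i - a0 i) (b i) + F (a0 i) (b i - b0 i).
  by rewrite Fl Fr; lmod R W3.
apply: le_trans (ler_normD _ _) _.
have := bd _ _ _ _ (mulr_ge0 ei s0) s0' k3 m1.
have := bd _ _ _ _ s0 (mulr_ge0 ei s0') k2 m3.
rewrite (_ : S i * (e i * S' i) = e i * (S i * S' i)); last by ring.
rewrite (_ : e i * S i * S' i = e i * (S i * S' i)); last by ring.
by rewrite -!(mulrA 2); lra.
Qed.

Lemma eq_near_family W S S' (a a0 b b0 : Idx -> W) :
  (forall i, P i -> S i = S' i) -> (forall i, P i -> a i = b i) ->
  (forall i, P i -> a0 i = b0 i) ->
  near_family S a a0 -> near_family S' b b0.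
Proof.
move=> SS ab ab0 [K K0 HK]; exists K => // i Pi.
by rewrite -SS// -ab// -ab0//; exact: HK.
Qed.

End near_families.

Section near_radial.
Context {R : realType} {n : nat} {Idx : Type}.
Variable phi : nat -> R -> R.
Hypothesis phiC11 : forall (Q : R) k, C11_on 0 Q (phi k) (phi k.+1).
Local Notation E := 'rV[R]_n.
Variables (P : Idx -> Prop) (e : Idx -> R) (B : R).
Hypothesis e0 : forall i, P i -> 0 <= e i.
Variables (X X0 X1 Y1 X2 Y2 : Idx -> E) (S : Idx -> R).
Hypothesis S0 : nonneg_weight P S.
Hypothesis XB : forall i, P i -> `|X i| <= B /\ `|X0 i| <= B.
Hypothesis nX : near_family P e (fun=> 1) X X0.
Hypothesis nX1 : near_family P e S X1 Y1.
Hypothesis nX2 : near_family P e (fun i => S i * S i) X2 Y2.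

Let one0 : nonneg_weight P (fun=> 1 : R). Proof. by []. Qed.
Let SS0 : nonneg_weight P (fun i => S i * S i).
Proof. by move=> i Pi; rewrite mulr_ge0// S0. Qed.

Let nscale (W : normedModType R) (S1 S2 S3 : Idx -> R) (a a0 : Idx -> R)
    (b b0 : Idx -> W) :
  nonneg_weight P S1 -> nonneg_weight P S2 ->
  (forall i, S1 i * S2 i = S3 i) ->
  @near_family R Idx P e R^o S1 a a0 -> near_family P e S2 b b0 ->
  near_family P e S3 (fun i => a i *: b i) (fun i => a0 i *: b0 i).
Proof.
move=> h1 h2 E3 na nb.
apply: eq_near_family (near_family_bilinear e0 h1 h2
  (scale_bounded_bilinear W) na nb) => // i _; exact: E3.
Qed.

Let nmul (S1 S2 S3 : Idx -> R) (a a0 b b0 : Idx -> R) :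
  nonneg_weight P S1 -> nonneg_weight P S2 ->
  (forall i, S1 i * S2 i = S3 i) ->
  @near_family R Idx P e R^o S1 a a0 -> @near_family R Idx P e R^o S2 b b0 ->
  @near_family R Idx P e R^o S3 (fun i => a i * b i) (fun i => a0 i * b0 i).
Proof.
move=> h1 h2 E3 na nb.
apply: eq_near_family (near_family_bilinear e0 h1 h2
  mulr_bounded_bilinear na nb) => // i _; exact: E3.
Qed.

Let ndot (S1 S2 S3 : Idx -> R) (a a0 b b0 : Idx -> E) :
  nonneg_weight P S1 -> nonneg_weight P S2 ->
  (forall i, S1 i * S2 i = S3 i) ->
  near_family P e S1 a a0 -> near_family P e S2 b b0 ->
  @near_family R Idx P e R^o S3 (fun i => dot (a i) (b i))
    (fun i => dot (a0 i) (b0 i)).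
Proof.
move=> h1 h2 E3 na nb.
apply: eq_near_family (near_family_bilinear e0 h1 h2
  dot_bounded_bilinear na nb) => // i _; exact: E3.
Qed.

Let nouter (S1 S2 S3 : Idx -> R) (a a0 b b0 : Idx -> E) :
  nonneg_weight P S1 -> nonneg_weight P S2 ->
  (forall i, S1 i * S2 i = S3 i) ->
  near_family P e S1 a a0 -> near_family P e S2 b b0 ->
  near_family P e S3 (fun i => outer (a i) (b i))
    (fun i => outer (a0 i) (b0 i)).
Proof.
move=> h1 h2 E3 na nb.
apply: eq_near_family (near_family_bilinear e0 h1 h2
  outer_bounded_bilinear na nb) => // i _; exact: E3.
Qed.

Let nphi k : @near_family R Idx P e R^o (fun=> 1)
  (fun i => phi k (half_sq (X i))) (fun i => phi k (half_sq (X0 i))).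
Proof.
have nq : @near_family R Idx P e R^o (fun=> 1) (fun i => half_sq (X i))
    (fun i => half_sq (X0 i)).
  have := near_familyZ 2^-1 (ndot one0 one0 (fun=> mulr1 _) nX nX).
  by apply: eq_near_family => // i _; rewrite /half_sq mulrC.
have [C HC] := phiC11 (n%:R * B ^+ 2 / 2) k; have [K K0 HK] := nq.
exists (`|C| + `|C| * K) => [|i Pi]; first by rewrite addr_ge0// mulr_ge0.
have [XiB X0iB] := XB Pi.
have hX := half_sq_bounds XiB; have hX0 := half_sq_bounds X0iB.
have [c1 _ c2 _ _] := HC _ _ hX hX0; have [c3 _ _ _ _] := HC _ _ hX0 hX.
have [k1 k2 k3] := HK i Pi.
have CC := ler_norm C; have CK : 0 <= `|C| * K by rewrite mulr_ge0.
rewrite !mulr1 in k3 *.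
split; [by lra|by lra|].
apply: le_trans c2 _; apply: (@le_trans _ _ (`|C| * (K * e i))).
  by rewrite ler_pM// ?(le_trans _ c1)// .
by rewrite mulrDl mulrA lerDr mulr_ge0// e0.
Qed.

Let nI : near_family P e (fun=> 1) (fun=> 1%:M : 'M[R]_n) (fun=> 1%:M).
Proof.
exists `|1%:M : 'M[R]_n| => // i Pi.
by rewrite subrr normr0 !mulr1 mulr_ge0// e0.
Qed.

Lemma near_dhessV : near_family P e S (fun i => dhessV phi (X i) (X1 i))
  (fun i => dhessV phi (X0 i) (Y1 i)).
Proof.
have n1 := @mul1r R; have n2 := @mulr1 R.
have nq := ndot one0 S0 (fun i => n1 (S i)) nX nX1.
apply: near_familyD.
  apply: (nscale S0 one0 (fun i => n2 (S i))) => //.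
  exact: (nmul one0 S0 (fun i => n1 (S i))).
apply: near_familyD.
  apply: (nscale S0 one0 (fun i => n2 (S i))).
    exact: (nmul one0 S0 (fun i => n1 (S i))).
  exact: (nouter one0 one0 (fun=> n1 1)).
apply: (nscale one0 S0 (fun i => n1 (S i))) => //.
apply: near_familyD.
  exact: (nouter S0 one0 (fun i => n2 (S i))).
exact: (nouter one0 S0 (fun i => n1 (S i))).
Qed.

(** Velocities have weight [S] and accelerations weight [S * S], so every summand is of total weight
    [S * S] and the product rules apply term by term. *)
Lemma near_ddhessV :
  near_family P e (fun i => S i * S i)
    (fun i => ddhessV phi (X i) (X1 i) (X2 i))
    (fun i => ddhessV phi (X0 i) (Y1 i) (Y2 i)).
Proof.
have n1 := @mul1r R; have n2 := @mulr1 R.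
pose SS i := S i * S i.
have nq1 := ndot one0 S0 (fun i => n1 (S i)) nX nX1.
have nq2 : @near_family R Idx P e R^o SS
    (fun i => dot (X1 i) (X1 i) + dot (X i) (X2 i))
    (fun i => dot (Y1 i) (Y1 i) + dot (X0 i) (Y2 i)).
  apply: near_familyD; first exact: (ndot S0 S0 (fun=> erefl)).
  exact: (ndot one0 SS0 (fun i => n1 (SS i))).
have np k : @near_family R Idx P e R^o SS
   (fun i => phi k.+1 (half_sq (X i)) * dot (X i) (X1 i) * dot (X i) (X1 i) +
     phi k (half_sq (X i)) * (dot (X1 i) (X1 i) + dot (X i) (X2 i)))
   (fun i => phi k.+1 (half_sq (X0 i)) * dot (X0 i) (Y1 i) * dot (X0 i) (Y1 i) +
     phi k (half_sq (X0 i)) * (dot (Y1 i) (Y1 i) + dot (X0 i) (Y2 i))).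
  apply: near_familyD.
    apply: (nmul S0 S0 (fun=> erefl)) => //.
    exact: (nmul one0 S0 (fun i => n1 (S i))).
  exact: (nmul one0 SS0 (fun i => n1 (SS i))).
rewrite /ddhessV /=.
apply: near_familyD.
  exact: (nscale SS0 one0 (fun i => n2 (SS i))).
apply: near_familyD.
  apply: near_familyD.
    apply: (nscale SS0 one0 (fun i => n2 (SS i))) => //.
    exact: (nouter one0 one0 (fun=> n1 1)).
  apply: (nscale S0 S0 (fun i => erefl)).
    apply: (@near_familyZ R Idx P e R^o S 2).
    exact: (nmul one0 S0 (fun i => n1 (S i))).
  apply: near_familyD; first exact: (nouter S0 one0 (fun i => n2 (S i))).
  exact: (nouter one0 S0 (fun i => n1 (S i))).
apply: (nscale one0 SS0 (fun i => n1 (SS i))) => //.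
apply: near_familyD; last exact: (nouter one0 SS0 (fun i => n1 (SS i))).
apply: near_familyD; first exact: (nouter SS0 one0 (fun i => n2 (SS i))).
by apply: near_familyZ; exact: (nouter S0 S0 (fun=> erefl)).
Qed.

End near_radial.

Section second_variation.
Context {R : realType} {n : nat}.
Variable phi : nat -> R -> R.
Hypothesis phiC11 : forall (Q : R) k, C11_on 0 Q (phi k) (phi k.+1).
Local Notation E := 'rV[R]_n.
Local Notation gradV := (@gradV R n phi).
Local Notation hessV := (@hessV R n phi).
Local Notation dhessV := (@dhessV R n phi).
Local Notation ddhessV := (@ddhessV R n phi).
Variables (B L : R).
Hypotheses (B0 : 0 <= B) (L0 : 0 <= L) (estL : radial_estimate (n :=
  n) phi B L).

(** The comparison lemma with [e = 0] and each quantity paired with itself: its first conclusion is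
    a plain size estimate. *)
Lemma dhessV_bound : exists2 K : R, 0 <= K &
  forall x x1 : E, `|x| <= B -> `|dhessV x x1| <= K * `|x1|.
Proof.
pose P (p : E * E) : Prop := `|p.1| <= B.
have e0 (p : E * E) : P p -> 0 <= (0 : R) by [].
have w0 : nonneg_weight P (fun p => `|p.2|) by [].
have xB (p : E * E) : P p -> `|p.1| <= B /\ `|p.1| <= B by [].
have nX : near_family P (fun=> 0) (fun=> 1) fst fst.
  by exists B => // p Pp; rewrite subrr normr0 mul0r !mulr0 mulr1.
have nX1 : near_family P (fun=> 0) (fun p => `|p.2|) snd snd.
  by exists 1 => // p Pp; rewrite subrr normr0 mul0r mulr0 mul1r.
have [K K0 HK] := near_dhessV phiC11 e0 w0 xB nX nX1.
by exists K => // x x1 xB'; have [] := HK (x, x1) xB'.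
Qed.

Lemma ddhessV_bound (M : R) : 0 <= M -> exists2 K : R, 0 <= K &
  forall (S : R) (x x1 x2 : E), 0 <= S -> `|x| <= B -> `|x1| <= M * S ->
    `|x2| <= M * (S * S) -> `|ddhessV x x1 x2| <= K * (S * S).
Proof.
move=> M0; pose Idx := (R * E * E * E)%type.
pose P (p : Idx) := [/\ 0 <= p.1.1.1, `|p.1.1.2| <= B,
  `|p.1.2| <= M * p.1.1.1 & `|p.2| <= M * (p.1.1.1 * p.1.1.1)].
have e0 (p : Idx) : P p -> 0 <= (0 : R) by [].
have w0 : nonneg_weight P (fun p => p.1.1.1) by move=> p [].
have xB (p : Idx) : P p -> `|p.1.1.2| <= B /\ `|p.1.1.2| <= B by move=> [].
have nX : near_family P (fun=> 0) (fun=> 1) (fun p => p.1.1.2)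
    (fun p => p.1.1.2).
  by exists B => // p []; rewrite subrr normr0 mul0r !mulr0 mulr1.
have nX1 : near_family P (fun=> 0) (fun p => p.1.1.1) (fun p => p.1.2)
    (fun p => p.1.2).
  by exists M => // p []; rewrite subrr normr0 mul0r mulr0.
have nX2 : near_family P (fun=> 0) (fun p => p.1.1.1 * p.1.1.1) snd snd.
  by exists M => // p []; rewrite subrr normr0 mul0r mulr0.
have [K K0 HK] := near_ddhessV phiC11 e0 w0 xB nX nX1 nX2.
exists K => // S x x1 x2 S0 xB' x1M x2M.
by have [] := HK (S, x, x1, x2) (And4 S0 xB' x1M x2M).
Qed.

(** The terms with [j1] and [j2] already contain [eps]. Only the term with [j] survives to leading
    order, and there [x], [x1], [x2], [j] are replaced by [x0], [t *: a1], 0 and [(1 - t) *: u]. *)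
Lemma second_variation_near (K : R) : 0 <= K -> exists2 K' : R, 0 <= K' &
  forall (eps t : R) (x x0 x1 x2 j j1 j2 a1 u : E), 0 <= eps -> 0 <= t <= 1 ->
    `|x| <= B -> `|x0| <= B -> `|x - x0| <= K * eps ->
    `|x1| <= K * `|a1| -> `|x1 - t *: a1| <= K * (eps * `|a1|) ->
    `|x2| <= K * (`|a1| * `|a1|) -> `|x2| <= K * (eps * (`|a1| * `|a1|)) ->
    `|j| <= K * `|u| -> `|j - (1 - t) *: u| <= K * (eps * `|u|) ->
    `|j1| <= K * (eps * (`|u| * `|a1|)) ->
    `|j2| <= K * (eps * (`|u| * (`|a1| * `|a1|))) ->
    `|dot (j2 *m hessV x + j1 *m dhessV x x1 +
           (j1 *m dhessV x x1 + j *m ddhessV x x1 x2)) u -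
      (1 - t) * dot (u *m ddhessV x0 (t *: a1) 0) u| <=
    K' * (eps * ((`|u| * `|u|) * (`|a1| * `|a1|))).
Proof.
move=> K0; have [Kd Kd0 HKd] := dhessV_bound.
have [Km Km0 HKm] := bounded_bilinear_ge0 (@mulmx_bounded_bilinear R n).
(* All data are packed into one index, so that the constant produced by the comparison of families
   depends on none of them. *)
pose Idx := (R * R * (E * E) * (E * E) * E * (E * E))%type.
pose eps (p : Idx) := p.1.1.1.1.1. pose t (p : Idx) := p.1.1.1.1.2.
pose x (p : Idx) := p.1.1.1.2.1. pose x0 (p : Idx) := p.1.1.1.2.2.
pose x1 (p : Idx) := p.1.1.2.1. pose x2 (p : Idx) := p.1.1.2.2.
pose j (p : Idx) := p.1.2. pose a1 (p : Idx) := p.2.1. pose u (p : Idx) :=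
  p.2.2.
pose P (p : Idx) := [/\ 0 <= eps p, 0 <= t p <= 1, `|x p| <= B /\ `|x0 p| <= B &
  `|x p - x0 p| <= K * eps p] /\
  [/\ `|x1 p| <= K * `|a1 p|, `|x1 p - t p *: a1 p| <= K * (eps p * `|a1 p|),
    `|x2 p| <= K * (`|a1 p| * `|a1 p|) /\
    `|x2 p| <= K * (eps p * (`|a1 p| * `|a1 p|)),
    `|j p| <= K * `|u p| &
    `|j p - (1 - t p) *: u p| <= K * (eps p * `|u p|)].
have e0 p : P p -> 0 <= eps p by move=> [[]].
have K1 (k y : R) : 0 <= y -> k <= K + 1 -> k * y <= (K + 1) * y.
  by move=> y0 kK; rewrite ler_wpM2r.
have nX : near_family P eps (fun=> 1) x x0.
  exists (K + B) => [|p [[ep tp [xB x0B] xx0] _]]; first by rewrite addr_ge0.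
  rewrite !mulr1; split; try lra.
  by apply: le_trans xx0 _; rewrite ler_wpM2r// lerDl.
have nX1 : near_family P eps (fun p => `|a1 p|) x1 (fun p => t p *: a1 p).
  exists (K + 1) => [|p [[ep /andP[t0 t1] _ _] [h1 h2 _ _ _]]].
    by rewrite addr_ge0.
  split.
  - by apply: le_trans h1 _; apply: K1 => //; rewrite lerDl.
  - by rewrite normrZ ger0_norm// K1//; lra.
  - by apply: le_trans h2 _; apply: K1; rewrite ?mulr_ge0// lerDl.
have nX2 : near_family P eps (fun p => `|a1 p| * `|a1 p|) x2 (fun=> 0).
  exists K => // p [[ep _ _ _] [_ _ [h1 h2] _ _]].
  by rewrite normr0 subr0 !mulr_ge0.
have nJ : near_family P eps (fun p => `|u p|) j (fun p => (1 - t p) *: u p).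
  exists (K + 1) => [|p [[ep /andP[t0 t1] _ _] [_ _ _ h1 h2]]].
    by rewrite addr_ge0.
  split.
  - by apply: le_trans h1 _; apply: K1 => //; rewrite lerDl.
  - by rewrite normrZ ger0_norm ?subr_ge0// K1//; lra.
  - by apply: le_trans h2 _; apply: K1; rewrite ?mulr_ge0// lerDl.
have xB p : P p -> `|x p| <= B /\ `|x0 p| <= B by move=> [[]].
have nu : near_family P eps (fun p => `|u p|) u u.
  by exists 1 => // p [[ep _ _ _] _]; rewrite subrr normr0 !mul1r mulr_ge0.
have w0 (v : Idx -> E) : nonneg_weight P (fun p => `|v p|) by [].
have w1 (v : Idx -> E) : nonneg_weight P (fun p => `|v p| * `|v p|).
  by move=> p _; rewrite mulr_ge0.
have nH := near_ddhessV phiC11 e0 (w0 a1) xB nX nX1 nX2.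
have nJH := near_family_bilinear e0 (w0 u) (w1 a1) mulmx_bounded_bilinear nJ nH.
have w2 : nonneg_weight P (fun p => `|u p| * (`|a1 p| * `|a1 p|)).
  by move=> p _; rewrite !mulr_ge0.
have [K2 K20 HK2] := near_family_bilinear e0 w2 (w0 u) dot_bounded_bilinear nJH
  nu.
have N0 : 0 <= (n%:R : R) by rewrite ler0n.
exists (n%:R * (L * K + 2 * (Km * Kd * K * K)) + K2) =>
  [|ep tp y y0 y1 y2 z z1 z2 b v].
  by rewrite addr_ge0// mulr_ge0// addr_ge0// !mulr_ge0.
move=> ep0 tp01 yB y0B yy0 h1 h2 h3 h4 h5 h6 h7 h8.
have := HK2 (ep, tp, (y, y0), (y1, y2), z, (b, v)).
case; first by split; split.
rewrite /x /x0 /x1 /x2 /j /a1 /u /t /eps /= => _ _ H.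
pose r1 := z2 *m hessV y + (z1 *m dhessV y y1 + z1 *m dhessV y y1).
have -> : dot (z2 *m hessV y + z1 *m dhessV y y1 +
    (z1 *m dhessV y y1 + z *m ddhessV y y1 y2)) v -
    (1 - tp) * dot (v *m ddhessV y0 (tp *: b) 0) v =
    dot r1 v + (dot (z *m ddhessV y y1 y2) v -
      dot ((1 - tp) *: v *m ddhessV y0 (tp *: b) 0) v).
  by rewrite -scalemxAl dotZl /r1 !dotDl; ring.
apply: le_trans (ler_normD _ _) _; rewrite [leRHS]mulrDl; apply: lerD;
  last first.
  by apply: le_trans H _; rewrite le_eqVlt; apply/orP; left; apply/eqP; ring.
apply: le_trans (norm_dot_le _ _) _.
have r1b : `|r1| <= (L * K + 2 * (Km * Kd * K * K)) *
    (ep * (`|v| * (`|b| * `|b|))).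
  have d1 : `|z1 *m dhessV y y1| <=
      Km * Kd * K * K * (ep * (`|v| * (`|b| * `|b|))).
    apply: le_trans (HKm _ _) _.
    have -> : Km * Kd * K * K * (ep * (`|v| * (`|b| * `|b|))) =
      Km * (K * (ep * (`|v| * `|b|))) * (Kd * (K * `|b|)) by ring.
    rewrite ler_pM ?mulr_ge0//; first by rewrite ler_wpM2l.
    by apply: le_trans (HKd _ _ yB) _; rewrite ler_wpM2l.
  have d2 : `|z2 *m hessV y| <= L * K * (ep * (`|v| * (`|b| * `|b|))).
    have [[_ + _ _] _] := estL yB yB => /(_ z2) /le_trans; apply.
    by rewrite -mulrA ler_wpM2l.
  apply: le_trans (ler_normD _ _) _.
  have := ler_normD (z1 *m dhessV y y1) (z1 *m dhessV y y1).
  move: d1 d2; set q := ep * _; lra.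
have -> : n%:R * (L * K + 2 * (Km * Kd * K * K)) * (ep * (`|v| * `|v| * (`|b| *
  `|b|)))
  = n%:R * ((L * K + 2 * (Km * Kd * K * K)) * (ep * (`|v| * (`|b| * `|b|)))) *
    `|v|.
  by ring.
by rewrite ler_wpM2r// ler_wpM2l.
Qed.

Lemma family_deriv_affine d (p q : R -> E) (Cp Cq : R) :
  continuous p -> continuous q ->
  (forall t, `|p t| <= Cp) -> (forall t, `|q t| <= Cq) ->
  family_deriv d (fun s t => p t + s *: q t) (fun _ t => q t).
Proof.
move=> cp cq pC qC.
have Cq0 : 0 <= Cq by exact: le_trans (normr_ge0 _) (qC 0).
split.
- exists (Cp + `|d| * Cq) => s sd; split=> [t|t].
    by apply: cvgD; [exact: cp|apply: cvgZr; exact: cq].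
  apply: le_trans (ler_normD _ _) _; rewrite lerD// normrZ ler_pM//.
  by rewrite ltW// (lt_le_trans sd)// ler_norm.
- by exists Cq => s sd.
- exists 0 => s h t _ _; rewrite mul0r (_ : _ - _ - _ = 0) ?normr0//.
  by lmod R 'rV[R]_n.
Qed.

Lemma continuous_clampZ (v : E) : continuous (fun t : R => clamp t *: v).
Proof. by move=> t; apply: cvgZl; exact: continuous_clamp. Qed.

Lemma continuous_onem_clampZ (v : E) :
  continuous (fun t : R => (1 - clamp t) *: v).
Proof.
move=> t; apply: cvgZl; apply: cvgB; first exact: cvg_cst.
exact: continuous_clamp.
Qed.

Lemma norm_clampZ (v : E) (t : R) : `|clamp t *: v| <= `|v|.
Proof. by rewrite normrZ -[leRHS]mul1r ler_wpM2r// norm_clamp. Qed.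

Lemma norm_onem_clampZ (v : E) (t : R) : `|(1 - clamp t) *: v| <= `|v|.
Proof.
have /andP[t0 t1] := clamp_itv t.
by rewrite normrZ -[leRHS]mul1r ler_wpM2r// ger0_norm; lra.
Qed.

(** Two derivatives in [s] of the integrand of the second derivative of the cost, when the covector
    is [a + s *: a1]. [K] is fixed before [eps], the paths and all vectors. *)
Lemma second_variation : exists2 K : R, 0 <= K &
  forall (eps d : R) (x a a1 u : E) (X J : R -> R -> E),
  0 < eps -> eps <= 1 -> eps * 2 * L <= 1 / 2 -> 0 < d ->
  (forall s : R, `|s| < d -> continuous (X s)) ->
  (forall s t : R, `|s| < d -> `|X s t| <= B) ->
  (forall t : R, `|x + clamp t *: a| <= B) ->
  (forall s t : R, `|s| < d -> X s t = x + clamp t *: (a + s *: a1) +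
     eps *: initial_op (fun r => gradV (X s r)) t) ->
  (forall s : R, `|s| < d -> continuous (J s)) ->
  (forall s : R, `|s| < d -> exists C : R, forall t, `|J s t| <= C) ->
  (forall s t : R, `|s| < d -> J s t = (1 - clamp t) *: u +
     eps *: boundary_op (fun r => J s r *m hessV (X s r)) t) ->
  exists F' F'' : R -> R -> E,
  [/\ family_deriv d (fun s t => J s t *m hessV (X s t)) F',
      family_deriv d F' F'' &
      forall t : R, `|dot (F'' 0 t) u -
        (1 - clamp t) *
        dot (u *m ddhessV (x + clamp t *: a) (clamp t *: a1) 0) u| <=
        K * (eps * ((`|u| * `|u|) * (`|a1| * `|a1|)))].
Proof.
have [Kd Kd0 HKd] := dhessV_bound.
have [Km Km0 HKm] := bounded_bilinear_ge0 (@mulmx_bounded_bilinear R n).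
pose Q := Km * Kd; have Q0 : 0 <= Q by rewrite mulr_ge0.
(* One constant that dominates both the bound 2 for the first variation of [X] and the bound [8 * Q]
   for the second. *)
have Q80 : 0 <= 2 + 8 * Q by rewrite addr_ge0// mulr_ge0.
have [Kdd Kdd0 HKdd] := ddhessV_bound Q80.
(* Constant for the second variation of [J]: 4 is the factor 2 of [fixed_path_bound] times the norm
   2 of [boundary_op], and the bracket sums two mixed terms [32 * Q * Q] and the term with
   [ddhessV]. *)
pose K3 := 4 * (64 * Q * Q + 2 * Km * Kdd).
have K30 : 0 <= K3 by rewrite mulr_ge0// addr_ge0// !mulr_ge0.
pose K := 2 + 4 * L + 8 * Q + 16 * Q + K3.
have K0 : 0 <= K by rewrite !addr_ge0// !mulr_ge0.
have [K' K'0 HK'] := second_variation_near K0.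
exists K' => // eps d x a a1 u X J eps0 eps1 epsL d0 cX XB x0B XE cJ Jb JE.
have e0 := ltW eps0.
have Ti := scaled_operator e0 (@initial_op_operator R n).
have Tb := scaled_operator e0 (@boundary_op_operator R n).
have k1 : 0 <= eps * 1 by rewrite mulr1.
have k2 : 0 <= eps * 2 by rewrite mulr_ge0.
have eL : 0 <= eps * L by rewrite mulr_ge0.
have kL1 : eps * 1 * L <= 1 / 2 by rewrite mulr1; lra.
have fX : bounded_family d X by exists B => s sd; split=> [|t];
  [exact: cX|exact: XB].
have fb : family_deriv d (fun s t => x + clamp t *: a + s *: (clamp t *: a1))
    (fun _ t => clamp t *: a1).
  apply: (family_deriv_affine _ (Cp := B) (Cq := `|a1|)) => //.
  - move=> t; apply: cvgD; first exact: cvg_cst.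
    exact: continuous_clampZ.
  - exact: continuous_clampZ.
  - by move=> t; exact: norm_clampZ.
have fz : family_deriv d (fun _ _ => 0 : E) (fun _ _ => 0).
  apply: (@family_deriv_cst R _ d (fun=> 0) 0).
    by move=> t; exact: cvg_cst.
  by move=> t; rewrite normr0.
have fconst (p : R -> E) (C : R) : continuous p -> (forall t, `|p t| <= C) ->
    family_deriv d (fun _ => p) (fun _ _ => 0) by exact: family_deriv_cst.
have XE' (s t : R) : `|s| < d -> X s t = x + clamp t *: a + s *: (clamp t *:
  a1) +
     eps *: initial_op (fun r => gradV (X s r)) t.
  by move=> sd; rewrite {1}XE//; lmod R 'rV[R]_n.
have [X1 fX1 X1E] := gradV_family_deriv phiC11 L0 k1 kL1 Ti estL fX XB fb XE'.
have [_ bX1 _] := fX1.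
(* Adds the zero source that the shape of [linear_family_deriv] expects. *)
have op0 (T : (R -> E) -> R -> E) (Z : R -> E) (t : R) :
    T (fun r => Z r + 0) t = T Z t.
  by congr (T _ t); apply/funext => r; rewrite addr0.
have X1E' (s t : R) : `|s| < d -> X1 s t = clamp t *: a1 +
    eps *: initial_op (fun r => X1 s r *m hessV (X s r) + 0) t.
  move=> sd; rewrite (op0 (@initial_op R n) (fun r => X1 s r *m hessV (X s r))).
  exact: X1E.
have fca1 := fconst (fun t => clamp t *: a1) `|a1| (@continuous_clampZ a1)
  (@norm_clampZ a1).
have [X2 fX2 X2E] := linear_family_deriv phiC11 L0 k1 kL1 Ti estL XB fX1 bX1
  fca1 fz X1E'.
have [_ bX2 _] := fX2.
have fH := family_deriv_hessV phiC11 XB fX1.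
have fdH := family_deriv_dhessV phiC11 XB fX1 fX2.
have [bH bdH _] := fH; have [_ bddH _] := fdH.
have bprod (Z : R -> R -> E) (H : R -> R -> 'M[R]_n) : bounded_family d Z ->
    bounded_family d H -> bounded_family d (fun s t => Z s t *m H s t).
  exact: (bounded_family_bilinear mulmx_bounded_bilinear).
have badd (Z Z' : R -> R -> E) : bounded_family d Z ->
    bounded_family d Z' -> bounded_family d (fun s t => Z s t + Z' s t).
  move=> bZ bZ'; apply: eq_bounded_family (bounded_family_lin 1 bZ bZ').
  by move=> s t _; rewrite scale1r.
have Hess (s t : R) (v : E) : `|s| < d -> `|v *m hessV (X s t)| <= L * `|v|.
  by move=> sd; have [[_ + _ _] _] := estL (XB s t sd) (XB s t sd) => /(_ v).
have bcont (Z : R -> R -> E) (s : R) : bounded_family d Z -> `|s| < d ->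
    continuous (Z s) /\ exists C : R, forall t, `|Z s t| <= C.
  by move=> [C HC] /HC[cZ ZC]; split=> //; exists C.
have JB (s t : R) : `|s| < d -> `|J s t| <= 2 * `|u|.
  move=> sd.
  rewrite -[X in 2 * X](addr0 `|u|) -[X in _ + X](mulr0 (eps * 2)).
  apply: (fixed_path_bound k2 L0 epsL Tb (b := fun t => (1 - clamp t) *: u)
    (g := fun r => J s r *m hessV (X s r))) => //.
  - have [C JC] := Jb s sd; have [[D HD] _ _] := fH; have [cHs HsD] := HD s sd.
    have b1 : bounded_family 1 (fun _ : R => J s) by exists C => r _; split;
      [exact: cJ|].
    have b2 : bounded_family 1 (fun (_ : R) t => hessV (X s t)) by exists D.
    have [F HF] := bounded_family_bilinear mulmx_bounded_bilinear b1 b2.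
    have z1 : `|0 : R| < 1 by rewrite normr0.
    by have [] := HF 0 z1.
  - exact: Jb.
  - by move=> r; exact: JE.
  - exact: norm_onem_clampZ.
  - by move=> r; rewrite addr0; exact: Hess.
have bJ : bounded_family d J.
  by exists (2 * `|u|) => s sd; split=> [|t]; [exact: cJ|exact: JB].
have JE' (s t : R) : `|s| < d -> J s t = (1 - clamp t) *: u +
    eps *: boundary_op (fun r => J s r *m hessV (X s r) + 0) t.
  move=> sd; rewrite (op0 (@boundary_op R n) (fun r => J s r *m hessV (X s r))).
  exact: JE.
have fcu := fconst (fun t => (1 - clamp t) *: u) `|u| (@continuous_onem_clampZ
  u) (@norm_onem_clampZ u).
have [J1 fJ1 J1E] := linear_family_deriv phiC11 L0 k2 epsL Tb estL XB fX1 bJ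
  fcu fz JE'.
have [_ bJ1 _] := fJ1.
have J1E' (s t : R) : `|s| < d -> J1 s t = 0 + eps *: boundary_op
    (fun r => J1 s r *m hessV (X s r) + J s r *m dhessV (X s r) (X1 s r)) t.
  move=> sd; rewrite -(op0 (@boundary_op R n)
    (fun r => J1 s r *m hessV (X s r) + J s r *m dhessV (X s r) (X1 s r))).
  exact: J1E.
have fJdH := family_deriv_mulmx fJ1 fdH.
have [J2 fJ2 J2E] := linear_family_deriv phiC11 L0 k2 epsL Tb estL XB fX1 bJ1
  fz fJdH J1E'.
have [_ bJ2 _] := fJ2.
exists (fun s t => J1 s t *m hessV (X s t) + J s t *m dhessV (X s t) (X1 s t)).
exists (fun s t => J2 s t *m hessV (X s t) + J1 s t *m dhessV (X s t) (X1 s t) +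
  (J1 s t *m dhessV (X s t) (X1 s t) +
   J s t *m ddhessV (X s t) (X1 s t) (X2 s t))).
split; [exact: family_deriv_mulmx|exact: family_derivD (family_deriv_mulmx fJ2
  fH) fJdH|].
have z0 : `|0 : R| < d by rewrite normr0.
have cont0 (Z : R -> R -> E) : bounded_family d Z -> continuous (Z 0).
  by move=> /bcont-/(_ _ z0)[].
have bnd0 (Z : R -> R -> E) : bounded_family d Z ->
    exists C : R, forall t, `|Z 0 t| <= C.
  by move=> /bcont-/(_ _ z0)[].
have X1B r : `|X1 0 r| <= 2 * `|a1|.
  rewrite -[X in 2 * X](addr0 `|a1|) -[X in _ + X](mulr0 (eps * 1)).
  apply: (fixed_path_bound k1 L0 kL1 Ti (b := fun t => clamp t *: a1)
    (g := fun r => X1 0 r *m hessV (X 0 r))) => //.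
  - exact: cont0 (bprod _ _ bX1 bH).
  - exact: bnd0.
  - by move=> p; exact: X1E.
  - exact: norm_clampZ.
  - by move=> p; rewrite addr0; exact: Hess.
have dHB r (v : E) (c : R) : `|v| <= c ->
    `|v *m dhessV (X 0 r) (X1 0 r)| <= 2 * Q * (c * `|a1|).
  move=> vc; apply: le_trans (HKm _ _) _.
  have -> : 2 * Q * (c * `|a1|) = Km * c * (Kd * (2 * `|a1|)) by rewrite /Q;
    ring.
  rewrite ler_pM ?mulr_ge0//; first by rewrite ler_wpM2l.
  by apply: le_trans (HKd _ _ (XB 0 r z0)) _; rewrite ler_wpM2l.
(* From here on the free terms vanish, because [clamp t *: a1] and [(1 - clamp t) *: u] do not
   depend on [s]. Each variation is then an image of the scaled operator and gains a factor
   [eps]. *)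
have X2B r : `|X2 0 r| <= 8 * Q * (eps * (`|a1| * `|a1|)).
  have -> : 8 * Q * (eps * (`|a1| * `|a1|)) =
      2 * (0 + eps * 1 * (2 * Q * (2 * `|a1| * `|a1|))) by ring.
  apply: (fixed_path_bound k1 L0 kL1 Ti (b := fun=> 0)
    (g := fun r => X2 0 r *m hessV (X 0 r) + X1 0 r *m dhessV (X 0 r) (X1 0 r)
       + 0)) => //.
  - have [bz _ _] := fz.
    exact: cont0 (badd _ _ (badd _ _ (bprod _ _ bX2 bH) (bprod _ _ bX1 bdH))
      bz).
  - exact: bnd0.
  - by move=> p; exact: X2E.
  - by move=> p; rewrite normr0.
  - move=> p; rewrite addr0; apply: le_trans (ler_normD _ _) _.
    by apply: lerD; [exact: Hess|apply: dHB; exact: X1B].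
have J1B r : `|J1 0 r| <= 16 * Q * (eps * (`|u| * `|a1|)).
  have -> : 16 * Q * (eps * (`|u| * `|a1|)) =
      2 * (0 + eps * 2 * (2 * Q * (2 * `|u| * `|a1|))) by ring.
  apply: (fixed_path_bound k2 L0 epsL Tb (b := fun=> 0)
    (g := fun r => J1 0 r *m hessV (X 0 r) + J 0 r *m dhessV (X 0 r) (X1 0 r)))
    => //.
  - exact: cont0 (badd _ _ (bprod _ _ bJ1 bH) (bprod _ _ bJ bdH)).
  - exact: bnd0.
  - by move=> p; exact: J1E'.
  - by move=> p; rewrite normr0.
  - move=> p; apply: le_trans (ler_normD _ _) _.
    by apply: lerD; [exact: Hess|apply: dHB; exact: JB].
have ddHB r : `|J 0 r *m ddhessV (X 0 r) (X1 0 r) (X2 0 r)| <=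
    2 * Km * Kdd * (`|u| * (`|a1| * `|a1|)).
  apply: le_trans (HKm _ _) _.
  have -> : 2 * Km * Kdd * (`|u| * (`|a1| * `|a1|)) =
    Km * (2 * `|u|) * (Kdd * (`|a1| * `|a1|)) by ring.
  rewrite ler_pM ?mulr_ge0//; first by rewrite ler_wpM2l// JB.
  apply: HKdd => //; first exact: XB.
    apply: le_trans (X1B r) _; rewrite ler_wpM2r//; lra.
  apply: le_trans (X2B r) _; apply: (@le_trans _ _ (8 * Q * (`|a1| * `|a1|))).
    by rewrite ler_wpM2l ?mulr_ge0// ler_piMl ?mulr_ge0.
  by rewrite ler_wpM2r ?mulr_ge0//; lra.
have J2B r : `|J2 0 r| <= K3 * (eps * (`|u| * (`|a1| * `|a1|))).
  have -> : K3 * (eps * (`|u| * (`|a1| * `|a1|))) =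
      2 * (0 + eps * 2 * ((64 * Q * Q + 2 * Km * Kdd) * (`|u| * (`|a1| *
        `|a1|)))).
    by rewrite /K3; ring.
  apply: (fixed_path_bound k2 L0 epsL Tb (b := fun=> 0)
    (g := fun r => J2 0 r *m hessV (X 0 r) + J1 0 r *m dhessV (X 0 r) (X1 0 r)
       + (J1 0 r *m dhessV (X 0 r) (X1 0 r) +
          J 0 r *m ddhessV (X 0 r) (X1 0 r) (X2 0 r)))) => //.
  - exact: cont0 (badd _ _ (badd _ _ (bprod _ _ bJ2 bH) (bprod _ _ bJ1 bdH))
      (badd _ _ (bprod _ _ bJ1 bdH) (bprod _ _ bJ bddH))).
  - exact: bnd0.
  - by move=> p; exact: J2E.
  - by move=> p; rewrite normr0.
  - move=> p; rewrite -addrA; apply: le_trans (ler_normD _ _) _.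
    apply: lerD; first exact: Hess.
    have h : `|J1 0 p *m dhessV (X 0 p) (X1 0 p)| <=
        32 * Q * Q * (`|u| * (`|a1| * `|a1|)).
      apply: le_trans (dHB _ _ _ (J1B p)) _.
      have -> : 2 * Q * (16 * Q * (eps * (`|u| * `|a1|)) * `|a1|) =
        eps * (32 * Q * Q * (`|u| * (`|a1| * `|a1|))) by ring.
      by rewrite ler_piMl// !mulr_ge0.
    apply: le_trans (ler_normD _ _) _.
    have := ler_normD (J1 0 p *m dhessV (X 0 p) (X1 0 p))
      (J 0 p *m ddhessV (X 0 p) (X1 0 p) (X2 0 p)).
    have := ddHB p; move: h; set q := `|u| * _; rewrite mulrDl; lra.
move=> t.
have q1 : 0 <= 4 * L by rewrite mulr_ge0.
have wk (c y : R) : 0 <= y -> c <= K -> c * y <= K * y.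
  by move=> y0 cK; rewrite ler_wpM2r.
have KE : [/\ 2 <= K, 4 * L <= K, 8 * Q <= K, 16 * Q <= K & K3 <= K].
  by clear -q1 L0 Q0 K30; rewrite /K; split; lra.
have [K_2 K_L K_8 K_16 K_3] := KE.
apply: HK' => //.
- exact: clamp_itv.
- exact: XB.
- rewrite XE' // scale0r addr0 addrC addKr mulrC.
  have [_ _ Tib] := Ti; apply: le_trans (Tib _ L _ _ t) _.
  + have bG : bounded_family d (fun s r => gradV (X s r)).
      by have [] := family_deriv_gradV phiC11 XB fX1.
    exact: cont0 bG.
  + by move=> r; have [_] := estL (XB 0 r z0) (XB 0 r z0).
  + by rewrite mulr1 ler_wpM2l//; lra.
- by apply: le_trans (X1B t) _; exact: wk.
- rewrite X1E// addrC addKr.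
  have [_ _ Tib] := Ti; apply: le_trans (Tib _ (L * (2 * `|a1|)) _ _ t) _.
  + exact: cont0 (bprod _ _ bX1 bH).
  + by move=> r; apply: le_trans (Hess 0 r _ z0) _; rewrite ler_wpM2l.
  + have -> : eps * 1 * (L * (2 * `|a1|)) = 2 * L * (eps * `|a1|) by ring.
    by apply: wk; rewrite ?mulr_ge0//; lra.
- apply: le_trans (X2B t) _; apply: (@le_trans _ _ (8 * Q * (`|a1| * `|a1|))).
    by rewrite ler_wpM2l ?mulr_ge0// ler_piMl ?mulr_ge0.
  by apply: wk; rewrite ?mulr_ge0.
- by apply: le_trans (X2B t) _; apply: wk; rewrite ?mulr_ge0.
- by apply: le_trans (JB 0 t z0) _; exact: wk.
- rewrite JE// addrC addKr.
  have [_ _ Tib] := Tb; apply: le_trans (Tib _ (L * (2 * `|u|)) _ _ t) _.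
  + exact: cont0 (bprod _ _ bJ bH).
  + by move=> r; apply: le_trans (Hess 0 r _ z0) _; rewrite ler_wpM2l// JB.
  + have -> : eps * 2 * (L * (2 * `|u|)) = 4 * L * (eps * `|u|) by ring.
    by apply: wk; rewrite ?mulr_ge0.
- by apply: le_trans (J1B t) _; apply: wk; rewrite ?mulr_ge0.
- by apply: le_trans (J2B t) _; apply: wk; rewrite ?mulr_ge0.
Qed.

End second_variation.

(** * The leading term *)

Section main_term.
Context {R : realType} {n : nat}.
Variable phi : nat -> R -> R.
Local Notation E := 'rV[R]_n.

(** Orthogonality removes every term containing [dot a1 u], namely those whose sign the assumptions
    would not control. *)
Lemma dot_ddhessV_ge (C t : R) (z a1 u : E) : dot a1 u = 0 ->
  C <= phi 2%N (half_sq z) -> 0 <= phi 3%N (half_sq z) ->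
  0 <= phi 4%N (half_sq z) ->
  C * t ^+ 2 * (dot a1 a1 * dot u u) <=
    dot (u *m ddhessV phi z (t *: a1) 0) u.
Proof.
move=> a1u p2 p3 p4.
have ua1 : dot u a1 = 0 by rewrite dotC.
rewrite /ddhessV /= !(mulmxDr, =^~ scalemxAr) mulmx1 !mul_outer.
rewrite !(dotDl, dotZl, dotDr, dotZr) !(dot0l, dot0r, a1u, ua1).
rewrite !(mulr0, addr0, mul0r, add0r) (dotC z u).
set q := dot z a1; set b := dot u z.
set P2 := phi 2%N _ in p2 *; set P3 := phi 3%N _ in p3 *; set P4 :=
  phi 4%N _ in p4 *.
have A0 := dot_ge0 a1; have U0 := dot_ge0 u.
set A := dot a1 a1 in A0 *; set U := dot u u in U0 *.
rewrite -subr_ge0.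
(* What remains is a combination of nonnegative expressions with coefficients [P2 - C], [P3] and
   [P4]. *)
rewrite (_ : _ - _ = (P2 - C) * (t ^+ 2 * (A * U)) + P3 * ((t * q) ^+ 2 * U) +
  P4 * ((t * q) ^+ 2 * b ^+ 2) + P3 * (t ^+ 2 * A * b ^+ 2)); last by ring.
have s1 := sqr_ge0 t; have s2 := sqr_ge0 (t * q); have s3 := sqr_ge0 b.
have p20 : 0 <= P2 - C by rewrite subr_ge0.
have AU := mulr_ge0 A0 U0.
by repeat apply: addr_ge0; apply: mulr_ge0 => //; apply: mulr_ge0 => //;
  exact: mulr_ge0.
Qed.

End main_term.

(** * The double integral of the weight [(1 - r) r^2] *)

Section twofold_integral.
Context {R : realType}.

(** The double primitive is [r^4 / 12 - r^5 / 20], and [1/12 - 1/20 = 1/30]. The weight combines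
    [1 - r] from the unperturbed Jacobi field with [r^2] from two factors [r *: a1]. *)
Lemma I_I_bump : I (I (fun r : R => (1 - clamp r) * clamp r ^+ 2)) 1 = 30^-1.
Proof.
have cc := @continuous_clamp R.
pose F1 : R -> R := fun r => 3^-1 * r ^+ 3 - 4^-1 * r ^+ 4.
pose F2 : R -> R := fun r => 12^-1 * r ^+ 4 - 20^-1 * r ^+ 5.
have cpow k : continuous (fun r : R => clamp r ^+ k).
  by move=> r; apply: (@continuous_comp _ _ _ clamp (fun x => x ^+ k));
    [exact: cc|exact: exprn_continuous].
have dpow (c : R) k (r : R) : is_derive r 1 (fun x => c * x ^+ k.+1)
    (c * (k.+1%:R * r ^+ k)).
  have dX : is_derive r 1 (fun x : R => x ^+ k.+1) (k.+1%:R * r ^+ k).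
    split; first exact: exprn_derivable.
    by rewrite exp_derive /= /GRing.scale/= mulr1.
  exact: is_deriveZ.
have dB (c c' : R) k l (r : R) :
    is_derive r 1 (fun x => c * x ^+ k.+1 - c' * x ^+ l.+1)
      (c * (k.+1%:R * r ^+ k) - c' * (l.+1%:R * r ^+ l)).
  by apply: is_deriveB; exact: dpow.
have -> : I (fun r : R => (1 - clamp r) * clamp r ^+ 2) = fun t => F1 (clamp t).
  apply/funext => t; transitivity (F1 (clamp t) - F1 0); last first.
    by rewrite /F1 !expr0n/= !mulr0 subrr subr0.
  apply: I_FTC => [r|s s01].
    apply: cvgM; last exact: cpow.
    by apply: cvgB; [exact: cvg_cst|exact: cc].
  rewrite clamp_id//.
  have -> : (1 - s) * s ^+ 2 =
    3^-1 * (3%:R * s ^+ 2) - 4^-1 * (4%:R * s ^+ 3) by field.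
  exact: dB.
transitivity (F2 (clamp 1) - F2 0); last first.
  by rewrite clamp1 /F2 !expr0n/= !expr1n; field.
apply: I_FTC => [r|s s01].
  apply: cvgB.
    by apply: cvgM; [exact: cvg_cst|exact: cpow].
  by apply: cvgM; [exact: cvg_cst|exact: cpow].
rewrite clamp_id//.
have -> : F1 s = 12^-1 * (4%:R * s ^+ 3) - 20^-1 * (5%:R * s ^+ 4).
  by rewrite /F1; field.
exact: dB.
Qed.

(** Over the triangle of area 1/2 the constant error integrates to [k / 2], bounded crudely by
    [k]. *)
Lemma I_I_ge (h : R -> R) (c k : R) : 0 <= k -> continuous h ->
  (forall t : R, 0 <= t <= 1 -> c * ((1 - t) * t ^+ 2) - k <= h t) ->
  c / 30 - k <= I (I h) 1.
Proof.
move=> k0 ch H.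
pose w (r : R) := (1 - clamp r) * clamp r ^+ 2.
have cw : continuous w.
  move=> r; apply: cvgM.
    by apply: cvgB; [exact: cvg_cst|exact: continuous_clamp].
  by apply: (@continuous_comp _ _ _ clamp (fun x => x ^+ 2));
    [exact: continuous_clamp|exact: exprn_continuous].
have ck : continuous (fun _ : R => - k) by move=> r; exact: cvg_cst.
have cIk : continuous (I (fun _ : R => - k)) by exact: continuous_I.
have -> : c / 30 - k = c * I (I w) 1 - k by rewrite I_I_bump.
apply: (@le_trans _ _ (I (I (fun r => c * w r + - k)) 1)).
  have -> : I (fun r => c * w r + - k) = fun t => c * I w t + I (fun=> - k) t.
    by apply/funext => t; rewrite I_lin.
  rewrite I_lin//; last exact: continuous_I.
  rewrite lerD2l.
  apply: (@le_trans _ _ (I (fun _ : R => - k) 1)).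
    by rewrite I_cst clamp1 mulr1.
  apply: I_le => // s /andP[s0 s1].
  by rewrite I_cst clamp_id ?s0// mulNr lerN2 ler_piMr.
have cwk : continuous (fun r => c * w r + - k).
  move=> r; apply: cvgD; last exact: cvg_cst.
  by apply: cvgM; [exact: cvg_cst|exact: cw].
apply: I_le; [exact: continuous_I|exact: continuous_I|].
move=> s _; apply: I_le => // r r01.
by rewrite /w clamp_id// H.
Qed.

Lemma dot_initial_op n (g : R -> 'rV[R]_n) (u : 'rV[R]_n) (t : R) :
  continuous g -> dot (initial_op g t) u = - I (I (fun r => dot (g r) u)) t.
Proof.
move=> cg.
have cgi i : continuous (fun r => g r 0 i) by move/continuous_rowP : cg.
have I_sum (f : 'I_n -> R -> R) s : (forall i, continuous (f i)) ->
    I (fun r => \sum_i f i r * u 0 i) s = \sum_i I (f i) s * u 0 i.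
  move=> cf.
  have cs (r : seq 'I_n) : continuous (fun x => \sum_(i <- r) f i x * u 0 i).
    elim: r => [|i r IH] x.
      rewrite (_ : (fun x => _) = fun=> 0); first exact: cvg_cst.
      by apply/funext => y; rewrite big_nil.
    rewrite (_ : (fun x => _) =
      fun x => f i x * u 0 i + \sum_(i <- r) f i x * u 0 i); last first.
      by apply/funext => y; rewrite big_cons.
    apply: cvgD; last exact: IH.
    by apply: cvgM; [exact: cf|exact: cvg_cst].
  have : forall r : seq 'I_n, I (fun x => \sum_(i <- r) f i x * u 0 i) s =
      \sum_(i <- r) I (f i) s * u 0 i.
    elim=> [|i r IH].
      rewrite big_nil (_ : (fun x => _) = fun=> 0).
        by rewrite I_cst mul0r.
      by apply/funext => y; rewrite big_nil.
    rewrite big_cons -IH mulrC -I_lin//.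
    by apply: eq_I => y _; rewrite big_cons mulrC.
  exact.
rewrite /dot.
have -> : I (fun r => \sum_i g r 0 i * u 0 i) =
    fun s => \sum_i I (fun r => g r 0 i) s * u 0 i.
  by apply/funext => s; rewrite (I_sum (fun i r => g r 0 i)).
rewrite (I_sum (fun i => I (fun r => g r 0 i))); last first.
  by move=> i; exact: continuous_I.
rewrite -sumrN; apply: eq_bigr => i _; rewrite -mulNr; congr (_ * _).
exact: initial_op_coord.
Qed.

End twofold_integral.

(** * Hamiltonian trajectories *)

Section coordinates.
Context {R : realType}.

Lemma norm_fst_le (W1 W2 : normedModType R) (p : W1 * W2) : `|p.1| <= `|p|.
Proof. by rewrite prod_normE le_max lexx. Qed.

Lemma norm_snd_le (W1 W2 : normedModType R) (p : W1 * W2) : `|p.2| <= `|p|.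
Proof. by rewrite prod_normE le_max lexx orbT. Qed.

Lemma is_derive_linear (W W' : normedModType R) (K : R) (l : W -> W')
    (g : R -> W) (t : R) (v : W) :
  (forall x y, l (x - y) = l x - l y) -> (forall (c : R) x,
    l (c *: x) = c *: l x) ->
  (forall x, `|l x| <= K * `|x|) ->
  is_derive t 1 g v -> is_derive t 1 (fun s => l (g s)) (l v).
Proof.
move=> lB lZ lK /is_derive_eps H; apply/is_derive_eps => e e0.
have q0 : 0 < `|K| + 1 by rewrite ltr_wpDl.
have e1 : 0 < e / (`|K| + 1) by rewrite divr_gt0.
have [d d0 Hd] := H _ e1; exists d => // h /Hd {}Hd.
rewrite -lZ -!lB; apply: le_trans (lK _) _.
have K1 : K <= `|K| + 1 by rewrite (le_trans (ler_norm K))// lerDl.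
apply: (@le_trans _ _ ((`|K| + 1) * (e / (`|K| + 1) * `|h|))).
  apply: (@le_trans _ _ ((`|K| + 1) * `|g (t + h) - g t - h *: v|)).
    exact: ler_wpM2r.
  by rewrite ler_wpM2l// ltW.
by rewrite mulrA mulrCA divff ?mulr1// gt_eqF.
Qed.

Lemma is_derive_fst (W1 W2 : normedModType R) (g : R -> W1 * W2) (t : R) v :
  is_derive t 1 g v -> is_derive t 1 (fun s => (g s).1) v.1.
Proof.
apply: (@is_derive_linear (W1 * W2)%type W1 1 fst) => // x.
by rewrite mul1r norm_fst_le.
Qed.

Lemma is_derive_snd (W1 W2 : normedModType R) (g : R -> W1 * W2) (t : R) v :
  is_derive t 1 g v -> is_derive t 1 (fun s => (g s).2) v.2.
Proof.
apply: (@is_derive_linear (W1 * W2)%type W2 1 snd) => // x.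
by rewrite mul1r norm_snd_le.
Qed.

Lemma is_derive_coord n (g : R -> 'rV[R]_n) (t : R) v i :
  is_derive t 1 g v -> is_derive t 1 (fun s => g s 0 i) (v 0 i).
Proof.
apply: (@is_derive_linear 'rV[R]_n R^o 1 (fun x : 'rV[R]_n => x 0 i : R^o)).
- by move=> x y; rewrite !mxE.
- by move=> c x; rewrite mxE.
- by move=> x; rewrite mul1r; exact: mx_entry_le.
Qed.

Lemma is_derive_dot n (g : R -> 'rV[R]_n) (t : R) (u v : 'rV[R]_n) :
  is_derive t 1 g v -> is_derive t 1 (fun s => dot (g s) u) (dot v u).
Proof.
apply: (@is_derive_linear 'rV[R]_n R^o (n%:R * `|u|)
  (fun x : 'rV[R]_n => dot x u : R^o)).
- by move=> x y; rewrite dotDl dotNl.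
- by move=> c x; exact: dotZl.
- by move=> x; rewrite mulrAC; exact: norm_dot_le.
Qed.

Lemma continuous_bilinear (W1 W2 W3 : normedModType R) (F : W1 -> W2 -> W3)
    (p : R -> W1) (q : R -> W2) :
  bounded_bilinear F -> continuous p -> continuous q ->
  continuous (fun t => F (p t) (q t)).
Proof.
move=> Fb cp cq t.
have [K K0 HK] := bounded_bilinear_ge0 Fb; have [Fl Fr] := bilinear_sub Fb.
apply/continuousP_eps => e e0.
pose D := K * (`|q t| + 1 + `|p t|) + 1.
have D0 : 0 < D by rewrite ltr_wpDl// mulr_ge0// !addr_ge0.
have m0 : 0 < Num.min 1 (e / D) by rewrite lt_min ltr01 divr_gt0.
have /continuousP_eps/(_ _ m0)[d1 d10 H1] := cp t.
have /continuousP_eps/(_ _ m0)[d2 d20 H2] := cq t.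
exists (Num.min d1 d2); first by rewrite lt_min d10.
move=> h; rewrite lt_min => /andP[/H1 {}H1 /H2].
rewrite le_min => /andP[h1 h2]; move: H1; rewrite le_min => /andP[_ h3].
have -> : F (p (t + h)) (q (t + h)) - F (p t) (q t) =
    F (p (t + h) - p t) (q (t + h)) + F (p t) (q (t + h) - q t).
  by rewrite Fl Fr; lmod R W3.
have qb : `|q (t + h)| <= `|q t| + 1.
  have -> : q (t + h) = q t + (q (t + h) - q t) by lmod R W2.
  by rewrite (le_trans (ler_normD _ _))// lerD2l.
apply: le_trans (ler_normD _ _) _.
have ed0 : 0 <= e / D by rewrite divr_ge0// ltW.
apply: (@le_trans _ _ (K * (e / D) * (`|q t| + 1) + K * `|p t| * (e / D))).
  apply: lerD; apply: le_trans (HK _ _) _; apply: ler_pM => //.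
  - exact: mulr_ge0.
  - exact: ler_wpM2l.
  - exact: mulr_ge0.
have -> : K * (e / D) * (`|q t| + 1) + K * `|p t| * (e / D) =
  (D - 1) * (e / D) by rewrite /D; ring.
apply: (@le_trans _ _ (D * (e / D))); first by rewrite ler_wpM2r// gerBl.
by rewrite mulrCA divff ?mulr1// gt_eqF.
Qed.

Lemma is_derive_dilation (W : normedModType R) (g : R -> W) (c t : R) v :
  0 <= c <= 1 -> is_derive (c * t) 1 g v ->
  is_derive t 1 (fun s => g (c * s)) (c *: v).
Proof.
move=> /andP[c0 c1] /is_derive_eps H; apply/is_derive_eps => e e0.
have [d d0 Hd] := H e e0; exists d => // h hd.
have ch : `|c * h| <= `|h| by rewrite normrM ger0_norm// ler_piMl.
have := Hd _ (le_lt_trans ch hd).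
rewrite mulrDr scalerA (mulrC h) => /le_trans; apply.
by rewrite ler_wpM2l// ltW.
Qed.

Lemma is_derive_continuous (W : normedModType R) (g : R -> W) (t : R) v :
  is_derive t 1 g v -> {for t, continuous g}.
Proof.
by move=> [dg _]; exact/differentiable_continuous/derivable1_diffP.
Qed.

Lemma directional_deriveE n (F : 'rV[R]_n -> R) (x v : 'rV[R]_n) (c C : R) :
  (forall h : R, `|h| <= 1 -> `|F (x + h *: v) - F x - h * c| <= C * h ^+ 2) ->
  'D_v F x = c.
Proof.
move=> H.
have : is_derive (0 : R) 1 (fun h : R => F (x + h *: v) : R^o) c.
  apply/is_derive_eps => e e0.
  exists (Num.min 1 (e / (`|C| + 1))).
    by rewrite lt_min ltr01 divr_gt0// ltr_wpDl.
  move=> h; rewrite lt_min => /andP[h1 he].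
  rewrite add0r scale0r addr0; apply: le_trans (H h (ltW h1)) _.
  rewrite normrX2 mulrA ler_wpM2r//.
  apply: (@le_trans _ _ ((`|C| + 1) * `|h|)).
    by rewrite ler_wpM2r// (le_trans (ler_norm _))// lerDl.
  by rewrite mulrC -ler_pdivlMr ?ltr_wpDl// ltW.
move=> [_ <-]; rewrite /derive.
apply: (congr1 (fun G : R -> R => lim (G @ (0 : R)^'))); apply/funext => h /=.
by rewrite scale0r !addr0 [h *: 1]mulr1 (addrC x).
Qed.

Lemma eq_I_upto (w v : R -> R) (t : R) :
  (forall s : R, 0 <= s <= clamp t -> w s = v s) -> I w t = I v t.
Proof.
move=> wv; apply: eq_Rintegral => s; rewrite inE/= in_itv/= => st.
exact: wv.
Qed.

End coordinates.

Section hamiltonian_flow.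
Context {R : realType} {n : nat}.
Variables (phi : nat -> R -> R) (V : 'rV[R]_n -> R).
Hypothesis phiC11 : forall (Q : R) k, C11_on 0 Q (phi k) (phi k.+1).
Hypothesis VE : forall x, V x = phi 0%N (half_sq x).
Local Notation E := 'rV[R]_n.
Local Notation gradV := (@gradV R n phi).

Lemma dot_delta (x : E) i : dot x (delta_mx 0 i) = x 0 i.
Proof.
rewrite /dot (bigD1 i)//= mxE !eqxx mulr1 big1 ?addr0// => j ji.
by rewrite mxE eqxx (negbTE ji) mulr0.
Qed.

Lemma ham_fieldE (eps : R) (z : E * E) :
  ham_field (hamiltonian V eps) z = (z.2, - (eps *: gradV z.1)).
Proof.
rewrite /ham_field; congr (_, - _); apply/rowP => i; rewrite mxE.
- pose v : E := delta_mx 0 i.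
  apply: (directional_deriveE (C := 2^-1 * dot v v)) => h _.
  rewrite /hamiltonian -/v !(dotDl, dotDr, dotZl, dotZr) (dotC v).
  rewrite -[z.2 0 i]dot_delta -/v.
  rewrite (_ : _ - _ - _ = 2^-1 * dot v v * h ^+ 2); last by field.
  by rewrite ger0_norm// mulr_ge0 ?sqr_ge0// mulr_ge0// dot_ge0.
- pose v : E := delta_mx 0 i.
  have B0 : 0 <= `|z.1| + `|v| by rewrite addr_ge0.
  have [L L0 HL] := @ex_radial_estimate R n _ phiC11 _ B0.
  apply: (directional_deriveE (C := `|eps| * L * `|v| ^+ 2)) => h h1.
  rewrite /hamiltonian -/v !VE mxE -(dot_delta (gradV z.1)) -/v.
  have b1 : `|z.1 + h *: v| <= `|z.1| + `|v|.
    by rewrite (le_trans (ler_normD _ _))// lerD2l normrZ ler_piMl.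
  have b2 : `|z.1| <= `|z.1| + `|v| by rewrite lerDl.
  have [[_ _ _ H] _] := HL _ _ b1 b2.
  rewrite (_ : z.1 + h *: v - z.1 = h *: v) in H; last by rewrite addrC addKr.
  rewrite dotZr in H.
  rewrite (_ : _ - _ - h * _ = eps *
    (phi 0%N (half_sq (z.1 + h *: v)) - phi 0%N (half_sq z.1) -
     h * dot (gradV z.1) v)); last by rewrite dotZl; ring.
  rewrite normrM -!mulrA ler_wpM2l//.
  apply: le_trans H _; rewrite normrZ ler_wpM2l// exprMn.
  by rewrite le_eqVlt; apply/orP; left; apply/eqP; rewrite (normrX2 h); ring.
Qed.

Lemma continuous_gradV_bounded (X : R -> E) : continuous X ->
  (exists C : R, forall t, `|X t| <= C) -> continuous (fun t => gradV (X t)).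
Proof.
move=> cX [C XC].
have C0 : 0 <= C by exact: le_trans (normr_ge0 _) (XC 0).
have [L L0 HL] := @ex_radial_estimate R n _ phiC11 _ C0.
exact: continuous_gradV HL _ cX XC.
Qed.

Lemma clamp_path_bounded (W : normedModType R) (X : R -> W) : continuous X ->
  (forall t, X (clamp t) = X t) -> exists C : R, forall t, `|X t| <= C.
Proof.
move=> cX Xc.
have [|r _ rP] := @EVT_max R (fun x => `|X x|) 0 1 ler01.
  by apply: continuous_subspaceT => x; apply: cvg_norm; exact: cX.
exists `|X r| => t; rewrite -Xc; apply: rP.
by rewrite in_itv; exact: clamp_itv.
Qed.

(** Running the curve as [g (t * s)] reduces time [t] to time 1: the initial velocity is scaled by
    [t] and the force by [t ^+ 2]. A single fixed-point equation thus covers all times in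
    [[0, 1]]. *)
Lemma ham_curve_path (eps : R) (x a : E) (t : R) (g : R -> E * E) : 0 <= t <=
  1 ->
  ham_curve (hamiltonian V eps) (x, a) t g ->
  let X s := (g (t * clamp s)).1 in let P s := (g (t * clamp s)).2 in
  [/\ continuous X, continuous P,
      forall s, X s = x + clamp s *: (t *: a) +
        (t ^+ 2 * eps) *: initial_op (fun r => gradV (X r)) s &
      forall s, P s = a - (t * eps) *: VI (fun r => gradV (X r)) s].
Proof.
move=> t01 [c [b [/andP[c0 b0] /andP[ct tb] g0 gd]]] X P.
have /andP[t0 t1] := t01.
have gd' (s : R) : 0 <= s <= 1 -> is_derive (t * s) 1 g (ham_field (hamiltonian
  V eps) (g (t * s))).
  move=> /andP[s0 s1]; apply: gd.
  have ts0 : 0 <= t * s by rewrite mulr_ge0.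
  have ts1 : t * s <= t by rewrite ler_piMr.
  by rewrite (lt_le_trans c0)//= (le_lt_trans ts1).
have Xd (s : R) : 0 <= s <= 1 -> is_derive s 1 (fun r =>
  (g (t * r)).1) (t *: P s).
  move=> s01; have := is_derive_dilation t01 (is_derive_fst (gd' s s01)).
  by rewrite ham_fieldE /= /P clamp_id.
have Pd (s : R) : 0 <= s <= 1 -> is_derive s 1 (fun r => (g (t * r)).2)
    (t *: - (eps *: gradV (X s))).
  move=> s01; have := is_derive_dilation t01 (is_derive_snd (gd' s s01)).
  by rewrite ham_fieldE /= /X clamp_id.
have cX : continuous X.
  move=> s; apply: (@continuous_comp _ _ _ clamp (fun r => (g (t * r)).1)).
    exact: continuous_clamp.
  exact: is_derive_continuous (Xd _ (clamp_itv s)).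
have cP : continuous P.
  move=> s; apply: (@continuous_comp _ _ _ clamp (fun r => (g (t * r)).2)).
    exact: continuous_clamp.
  exact: is_derive_continuous (Pd _ (clamp_itv s)).
have Xb : exists C : R, forall r, `|X r| <= C.
  by apply: clamp_path_bounded => // r; rewrite /X clampK.
have cN := continuous_gradV_bounded cX Xb.
have [Il Ic _] := @VI_operator R n.
have X0 : X 0 = x by rewrite /X clamp0 mulr0 g0.
have P0 : P 0 = a by rewrite /P clamp0 mulr0 g0.
have FTC (F w : R -> E) s : continuous w ->
    (forall r : R, 0 <= r <= 1 -> is_derive r 1 F (w r)) ->
    F (clamp s) = F 0 + VI w s.
  move=> cw Fw; apply/rowP => i; rewrite !mxE.
  rewrite (_ : I _ s = F (clamp s) 0 i - F 0 0 i); first by rewrite addrC subrK.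
  apply: (@I_FTC R (fun r => F r 0 i)).
    by move/continuous_rowP : cw.
  by move=> r /Fw; exact: is_derive_coord.
have VIZ (k : R) (w : R -> E) s : continuous w ->
    VI (fun r => k *: w r) s = k *: VI w s.
  move=> cw; have := Il (k - 1) w w cw cw s.
  rewrite (_ : (fun r => _) = fun r => k *: w r); last first.
    by apply/funext => r; lmod R 'rV[R]_n.
  by move=> ->; lmod R 'rV[R]_n.
have PE s : P s = a - (t * eps) *: VI (fun r => gradV (X r)) s.
  rewrite (_ : P s = (g (t * 0)).2 +
    VI (fun r => (- (t * eps)) *: gradV (X r)) s).
    by rewrite mulr0 g0 /= VIZ// scaleNr.
  apply: (FTC (fun r => (g (t * r)).2)).
  - by move=> r; apply: cvgZr; exact: cN.
  - move=> r /Pd; rewrite (_ : t *: - _ = (- (t * eps)) *: gradV (X r))//.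
    by lmod R 'rV[R]_n.
split=> // s.
have cVN : continuous (VI (fun r => gradV (X r))) by exact: Ic.
have -> : X s = (g (t * 0)).1 + VI (fun r => t *: P r) s.
  have ctP : continuous (fun r => t *: P r) by move=> r; apply: cvgZr;
    exact: cP.
  exact: (FTC (fun r => (g (t * r)).1) _ s ctP Xd).
have -> : (fun r => t *: P r) =
   (fun r => (- (t ^+ 2 * eps)) *: VI (fun r => gradV (X r)) r + t *: a).
  by apply/funext => r; rewrite PE; lmod R 'rV[R]_n.
rewrite Il//; last by move=> r; exact: cvg_cst.
have -> : VI (fun=> t *: a) s = clamp s *: (t *: a).
  by apply/rowP => i; rewrite mxE I_cst [RHS]mxE mulrC.
rewrite mulr0 g0 /= initial_opE.
by lmod R 'rV[R]_n.
Qed.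

(** Causality of the double integral: its value at [t] sees the force only up to [t]. This is what a
    first-exit argument needs. *)
Lemma initial_op_upto (w v : R -> E) (t : R) :
  (forall s : R, 0 <= s <= clamp t -> w s = v s) ->
  initial_op w t = initial_op v t.
Proof.
move=> wv.
apply/rowP => i.
transitivity (- I (I (fun r => w r 0 i)) t); first exact: initial_op_coord.
transitivity (- I (I (fun r => v r 0 i)) t); last exact/esym/initial_op_coord.
suff -> : I (I (fun r => w r 0 i)) t = I (I (fun r => v r 0 i)) t by [].
apply: eq_I_upto => s /andP[s0 st].
apply: eq_I_upto => r /andP[r0 rs]; rewrite wv// r0 (le_trans rs)//.
have /andP[t0 t1] := clamp_itv t.
by rewrite clamp_id// s0 (le_trans st).
Qed.

Section small_eps.
Variables (M B L : R).
Hypotheses (M0 : 0 <= M) (BM : 2 * M + 1 <= B) (L0 : 0 <= L).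
Hypothesis estL : radial_estimate (n := n) phi B L.

(* Otherwise consider the first time at which the path reaches norm [B]: up to
   that time the force is at most [L], so that the path has moved too little. *)
Lemma path_bound (eps : R) (x a : E) (X : R -> E) : `|x| <= M -> `|a| <= M ->
  0 <= eps -> eps * L <= 1 / 4 -> continuous X ->
  (forall s, X (clamp s) = X s) ->
  (forall s, X s = x + clamp s *: a +
     eps *: initial_op (fun r => gradV (X r)) s) ->
  forall s, `|X s| <= B.
Proof.
move=> xM aM e0 eL cX Xc XE.
have m0 := M0; have bm := BM.
have B0 : 0 <= B by lra.
have stop (s : R) : 0 <= s <= 1 -> (forall r : R, 0 <= r <= s -> `|X r| <= B) ->
    `|X s| <= 2 * M + 1 / 4.
  move=> s01 Xs; rewrite XE; have /andP[s0 s1] := s01.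
  (* Stopping the path at [s] makes the bound by [B] hold at all times and leaves the force before
     [s] unchanged. *)
  pose Y (r : R) := X (Num.min s (clamp r)).
  have cY : continuous Y.
    move=> r; apply: (@continuous_comp _ _ _ (fun r => Num.min s (clamp r)) X);
      last exact: cX.
    by apply: (continuous_min (f := fun=> s));
      [exact: cvg_cst|exact: continuous_clamp].
  have YB r : `|Y r| <= B.
    have /andP[r0 r1] := clamp_itv r.
    by apply: Xs; rewrite le_min s0 r0 ge_min lexx.
  have -> : initial_op (fun r => gradV (X r)) s = initial_op (fun r =>
    gradV (Y r)) s.
    apply: initial_op_upto => r; rewrite clamp_id// => /andP[r0 rs].
    by rewrite /Y clamp_id ?r0 ?(le_trans rs)// min_r.
  have [_ _ Ib] := @initial_op_operator R n.
  have cN : continuous (fun r => gradV (Y r)) by exact: continuous_gradV estL _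
    cY YB.
  have : `|initial_op (fun r => gradV (Y r)) s| <= 1 * L.
    by apply: Ib => // r; have [_] := estL (YB r) (YB r).
  rewrite mul1r => IL; apply: le_trans (ler_normD _ _) _; apply: lerD.
    apply: le_trans (ler_normD _ _) _; have := norm_clampZ a s; lra.
  rewrite normrZ ger0_norm//; apply: le_trans eL.
  by rewrite ler_wpM2l.
move=> s1; rewrite leNgt; apply/negP => Xs1.
pose Z := [set s : R | 0 <= s <= 1 /\ B <= `|X s|].
have Zs1 : Z (clamp s1) by split; [exact: clamp_itv|rewrite Xc ltW].
have Zlb : has_lbound Z by exists 0 => s [/andP[]].
have Zinf : has_inf Z by split=> //; exists (clamp s1).
pose s0 := inf Z.
have s0_le z : Z z -> s0 <= z by move=> Zz; exact: ge_inf.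
have s00 : 0 <= s0 by apply: lb_le_inf; [exists (clamp s1)|move=> z [/andP[]]].
have s01 : s0 <= 1 by apply: (le_trans (s0_le _ Zs1)); have /andP[] :=
  clamp_itv s1.
have before (s : R) : 0 <= s -> s < s0 -> `|X s| <= 2 * M + 1 / 4.
  move=> ps ss0; have s_1 : s <= 1 by exact: le_trans (ltW ss0) s01.
  apply: stop => [|r /andP[r0 rs]]; first by rewrite ps.
  rewrite leNgt; apply/negP => Xr.
  have : Z r by split; [rewrite r0 (le_trans rs)|exact: ltW].
  by move=> /s0_le; rewrite leNgt (le_lt_trans rs).
(* Before [s0] the norm is at most [2 * M + 1 / 4]. Continuity costs 1/4 on reaching [s0] and 1/4
   just after it, where elements of [Z] must lie; [2 * M + 3 / 4 < B] is the contradiction. *)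
have at_s0 : `|X s0| <= 2 * M + 1 / 2.
  have [->|s0N] := eqVneq s0 0.
    have := stop 0; rewrite lexx ler01 => /(_ isT).
    suff h : `|X 0| <= M by move=> _; lra.
    rewrite XE clamp0 scale0r addr0.
    rewrite (_ : initial_op _ 0 = 0) ?scaler0 ?addr0//.
    apply/rowP => i.
    by rewrite initial_op_coord mxE /I clamp0 set_itv1 Rintegral_set1 oppr0.
  have s0p : 0 < s0 by rewrite lt_def s0N.
  have q0 : (0 : R) < 1 / 4 by rewrite divr_gt0.
  have /continuousP_eps/(_ _ q0)[r r0 Hr] := cX s0.
  pose h := Num.min (r / 2) (s0 / 2).
  have h0 : 0 < h by rewrite lt_min !divr_gt0.
  have hr : h <= r / 2 by rewrite ge_min lexx.
  have hs : h <= s0 / 2 by rewrite ge_min lexx orbT.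
  have hN : `|- h| < r by rewrite normrN gtr0_norm//; lra.
  have := Hr _ hN; have := before (s0 - h); rewrite subr_ge0.
  have hs0 : h <= s0 by lra.
  have hs1 : s0 - h < s0 by lra.
  move=> /(_ hs0 hs1) b1 b2.
  have -> : X s0 = X (s0 - h) - (X (s0 - h) - X s0) by rewrite opprB addrC
    subrK.
  by apply: le_trans (ler_normB _ _) _; lra.
have q0 : (0 : R) < 1 / 4 by rewrite divr_gt0.
have /continuousP_eps/(_ _ q0)[r r0 Hr] := cX s0.
have [z Zz zr] : exists2 z, Z z & z < s0 + r by exact: inf_adherent.
have s0z := s0_le z Zz.
have hz : `|z - s0| < r by rewrite ger0_norm ?subr_ge0// ltrBlDl.
have := Hr _ hz; rewrite (addrC s0) subrK => Xz.
case: Zz => _; apply/negP; rewrite -ltNge.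
have -> : X z = X s0 + (X z - X s0) by rewrite addrC subrK.
by apply: le_lt_trans (ler_normD _ _) _; lra.
Qed.

End small_eps.
End hamiltonian_flow.

(** * First variation of the cost *)

Section trajectories.
Context {R : realType} {n : nat}.
Variables (phi : nat -> R -> R) (V : 'rV[R]_n -> R).
Hypothesis phiC11 : forall (Q : R) k, C11_on 0 Q (phi k) (phi k.+1).
Hypothesis VE : forall x, V x = phi 0%N (half_sq x).
Local Notation E := 'rV[R]_n.
Local Notation gradV := (@gradV R n phi).
Variables (M B L eps : R).
Hypotheses (M0 : 0 <= M) (BM : 2 * M + 1 <= B) (L0 : 0 <= L).
Hypothesis estL : radial_estimate (n := n) phi B L.
Hypotheses (eps0 : 0 < eps) (eps1 : eps <= 1) (epsL : eps * L <= 1 / 4).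

Definition trajectory (x a : E) (X P : R -> E) :=
  [/\ X 0 = x, P 0 = a,
      forall s : R, 0 <= s <= 1 -> is_derive s 1 X (P s) &
      forall s : R, 0 <= s <= 1 -> is_derive s 1 P (- (eps *: gradV (X s)))].

Lemma trajectory_continuous (x a : E) X P : trajectory x a X P ->
  continuous (fun s => X (clamp s)) /\ continuous (fun s => P (clamp s)).
Proof.
move=> [_ _ dX dP]; split=> s.
  apply: (@continuous_comp _ _ _ clamp X); first exact: continuous_clamp.
  exact: is_derive_continuous (dX _ (clamp_itv s)).
apply: (@continuous_comp _ _ _ clamp P); first exact: continuous_clamp.
exact: is_derive_continuous (dP _ (clamp_itv s)).
Qed.

Definition integral_path (x a : E) (X : R -> E) :=
  [/\ continuous X, forall s, X (clamp s) = X s, forall s, `|X s| <= B &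
      forall s, X s = x + clamp s *: a +
        eps *: initial_op (fun r => gradV (X r)) s].

(** The flow is defined by choice, separately at each time, so uniqueness of solutions is needed to
    see that its values form a single trajectory. *)
Lemma Phi_trajectory (x a : E) : `|x| <= M -> `|a| <= M ->
  flow_defined (hamiltonian V eps) 1 (x, a) ->
  exists X P, [/\ trajectory x a X P, integral_path x a (fun s => X (clamp s)) &
    forall t : R, 0 <= t <= 1 -> Phi V eps t x a = X t].
Proof.
move=> xM aM [g gH]; have e0 := ltW eps0; have l0 := L0.
have [c [b [c0b c1b g0 gd]]] := gH.
have k0 (t : R) : 0 <= t <= 1 -> 0 <= t ^+ 2 * eps <= eps.
  move=> /andP[t0 t1]; rewrite mulr_ge0 ?sqr_ge0//= ler_piMl//.
  by rewrite exprn_ile1.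
have kL (t : R) : 0 <= t <= 1 -> t ^+ 2 * eps * L <= 1 / 4.
  move=> /k0/andP[_ te]; apply: le_trans epsL; exact: ler_wpM2r.
have bnd (t : R) (h : R -> E * E) : 0 <= t <= 1 ->
    ham_curve (hamiltonian V eps) (x, a) t h ->
    [/\ continuous (fun s => (h (t * clamp s)).1),
        forall s, `|(h (t * clamp s)).1| <= B &
        forall s, (h (t * clamp s)).1 = x + clamp s *: (t *: a) +
         (t ^+ 2 * eps) *: initial_op (fun r => gradV (h (t * clamp r)).1) s].
  move=> t01 /(ham_curve_path phiC11 VE t01)[cX _ XE _]; split=> //.
  have /andP[k1 k2] := k0 t t01; have /andP[t0 t1] := t01.
  have taM : `|t *: a| <= M.
    by rewrite normrZ ger0_norm// (le_trans _ aM)// ler_piMl.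
  have Xc s : (h (t * clamp (clamp s))).1 = (h (t * clamp s)).1 by rewrite
    clampK.
  exact: (path_bound M0 BM estL xM taM k1 (kL t t01) cX Xc XE).
have i01 : 0 <= (1 : R) <= 1 by rewrite ler01 lexx.
exists (fun s => (g s).1), (fun s => (g s).2); split.
- split; rewrite ?g0// => s /andP[s0 s1]; have /gd gs : c < s < b.
  + by move: c0b c1b => /andP[? ?] /andP[? ?]; apply/andP; split; lra.
  + by have := is_derive_fst gs; rewrite (ham_fieldE phiC11 VE).
  + by move: c0b c1b => /andP[? ?] /andP[? ?]; apply/andP; split; lra.
  + by have := is_derive_snd gs; rewrite (ham_fieldE phiC11 VE).
- have [cX XB XE] := bnd 1 g i01 gH.
  have E1 : (fun s => (g (1 * clamp s)).1) = fun s => (g (clamp s)).1.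
    by apply/funext => s; rewrite mul1r.
  have E2 : (fun s => gradV (g (1 * clamp s)).1) = fun s =>
    gradV (g (clamp s)).1.
    by apply/funext => s; rewrite mul1r.
  rewrite E1 in cX; split; first exact: cX.
  + by move=> s; rewrite clampK.
  + by move=> s; rewrite -[clamp s]mul1r.
  + by move=> s; have := XE s; rewrite E2 mul1r scale1r expr1n mul1r.
move=> t t01; rewrite /Phi /ham_flow.
have gHt : ham_curve (hamiltonian V eps) (x, a) t g.
  exists c, b; split=> //; move: c0b c1b t01 =>
    /andP[? ?] /andP[? ?] /andP[? ?].
  by apply/andP; split; lra.
have : exists w, [set w | exists2 h, ham_curve (hamiltonian V eps) (x,
  a) t h & h t = w] w.
  by exists (g t), g.
(* The selected curve [h] may differ from [g] and live on another interval. Both satisfy the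
   rescaled equation with the same data, so their distance is at most [2 * 0]. *)
move=> /(@xgetPex _ (x, a)); set w := xget _ _ => -[h hH <-].
have [ch hB hE] := bnd t h t01 hH; have [cg gB gE] := bnd t g t01 gHt.
have /andP[k1 k2] := k0 t t01.
have Ti := scaled_operator k1 (@initial_op_operator R n).
have k1' : 0 <= t ^+ 2 * eps * 1 by rewrite mulr1.
have kL1 : t ^+ 2 * eps * 1 * L <= 1 / 2.
  by rewrite mulr1; have := kL t t01; lra.
have b0 s : `|(x + clamp s *: (t *: a)) - (x + clamp s *: (t *: a))| <= (0 : R).
  by rewrite subrr normr0.
have := fixed_path_dist L0 k1' kL1 Ti estL ch cg hB gB hE gE b0 1.
by rewrite mulr0 clamp1 mulr1 normr_le0 subr_eq0 => /eqP.
Qed.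

Lemma continuous_V (X : R -> E) : continuous X ->
  (exists C : R, forall t, `|X t| <= C) -> continuous (fun t => V (X t)).
Proof.
move=> cX [C XC].
have fX : family_deriv 1 (fun _ : R => X) (fun _ _ => 0).
  exact: (@family_deriv_cst R _ 1 X C).
have XC' (s t : R) : `|s| < 1 -> `|X t| <= C by [].
have [[D HD] _ _] := family_deriv_phi phiC11 0 XC' fX.
have z1 : `|0 : R| < 1 by rewrite normr0.
have [c _] := HD 0 z1.
rewrite (_ : (fun t => V (X t)) = fun t => phi 0%N (half_sq (X t)))//.
by apply/funext => t; rewrite VE.
Qed.

Lemma continuous_lagrangian (X P : R -> E) : continuous X -> continuous P ->
  (forall t, X (clamp t) = X t) ->
  continuous (fun t => lagrangian V eps (X t) (P t)).
Proof.
move=> cX cP Xc t; rewrite /lagrangian; apply: cvgB.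
  by apply: cvgM; [exact: cvg_cst|exact: (continuous_bilinear
    dot_bounded_bilinear)].
apply: cvgM; first exact: cvg_cst.
by apply: continuous_V => //; exact: clamp_path_bounded.
Qed.

Lemma action_I (g X P : R -> E) :
  (forall t : R, 0 <= t <= 1 -> g t = X t) ->
  (forall t : R, 0 <= t <= 1 -> deriv_within `[0, 1] g t = P t) ->
  action (lagrangian V eps) g = I (fun t => lagrangian V eps (X t) (P t)) 1.
Proof.
move=> gX gP; rewrite /action /I clamp1; apply: eq_Rintegral => t.
by rewrite inE/= in_itv/= => t01; rewrite gX// gP.
Qed.

Lemma clusters_at_itv01 (t : R) : `[0, 1]%classic t -> clusters_at `[0, 1] t.
Proof.
rewrite /= in_itv/= => /andP[t0 t1] r r0.
pose h := Num.min (r / 2) (1 / 2).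
have h0 : 0 < h by rewrite lt_min !divr_gt0.
have h1 : h <= 1 / 2 by rewrite ge_min lexx orbT.
have hr : h <= r / 2 by rewrite ge_min lexx.
have [th|th] := leP t (1 / 2).
  exists h; first by rewrite gt_eqF.
  by rewrite gtr0_norm//= in_itv/=; split; [lra|apply/andP; split; lra].
exists (- h); first by rewrite oppr_eq0 gt_eqF.
by rewrite normrN gtr0_norm//= in_itv/=; split; [lra|apply/andP; split; lra].
Qed.

Lemma dwithin_clamp_continuous (g g' : R -> E) :
  (forall t : R, 0 <= t <= 1 -> has_dwithin `[0, 1] g t (g' t)) ->
  continuous (fun t => g (clamp t)).
Proof.
move=> dg t; apply/continuousP_eps => e e0.
have [r r0 Hr] := has_dwithin_continuous (dg _ (clamp_itv t)) e0.
exists r => // h hr.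
have -> : clamp (t + h) = clamp t + (clamp (t + h) - clamp t).
  by rewrite [RHS]addrC subrK.
apply: Hr.
  apply: le_lt_trans (clamp_lip _ _) _.
  by rewrite (addrC t) addrK.
by rewrite [X in _ X]addrC subrK /= in_itv/= clamp_itv.
Qed.

(** The upper bound on the potential bounds the actions from below; without such a bound [inf] would
    be a default value and not compare with any action. *)
Lemma action_ge (K : R) (x y : E) g : (forall x, V x <= K) ->
  smooth_path x y g -> - (eps * K) <= action (lagrangian V eps) g.
Proof.
move=> VK [sg _ _]; have e0 := ltW eps0.
pose g' := deriv_within `[0, 1] g.
have dg t : 0 <= t <= 1 -> has_dwithin `[0, 1] g t (g' t).
  move=> t01; have Dt : `[0, 1]%classic t by rewrite /= in_itv.
  exact: (smooth_on_dwithin 0 sg Dt).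
have dg' t : 0 <= t <= 1 -> has_dwithin `[0, 1] g' t (deriv_within `[0,
  1] g' t).
  move=> t01; have Dt : `[0, 1]%classic t by rewrite /= in_itv.
  exact: (smooth_on_dwithin 1 sg Dt).
have cg := dwithin_clamp_continuous dg; have cg' :=
  dwithin_clamp_continuous dg'.
rewrite (@action_I g (fun t => g (clamp t)) (fun t => g' (clamp t)));
  first last.
- by move=> t t01; rewrite clamp_id.
- by move=> t t01; rewrite clamp_id.
apply: (@le_trans _ _ (I (fun=> - (eps * K)) 1)).
  by rewrite I_cst clamp1 mulr1.
apply: I_le.
- by move=> t; exact: cvg_cst.
- by apply: continuous_lagrangian => // t; rewrite clampK.
move=> t _; rewrite /lagrangian lerBrDr.
have := dot_ge0 (g' (clamp t)); have : eps * V (g (clamp t)) <= eps * K.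
  by rewrite ler_wpM2l.
by lra.
Qed.

Lemma cost_le (K : R) (x y : E) g : (forall x, V x <= K) ->
  smooth_path x y g -> cost (lagrangian V eps) x y <=
    action (lagrangian V eps) g.
Proof.
move=> VK sg; apply: ge_inf; last by exists g.
by exists (- (eps * K)) => _ [h hs <-]; exact: action_ge hs.
Qed.

(* The test curve for [x + v] is the minimizer from [x], sheared by
   [(1 - t) v]; the first-order change of its action is [- dot a v]. *)
Lemma cost_shift_le : (exists K, forall x, V x <= K) ->
  exists2 C : R, 0 <= C & forall (x a v : E), `|x| <= M -> `|a| <= M ->
  regular V eps (x, a) -> `|v| <= 1 ->
  cost (lagrangian V eps) (x + v) (Phi V eps 1 x a) <=
  cost (lagrangian V eps) x (Phi V eps 1 x a) - dot a v + C * `|v| ^+ 2.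
Proof.
move=> [K VK]; have m0 := M0; have bm := BM; have e0 := ltW eps0.
(* The sheared path leaves the ball of radius [B] by at most [|v| <= 1], so the Taylor estimate is
   taken on the larger ball. *)
have B10 : 0 <= B + 1 by lra.
have [L' L'0 estL'] := @ex_radial_estimate R n _ phiC11 _ B10.
exists (n%:R + L') => [|x a v xM aM]; first by rewrite addr_ge0.
move=> [/= fl sp pact _] v1.
have [X [P [tr ip PhiX]]] := Phi_trajectory xM aM fl.
have [X0 P0 dX dP] := tr; have [cX cP] := trajectory_continuous tr.
have [_ _ XB _] := ip.
pose p := fun t => Phi V eps t x a.
have pX t : 0 <= t <= 1 -> p t = X t by exact: PhiX.
have [sp0 p0 p1] := sp.
have dp t : 0 <= t <= 1 -> has_dwithin `[0, 1] p t (P t).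
  move=> t01; have Dt : `[0, 1]%classic t by rewrite /= in_itv.
  apply: (eq_has_dwithin (g := X)) => //.
    by move=> s; rewrite /= in_itv/= => /pX.
  exact: is_derive_dwithin (dX t t01).
have dpE t : 0 <= t <= 1 -> deriv_within `[0, 1] p t = P t.
  move=> t01; apply: deriv_withinE; last exact: dp.
  by apply: clusters_at_itv01; rewrite /= in_itv.
pose q t := p t + (1 - t) *: v.
(* Candidates for all derivatives of [q], since admissible curves must be smooth. The shear is
   affine in time and contributes only to orders 0 and 1. *)
pose G k t := iter k (deriv_within `[0, 1]) p t +
  match k with 0 => (1 - t) *: v | 1 => - v | _ => 0 end.
have [sq qG] : smooth_on `[0, 1] q /\
    forall k t, `[0, 1]%classic t -> iter k (deriv_within `[0, 1]) q t = G k t.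
  apply: smooth_onI => //; first exact: clusters_at_itv01.
  move=> k t Dt; have H := smooth_on_dwithin k sp0 Dt.
  have aff (b c : E) : has_dwithin `[0, 1] (fun s => b + s *: c) t c.
    exact: has_dwithin_affine.
  rewrite /G; case: k H => [|[|k]] H; apply: (has_dwithinD H).
  - have -> : (fun s => (1 - s) *: v) = (fun s => v + s *: - v).
      by apply/funext => s; lmod R 'rV[R]_n.
    exact: aff.
  - exact: has_dwithin_cst.
  - exact: has_dwithin_cst.
have spq : smooth_path (x + v) (Phi V eps 1 x a) q.
  split=> //.
    by rewrite /q /p p0 subr0 scale1r.
  by rewrite /q subrr scale0r addr0.
have := cost_le VK spq.
rewrite -pact.
have i01 : 0 <= (1 : R) <= 1 by rewrite ler01 lexx.
have XC t : X (clamp (clamp t)) = X (clamp t) by rewrite clampK.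
rewrite (@action_I p (fun t => X (clamp t)) (fun t => P (clamp t))); first last.
- by move=> t t01; rewrite clamp_id// dpE.
- by move=> t t01; rewrite clamp_id// pX.
pose Y t := X (clamp t) + (1 - clamp t) *: v.
rewrite (@action_I q Y (fun t => P (clamp t) - v)); first last.
- move=> t t01; have Dt : `[0, 1]%classic t by rewrite /= in_itv.
  by have := qG 1 t Dt; rewrite /= => ->; rewrite clamp_id// /G /= dpE.
- by move=> t t01; rewrite /Y clamp_id// /q pX.
have cY : continuous Y.
  by move=> t; apply: cvgD; [exact: cX|exact: continuous_onem_clampZ].
have cPv : continuous (fun t => P (clamp t) - v).
  by move=> t; apply: cvgB; [exact: cP|exact: cvg_cst].
have YB t : `|Y t| <= B + 1.
  apply: le_trans (ler_normD _ _) _; rewrite lerD ?XB//.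
  exact: le_trans (norm_onem_clampZ _ _) _.
have XB1 t : `|X (clamp t)| <= B + 1 by rewrite (le_trans (XB t))// lerDl.
have cLX := continuous_lagrangian cX cP XC.
have cLY : continuous (fun t => lagrangian V eps (Y t) (P (clamp t) - v)).
  by apply: continuous_lagrangian => // t; rewrite /Y !clampK.
(* First-order change of the Lagrangian under the shear. By Hamilton's equation it is the derivative
   of [dot (P s) v * (1 - s)], so only the boundary value [- dot a v] at time 0 is left. *)
pose D t := dot (- (eps *: gradV (X (clamp t)))) v * (1 - clamp t) -
  dot (P (clamp t)) v.
have cg : continuous (fun t => gradV (X (clamp t))).
  exact: continuous_gradV estL _ cX XB.
have ccst (W : normedModType R) (c : W) : continuous (fun _ : R => c).
  by move=> t; exact: cvg_cst.
have cc1 : continuous (fun t : R => 1 - clamp t).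
  by move=> t; apply: cvgB; [exact: cvg_cst|exact: continuous_clamp].
have cD : continuous D.
  move=> t; apply: cvgB.
    apply: cvgM; last exact: cc1.
    apply: (continuous_bilinear dot_bounded_bilinear); last exact: ccst.
    by move=> s; apply: cvgN; apply: cvgZr; exact: cg.
  by apply: (continuous_bilinear dot_bounded_bilinear); [exact: cP|exact: ccst].
have ID : I D 1 = - dot a v.
  pose F (s : R) : R := dot (P s) v * (1 - s).
  transitivity (F (clamp 1) - F 0).
    apply: (@I_FTC R F D 1 cD) => s s01.
    have H1 := is_derive_dot v (dP s s01).
    have H2 : is_derive s 1 (fun r : R => 1 - r) (- 1).
      apply/is_derive_eps => e e00; exists 1 => // h _.
      have -> : 1 - (s + h) - (1 - s) - h *: (- 1) = 0 :> R.
        by rewrite /GRing.scale/=; ring.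
      by rewrite normr0 mulr_ge0// ltW.
    have H3 := is_deriveM H1 H2.
    have -> : D s = dot (P s) v *: (- 1) +
        (1 - s) *: dot (- (eps *: gradV (X s))) v.
      by rewrite /D clamp_id// /GRing.scale/=; ring.
    exact: H3.
  by rewrite /F clamp1 /= subrr mulr0 sub0r subr0 mulr1 P0.
move=> H; apply: (le_trans H).
(* [n%:R] pays for the kinetic term [dot v v / 2] in the sup norm, and [L'] for the Taylor remainder
   of the potential, as [eps <= 1]. *)
set c := (n%:R + L') * `|v| ^+ 2.
set LX := fun t => lagrangian V eps (X (clamp t)) (P (clamp t)).
apply: (@le_trans _ _ (I (fun t => 1 * LX t + (1 * D t + c)) 1)); last first.
  rewrite I_lin//; last first.
    by move=> t; apply: cvgD; [apply: cvgM; [exact: cvg_cst|exact: cD]|exact: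
      cvg_cst].
  rewrite I_lin//; last by move=> t; exact: cvg_cst.
  by rewrite !mul1r ID I_cst clamp1 mulr1 addrA.
apply: I_le => //.
  move=> t; apply: cvgD; first by apply: cvgM; [exact: cvg_cst|exact: cLX].
  by apply: cvgD; [apply: cvgM; [exact: cvg_cst|exact: cD]|exact: cvg_cst].
move=> t _; rewrite !mul1r /LX /lagrangian /D.
have [[_ _ _ HV] _] := estL' _ _ (YB t) (XB1 t).
rewrite -!VE in HV.
have YX : Y t - X (clamp t) = (1 - clamp t) *: v by rewrite /Y addrC addKr.
rewrite YX dotZr in HV.
have HV2 : V (X (clamp t)) - V (Y t) <=
    L' * `|v| ^+ 2 - (1 - clamp t) * dot (gradV (X (clamp t))) v.
  have : L' * `|(1 - clamp t) *: v| ^+ 2 <= L' * `|v| ^+ 2.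
    by rewrite ler_wpM2l// lerXn2r ?nnegrE// norm_onem_clampZ.
  by move: HV; rewrite ler_norml => /andP[? ?]; lra.
have HV3 := ler_wpM2l e0 HV2.
have v2 : 0 <= `|v| ^+ 2 by rewrite sqr_ge0.
have HV4 : eps * (L' * `|v| ^+ 2) <= L' * `|v| ^+ 2.
  by rewrite ler_piMl// mulr_ge0.
have dv := dot_le_norm v; have dv0 := dot_ge0 v.
rewrite !(dotDl, dotDr, dotNl, dotNr) (dotZl eps) (dotC v).
rewrite /c mulrDl.
move: HV3 HV4 dv dv0; rewrite mulrBr mulrBr.
set d1 := dot (P _) (P _); set d2 := dot (P _) v; set d3 := dot (gradV _) v.
set w1 := V _; set w2 := V (Y t); set d4 := dot v v.
rewrite (_ : eps * ((1 - clamp t) * d3) = eps * d3 * (1 - clamp t));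
  last by ring.
rewrite mulNr.
set k1 := eps * d3 * _; set k2 := eps * (L' * _); set k3 := n%:R * _; set k4 :=
  L' * _.
by lra.
Qed.

End trajectories.

(** * Local inversion of the time-one map and the gradient of the cost *)

Section inverse.
Context {R : realType} {n : nat}.
Variables (phi : nat -> R -> R) (V : 'rV[R]_n -> R).
Hypothesis phiC11 : forall (Q : R) k, C11_on 0 Q (phi k) (phi k.+1).
Hypothesis VE : forall x, V x = phi 0%N (half_sq x).
Local Notation E := 'rV[R]_n.
Local Notation gradV := (@gradV R n phi).
Variables (M B L eps : R) (W : set (E * E)).
Hypotheses (M0 : 0 <= M) (BM : 2 * M + 1 <= B) (L0 : 0 <= L).
Hypothesis estL : radial_estimate (n := n) phi B L.
Hypotheses (eps0 : 0 < eps) (eps1 : eps <= 1) (epsL : eps * L <= 1 / 4).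
Hypothesis Wopen : open W.
Hypothesis Wreg : forall z, W z -> regular V eps z.
Hypothesis WM : forall z, W z -> `|z.1| <= M /\ `|z.2| <= M.
Local Notation integral_path := (integral_path phi B eps).
Local Notation Phi1 := (Phi V eps 1).

Lemma exp_path (x a : E) : W (x, a) ->
  exists2 X, integral_path x a X & Phi1 x a = X 1.
Proof.
move=> Wxa; have [/= xM aM] := WM Wxa; have [fd _ _ _] := Wreg Wxa.
have [X [P [_ XP XE]]] := Phi_trajectory phiC11 VE M0 BM L0 estL eps0 epsL xM
  aM fd.
exists (fun s => X (clamp s)) => //.
by rewrite XE ?ler01 ?lexx// clamp1.
Qed.

Lemma integral_path_dist (x a x' a' : E) X X' :
  integral_path x a X -> integral_path x' a' X' ->
  forall t : R, `|X t - X' t| <= 2 * (`|x - x'| + `|a - a'|).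
Proof.
move=> [cX _ XB XE] [cX' _ XB' XE'].
have e0 := ltW eps0; have l0 := L0; have el := epsL.
have Ti := scaled_operator e0 (@initial_op_operator R n).
have k1 : 0 <= eps * 1 by rewrite mulr1.
have kL1 : eps * 1 * L <= 1 / 2 by rewrite mulr1; lra.
apply: (fixed_path_dist L0 k1 kL1 Ti estL cX cX' XB XB' XE XE') => t.
have -> : x + clamp t *: a - (x' + clamp t *: a') = (x - x') + clamp t *: (a -
  a').
  lmod R 'rV[R]_n.
rewrite (le_trans (ler_normD _ _))// lerD2l normrZ ler_piMl//.
by have /andP[t0 t1] := clamp_itv t; rewrite ger0_norm.
Qed.

(** The time-one map is [x + a] plus a term whose Lipschitz constant is [2 * eps * L], which is at
    most 1/2. *)
Lemma Phi1_remainder (x a x' a' : E) : W (x, a) -> W (x', a') ->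
  `|Phi1 x a - Phi1 x' a' - (x - x') - (a - a')| <=
  1 / 2 * (`|x - x'| + `|a - a'|).
Proof.
move=> /exp_path[X XP ->] /exp_path[X' XP' ->].
have [cX _ XB XE] := XP; have [cX' _ XB' XE'] := XP'.
have gX := continuous_gradV estL cX XB.
have gX' := continuous_gradV estL cX' XB'.
have [Tl _ Tb] := @initial_op_operator R n.
have -> : X 1 - X' 1 - (x - x') - (a - a') =
    eps *: initial_op (fun r => (-1) *: gradV (X' r) + gradV (X r)) 1.
  rewrite XE XE' clamp1 Tl//; lmod R 'rV[R]_n.
set S := `|x - x'| + `|a - a'|; have S0 : 0 <= S by rewrite addr_ge0.
have Hb : `|initial_op (fun r => (-1) *: gradV (X' r) + gradV (X r)) 1| <=
  1 * (L * (2 * S)).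
  apply: Tb => [t|t]; first by apply: cvgD; [apply: cvgZr;
    exact: gX'|exact: gX].
  rewrite scaleN1r addrC.
  have [[+ _ _ _] _] := estL (XB t) (XB' t) => /le_trans; apply.
  by rewrite ler_wpM2l//; exact: integral_path_dist XP XP' t.
rewrite normrZ ger0_norm ?(ltW eps0)//.
apply: (le_trans (ler_wpM2l (ltW eps0) Hb)).
rewrite [leLHS](_ : _ = (eps * L * 2) * S); last by ring.
by rewrite ler_wpM2r//; have := epsL; lra.
Qed.

Lemma local_inverse (x a : E) : W (x, a) ->
  exists2 r : R, 0 < r & forall x' : E, `|x' - x| < r ->
    exists a' : E, [/\ W (x', a'), Phi1 x' a' = Phi1 x a &
      `|a' - a| <= 4 * `|x' - x|].
Proof.
move=> Wxa.
have /nbhs_ballP[r0 r00 Hr0] : nbhs (x, a) W by exact: Wopen.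
have r0' : 0 < r0 by [].
exists (r0 / 4); first by rewrite divr_gt0.
move=> x' x'r.
set rho := 4 * `|x' - x|.
have rhor : rho < r0 by rewrite /rho mulrC -ltr_pdivlMr.
have WU b : `|b - a| <= rho -> W (x', b).
  move=> ba; apply: Hr0; split; rewrite /= -ball_normE /= distrC.
    by apply: lt_le_trans x'r _; lra.
  by apply: le_lt_trans rhor.
pose U := [set b : E | `|b - a| <= rho].
(* Fixed points of [f] reach the prescribed endpoint. [f] contracts by 1/2, and with
   [|b - a| <= 4 |x' - x|] one gets [|f b - a| <= (1 + 1/2 + 2) |x' - x|]; hence the factor 4 in the
   radius. *)
pose f b := b + Phi1 x a - Phi1 x' b.
have fU : {homo f : b / U b >-> U b}.
  move=> b /= Ub.
  have := Phi1_remainder Wxa (WU _ Ub).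
  set e := _ - (a - b) => eb.
  rewrite /U /= (_ : f b - a = e - (x' - x)); last by rewrite /f /e;
    lmod R 'rV[R]_n.
  rewrite (le_trans (ler_normB _ _))//.
  have {}Ub : `|a - b| <= rho by rewrite distrC.
  by move: eb Ub; rewrite /rho [`|x - x'|]distrC; have := normr_ge0 (x' - x);
    lra.
have cU : closed U.
  have c (b : E) : (fun c : E => `|c - a|) @ b --> `|b - a|.
    have c0 : (fun=> a : E) @ b --> a by exact: cst_continuous.
    apply: (@cvg_norm _ E _ _ (nbhs_filter b)).
    exact: (@cvgB _ _ _ _ (nbhs_filter b) id (cst a) b a cvg_id c0).
  rewrite (_ : U = (fun b : E => `|b - a|) @^-1` [set y | y <= rho])//.
  by apply: closed_comp => [b _|]; [exact: c|exact: closed_le].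
have U0 : U !=set0 by exists a; rewrite /U /= subrr normr0 mulr_ge0.
have cf : is_contraction (mkfun_fun fU).
  exists (1/2)%:nng; split; first by rewrite /=; lra.
  move=> [b c] [/= Ub Uc].
  have := Phi1_remainder (WU _ Ub) (WU _ Uc).
  rewrite subrr normr0 add0r subr0 -normrN.
  rewrite (_ : - (_ - (b - c)) = f b - f c); last by rewrite /f;
    lmod R 'rV[R]_n.
  by [].
have [b Ub bE] := banach_fixed_point cf cU U0.
exists b; split=> //; first exact: WU.
move/eqP: bE; rewrite /= /mkfun /f -addrA -subr_eq0 opprD addrA subrr add0r.
by rewrite oppr_eq0 subr_eq0 => /eqP.
Qed.

(** [cost_shift_le] is used twice: from [x] by [v], and from [x + v] by [- v] with the covector [a']
    that leads to the same endpoint. *)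
Lemma cost_gradient (x a : E) : (exists K, forall x, V x <= K) -> W (x, a) ->
  exists C r : R, 0 < r /\ forall v : E, `|v| < r ->
    `|cost (lagrangian V eps) (x + v) (Phi1 x a) -
      cost (lagrangian V eps) x (Phi1 x a) + dot a v| <= C * `|v| ^+ 2.
Proof.
move=> VK Wxa; have [C0 C00 HC] := cost_shift_le phiC11 VE M0 BM L0 estL eps0
  eps1 epsL VK.
have [r r0 Hr] := local_inverse Wxa; have [/= xM aM] := WM Wxa.
exists (C0 + n%:R * 4), (Num.min r 1); split.
  by rewrite lt_min r0 ltr01.
move=> v; rewrite lt_min => /andP[vr /ltW v1].
have up := HC x a v xM aM (Wreg Wxa) v1.
have [|a' [Wa' PE aa']] := Hr (x + v); first by rewrite addrAC subrr add0r.
rewrite addrAC subrr add0r in aa'; have [/= xM' aM'] := WM Wa'.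
have := HC (x + v) a' (- v) xM' aM' (Wreg Wa').
rewrite normrN addrK PE dotNr opprK => /(_ v1) lo.
have dE : dot a' v = dot a v + dot (a' - a) v by rewrite -dotDl addrC subrK.
(* The second use produces [dot a' v] in place of [dot a v]; the Lipschitz bound on [a'] makes the
   difference quadratic in [v]. *)
have d1 : `|dot (a' - a) v| <= n%:R * 4 * `|v| ^+ 2.
  apply: (le_trans (norm_dot_le _ _)).
  rewrite -!mulrA ler_wpM2l// expr2 mulrA ler_wpM2r//.
move: d1; rewrite ler_norml => /andP[d1 d2].
have v2 : 0 <= `|v| ^+ 2 by rewrite sqr_ge0.
have n2 : 0 <= n%:R * 4 * `|v| ^+ 2 by rewrite !mulr_ge0.
by rewrite ler_norml; apply/andP; split; lra.
Qed.

End inverse.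

Section quadratic_remainder.
Context {R : realType} {n : nat}.
Local Notation E := 'rV[R]_n.
Variables (F : E -> R) (x a : E) (C r : R).
Hypothesis r0 : 0 < r.
Hypothesis FC : forall v : E, `|v| < r ->
  `|F (x + v) - F x + dot a v| <= C * `|v| ^+ 2.

(** The quadratic remainder is little-o. The form [- dot a] is packed as a continuous linear map, so
    that uniqueness identifies it with the differential. *)
Lemma quadratic_diff : differentiable F x /\ forall u, 'd F x u = - dot a u.
Proof.
pose d (u : E) : R := - dot a u.
have lin_d : linear d.
  by move=> c u v; rewrite /d dotDr dotZr opprD -mulrN.
pose dM := GRing.isLinear.Build _ _ _ _ _ lin_d.
pose D : {linear E -> R^o} := HB.pack d dM.
have cD : continuous D.
  apply/linear_bounded_continuous/linear_boundedP.
  near=> b => u; rewrite /= /d normrN; apply: (le_trans (norm_dot_le _ _)).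
  by apply: ler_wpM2r => //; near: b; exact: nbhs_pinfty_ge.
have FD : F \o shift x = cst (F x) + D +o_ 0 id.
  apply/eqaddoP => e e0.
  have C1 : 0 < `|C| + 1 by rewrite ltr_wpDl.
  have h1 : \forall v \near (0 : E), `|v| < r by exact:
    pseudometric_normed_Zmodule.nbhs0_lt.
  have h2 : \forall v \near (0 : E), `|v| < e / (`|C| + 1).
    by apply: pseudometric_normed_Zmodule.nbhs0_lt; exact: divr_gt0.
  apply: (filterS2 _ _ h1 h2) => v vr ve.
  rewrite /= !fctE /= opprD addrA /d opprK [v + x]addrC.
  apply: (le_trans (FC vr)); rewrite expr2 mulrA ler_wpM2r//.
  move: ve; rewrite ltr_pdivlMr// mulrDr mulr1 => ve.
  have : C * `|v| <= `|C| * `|v| by rewrite ler_wpM2r// ler_norm.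
  by have := normr_ge0 v; lra.
have dE := diff_unique cD FD.
split; last by move=> u; rewrite dE.
by apply/diff_locallyP; rewrite dE.
Unshelve. all: by end_near. Qed.

Lemma quadratic_is_derive (g : R -> E) (t : R) (g' : E) : g t = x ->
  is_derive t 1 g g' -> is_derive t 1 (fun s => F (g s)) (- dot a g').
Proof.
move=> gt dg; have [dF FE] := quadratic_diff.
have dg1 : differentiable g t by apply/derivable1_diffP; exact: ex_derive.
have dF1 : differentiable F (g t) by rewrite gt.
have dFg : differentiable (F \o g) t by exact: differentiable_comp.
split; first by apply/derivable1_diffP.
rewrite (@deriveE R R R^o (F \o g) t 1 dFg).
have -> : 'd (F \o g) t 1 = 'd F (g t) ('d g t 1).
  by have := diff_comp dg1 dF1 => /(congr1 (fun h => h 1)).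
by rewrite -(@deriveE R R E g t 1 dg1) derive_val gt FE.
Qed.

End quadratic_remainder.

(** * Second derivative of the cost and cross-curvature *)

Section curves.
Context {R : realType} {n : nat}.
Local Notation E := 'rV[R]_n.

Lemma family_deriv_sub (W : normedModType R) (d d' : R) (a a' : R -> R -> W) :
  d' <= d -> family_deriv d a a' -> family_deriv d' a a'.
Proof.
move=> dd [[A HA] [B HB] [C HC]]; have lt (s : R) : `|s| < d' -> `|s| < d.
  by move=> /lt_le_trans; exact.
by split; [exists A => s /lt/HA|exists B => s /lt/HB|exists C =>
  s h t /lt sd /lt; exact: HC].
Qed.

Lemma has_dwithin_coord (D : set R) (g : R -> E) x v i :
  has_dwithin D g x v -> has_dwithin (W := R^o) D (fun y => g y 0 i) x (v 0 i).
Proof.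
move=> H e /H[r r0 Hr]; exists r => // h hr Dh; apply: le_trans (Hr h hr Dh).
apply: le_trans (mx_entry_le _ 0 i).
by rewrite !mxE.
Qed.

Lemma ex_uniform (P : 'I_n -> R -> Prop) : (forall i, exists C, P i C) ->
  (forall i C D, C <= D -> P i C -> P i D) ->
  exists2 C : R, 0 <= C & forall i, P i C.
Proof.
move=> /choice[C PC] mono; exists (\sum_i `|C i|); first exact: sumr_ge0.
move=> i; apply: mono (PC i); rewrite (bigD1 i)//= (le_trans (ler_norm _))//.
by rewrite lerDl sumr_ge0.
Qed.

(** A curve is viewed as a family of paths constant in time, so that the calculus of families
    applies to it. Halving the interval gives a compact one, on which all derivatives are
    bounded. *)
Lemma smooth_curve_family (g : R -> E) (d : R) : 0 < d ->
  smooth_on `]- d, d[ g -> exists r (G : nat -> R -> E), [/\ 0 < r, G 0%N = g &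
    forall k, family_deriv r (fun s _ : R => G k s) (fun s _ => G k.+1 s)].
Proof.
move=> d0 sg; pose r := d / 2; have r0 : 0 < r by rewrite divr_gt0.
pose D := `]- d, d[%classic : set R; pose J := `[- r, r]%classic : set R.
have dr : d = 2 * r by rewrite /r; field.
have JD : J `<=` D.
  move=> x; rewrite /J /D /= !in_itv/= dr => /andP[? ?].
  by apply/andP; split; lra.
pose G k := iter k (deriv_within D) g.
have HG k i (x : R) : - r <= x <= r ->
    has_dwithin (W := R^o) J (fun y => G k y 0 i) x (G k.+1 x 0 i).
  move=> xr; apply: has_dwithin_coord; apply: (has_dwithin_sub JD).
  by apply: smooth_on_dwithin => //; apply: JD; rewrite /J /= in_itv.
have C11 k i : C11_on (- r) r (fun y => G k y 0 i) (fun y => G k.+1 y 0 i).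
  exact: dwithin_C11 (HG k i) (HG k.+1 i) (HG k.+2 i).
have sr (s : R) : `|s| < r -> - r <= s <= r.
  by rewrite ltr_norml => /andP[/ltW-> /ltW->].
have bG k : exists C : R, forall x, - r <= x <= r -> `|G k x| <= C.
  have [i|i C C' CC H x xr|C C0 HC] := @ex_uniform (fun i C =>
    forall x : R, - r <= x <= r -> `|G k x 0 i| <= C).
  - by have [C HC] := C11 k i; exists C => x xr; have [] := HC x x xr xr.
  - exact: le_trans (H x xr) CC.
  by exists C => x xr; apply: mx_norm_le => // j i; rewrite ord1; exact: HC.
have bf k : bounded_family r (fun s _ : R => G k s).
  have [C HC] := bG k; exists C => s /sr/HC Cs; split=> // t.
  exact: cst_continuous.
exists r, G; split=> // k; split=> //.
have [i|i C C' CC H x h xr yr|C C0 HC] := @ex_uniform (fun i C =>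
  forall x h : R, - r <= x <= r -> - r <= x + h <= r ->
  `|G k (x + h) 0 i - G k x 0 i - h * G k.+1 x 0 i| <= C * h ^+ 2).
- have [C HC] := C11 k i; exists C => x h xr yr.
  have xh : x + h - x = h by rewrite addrAC subrr add0r.
  by have [_ _ _ _] := HC _ _ yr xr; rewrite xh.
- by apply: (le_trans (H x h xr yr)); rewrite ler_wpM2r// sqr_ge0.
exists C => s h _ /sr sd /sr shd; apply: mx_norm_le => [|j i].
  by rewrite mulr_ge0// sqr_ge0.
by rewrite ord1 !mxE; exact: HC.
Qed.

End curves.

Section second_derivative.
Context {R : realType} {n : nat}.
Variables (phi : nat -> R -> R) (V : 'rV[R]_n -> R).
Hypothesis phiC11 : forall (Q : R) k, C11_on 0 Q (phi k) (phi k.+1).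
Hypothesis VE : forall x, V x = phi 0%N (half_sq x).
Local Notation E := 'rV[R]_n.
Local Notation gradV := (@gradV R n phi).
Local Notation hessV := (@hessV R n phi).
Variables (M B L eps : R) (W : set (E * E)).
Hypotheses (M0 : 0 <= M) (BM : 2 * M + 1 <= B) (L0 : 0 <= L).
Hypothesis estL : radial_estimate (n := n) phi B L.
Hypotheses (eps0 : 0 < eps) (eps1 : eps <= 1) (epsL : eps * L <= 1 / 4).
Hypothesis Wopen : open W.
Hypothesis Wreg : forall z, W z -> regular V eps z.
Hypothesis WM : forall z, W z -> `|z.1| <= M /\ `|z.2| <= M.
Local Notation integral_path := (integral_path phi B eps).
Local Notation Phi1 := (Phi V eps 1).

Lemma cost_cost_diff (x a : E) : (exists K, forall x, V x <= K) -> W (x, a) ->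
  cost_diff_eq (cost (lagrangian V eps)) x (Phi1 x a) a.
Proof.
move=> VK Wxa.
have [C [r [r0 H]]] := cost_gradient phiC11 VE M0 BM L0 estL eps0 eps1 epsL
  Wopen Wreg WM VK Wxa.
exact: quadratic_diff r0 H.
Qed.

(** [cexp] is a choice, so uniqueness is required: any candidate is [Phi1 x a'] with [(x, a')] in
    [W], the differential there is [- a'], and therefore [a' = a]. *)
Lemma cexp_Phi (x a : E) : (exists K, forall x, V x <= K) -> W (x, a) ->
  cexp (cost (lagrangian V eps)) (Kset V eps W) x a = Phi1 x a.
Proof.
move=> VK Wxa; have H := cost_cost_diff VK Wxa.
have : exists y, [set y | Kset V eps W (x, y) /\
    cost_diff_eq (cost (lagrangian V eps)) x y a] y.
  by exists (Phi1 x a); split=> //; exists (x, a).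
move=> /(@xgetPex _ 0) [[[x' a'] Wxa' [<- yE]] [_ DE]].
rewrite /cexp -yE; suff -> : a' = a by [].
have [_ DE'] := cost_cost_diff VK Wxa'.
rewrite -yE /= in DE; apply/rowP => i.
have := DE' (delta_mx 0 i); rewrite DE !dot_delta => /oppr_inj.
exact.
Qed.

(** Along the curve the first derivative of the cost is [- dot (A s) (G 1 s)], where [A s] is the
    covector leading from [G 0 s] to the fixed endpoint. [A s] is merely chosen; its
    differentiability comes from the two-point equation satisfied by the trajectory. *)
Lemma cost_curve_derive2 (x a u : E) (r : R) (G : nat -> R -> E) :
  (exists K, forall x, V x <= K) -> W (x, a) -> 0 < r ->
  (forall k, family_deriv r (fun s _ : R => G k s) (fun s _ => G k.+1 s)) ->
  G 0%N 0 = x -> G 1%N 0 = u ->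
  exists X J : R -> E, [/\ integral_path x a X, continuous J,
    exists C : R, forall t, `|J t| <= C,
    forall t, J t = (1 - clamp t) *: u +
      eps *: boundary_op (fun r => J r *m hessV (X r)) t &
    derive1n 2 (fun t => cost (lagrangian V eps) (G 0%N t) (Phi1 x a)) 0 =
      dot u u + eps * dot (initial_op (fun r => J r *m hessV (X r)) 1) u
      - dot a (G 2%N 0)].
Proof.
move=> VK Wxa r0 fG G0 G1.
have [r1 r10 Hr1] := local_inverse phiC11 VE M0 BM L0 estL eps0 epsL Wopen Wreg
  WM Wxa.
have [D D0 GD] := family_deriv_lip (fG 0%N).
(* [D] is a Lipschitz constant of the curve, so for [|s| < d] the base point stays in the ball where
   the local inverse exists. *)
pose d := Num.min r (r1 / (D + 1)).
have D1 : 0 < D + 1 by rewrite ltr_wpDl.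
have d0 : 0 < d by rewrite lt_min r0 divr_gt0.
have z0 : `|0 : R| < d by rewrite normr0.
have dr : d <= r by rewrite ge_min lexx.
have Gx s : `|s| < d -> `|G 0%N s - x| < r1.
  rewrite lt_min => /andP[sr sD].
  have := GD 0 s 0; rewrite add0r normr0 G0 => /(_ r0 sr) /le_lt_trans; apply.
  move: sD; rewrite ltr_pdivlMr// => /(le_lt_trans _); apply.
  by rewrite mulrC ler_wpM2l// lerDl.
pose y := Phi1 x a.
have : forall s, exists p : E * (R -> E), `|s| < d ->
    [/\ W (G 0%N s, p.1), Phi1 (G 0%N s) p.1 = y, p.2 1 = y,
      integral_path (G 0%N s) p.1 p.2 & `|p.1 - a| <= 4 * `|G 0%N s - x|].
  move=> s; have [sd|] := boolP (`|s| < d); last by exists (a, fun=> a).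
  have [b [Wb PE ba]] := Hr1 _ (Gx s sd).
  have [X XP XE] := exp_path phiC11 VE M0 BM L0 estL eps0 epsL Wreg WM Wb.
  by exists (b, X) => _; split=> //; rewrite /= -XE.
move=> /choice[p Hp].
pose X s := (p s).2; pose A s := (p s).1.
have XB s t : `|s| < d -> `|X s t| <= B by move=> /Hp[_ _ _ [_ _ h _] _];
  exact: h.
have bX : bounded_family d X.
  by exists B => s /Hp[_ _ _ [? _ ? _] _].
have cgr s : `|s| < d -> continuous (fun r => gradV (X s r)).
  by move=> /Hp[_ _ _ [cX _ BX _] _]; exact: (continuous_gradV estL cX BX).
(* The trajectory equation at time 1, solved for the covector. Substituted back, it replaces
   [initial_op] by [boundary_op]. *)
have AE s : `|s| < d -> A s = y - G 0%N s - eps *: initial_op (fun r =>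
  gradV (X s r)) 1.
  move=> sd; have [_ _ yE [_ _ _ /(_ 1) XE] _] := Hp s sd.
  rewrite yE clamp1 -/(X s) -/(A s) in XE.
  by rewrite {1}XE; lmod R 'rV[R]_n.
pose b s t := (1 - clamp t) *: G 0%N s + clamp t *: y.
pose b' s t := (1 - clamp t) *: G 1%N s + 0.
have fG' k := family_deriv_sub dr (fG k).
have fc : @family_deriv R R^o d (fun _ t => 1 - clamp t) (fun _ _ => 0).
  apply: (@family_deriv_cst R R^o d _ 1) => t.
    by apply: (@cvgB _ R^o); [exact: cvg_cst|exact: continuous_clamp].
  by have /andP[? ?] := clamp_itv t; rewrite ger0_norm; lra.
have fy : family_deriv d (fun _ t : R => clamp t *: y) (fun _ _ => 0).
  exact: family_deriv_cst (@continuous_clampZ _ _ y) (@norm_clampZ _ _ y).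
have fb : family_deriv d b b'.
  have := family_derivD (family_deriv_scale fc (fG' 0%N)) fy.
  by apply: eq_family_deriv => s t _ //; rewrite scale0r add0r.
have Xeq s t : `|s| < d -> X s t = b s t + eps *: boundary_op (fun r =>
  gradV (X s r)) t.
  move=> sd; have [_ _ yE [_ _ _ XE] _] := Hp s sd.
  rewrite {1}/X XE -/(X s) -/(A s) (AE s sd) /b boundary_opE.
  by lmod R 'rV[R]_n.
have e0 := ltW eps0; have e02 : 0 <= eps * 2 by rewrite mulr_ge0.
have el := epsL; have eL : eps * 2 * L <= 1 / 2 by lra.
have Tb := scaled_operator e0 (@boundary_op_operator R n).
have Ti := scaled_operator e0 (@initial_op_operator R n).
have [X' fX X'E] := gradV_family_deriv phiC11 L0 e02 eL Tb estL bX XB fb Xeq.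
have X0P : integral_path x a (X 0).
  have [_ _ _ + ] := Hp 0 z0; rewrite G0 subrr normr0 mulr0 normr_le0 subr_eq0.
  by move=> + /eqP aE; rewrite aE.
have [_ bX' _] := fX.
have [C HC] := bX'; have [cJ CJ] := HC 0 z0.
exists (X 0), (X' 0); split=> //.
- by exists C.
- by move=> t; rewrite X'E// /b' G1 addr0.
(* At time 1 this is [- A s]. Keeping [t] free makes it a family of paths, which can be
   differentiated through [initial_op]. *)
pose q s t := - y + G 0%N s + eps *: initial_op (fun r => gradV (X s r)) t.
pose q' s t := 0 + G 1%N s + eps *: initial_op (fun r =>
  X' s r *m hessV (X s r)) t.
have fq : family_deriv d q q'.
  have fcy : family_deriv d (fun _ _ : R => - y) (fun _ _ => 0).
    by apply: (@family_deriv_cst _ _ _ _ `|y|) => t;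
      [exact: cst_continuous|rewrite normrN].
  have e10 : 0 <= eps * 1 by rewrite mulr1.
  have fg := family_deriv_gradV phiC11 XB fX.
  exact: family_derivD (family_derivD fcy (fG' 0%N)) (family_deriv_operator e10
    Ti fg).
have Aq s : `|s| < d -> A s = - q s 1.
  by move=> sd; rewrite AE// /q; lmod R 'rV[R]_n.
have dc (s : R) : `|s| < d -> is_derive s 1
    (fun t => cost (lagrangian V eps) (G 0%N t) y) (dot (q s 1) (G 1%N s)).
  move=> sd; have [Wb PE _ _ _] := Hp s sd.
  have [C1 [r2 [r20]]] := cost_gradient phiC11 VE M0 BM L0 estL eps0 eps1 epsL
    Wopen Wreg WM VK Wb.
  rewrite PE => H.
  have dG := family_deriv_is_derive 0 (fG' 0%N) sd.
  have := @quadratic_is_derive R n (fun z => cost (lagrangian V eps) z y)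
    (G 0%N s) (A s) C1 r2 r20 H (G 0%N) s (G 1%N s) (erefl _) dG.
  by rewrite Aq// dotNl opprK.
pose F (t : R) : R^o := cost (lagrangian V eps) (G 0%N t) y.
have dF : is_derive (0 : R) 1 (derive1 F : R -> R^o)
    (dot (q' 0 1) (G 1%N 0) + dot (q 0 1) (G 2%N 0)).
  have := family_deriv_is_derive 1 (family_deriv_dot fq (fG' 1%N)) z0.
  apply: near_eq_is_derive; apply/nbhs_ballP; exists d => //= s.
  rewrite /ball/= sub0r normrN => sd.
  by have ds := dc s sd; rewrite derive1E derive_val.
rewrite derive1nS derive1n1 derive1E (derive_val (is_derive := dF)).
have aE : A 0 = a.
  by have [_ _ _ _] := Hp 0 z0; rewrite G0 subrr normr0 mulr0 normr_le0
    subr_eq0 => /eqP.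
have -> : q 0 1 = - a by rewrite -aE Aq// opprK.
by rewrite dotNl /q' G1 add0r dotDl dotZl.
Qed.

End second_derivative.

Section second_derivatives.
Context {R : realType}.

(** The explicit formula [q] is available only near 0, where the covector stays in [W]; the second
    derivative at 0 sees no more. *)
Lemma derive1n2E (Q q q' : R -> R) (d q'' : R) : 0 < d ->
  (forall s : R, `|s| < d -> Q s = q s) ->
  (forall s : R, `|s| < d -> is_derive s 1 (q : R -> R^o) (q' s)) ->
  is_derive (0 : R) 1 (q' : R -> R^o) q'' ->
  derive1n 2 (Q : R -> R^o) 0 = q''.
Proof.
move=> d0 Qq dq dq'.
have near_lt (s : R) : `|s| < d -> \forall r \near s, `|r| < d.
  move=> sd; apply/nbhs_ballP; exists (d - `|s|); first by rewrite /= subr_gt0.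
  move=> r; rewrite /ball/= => sr.
  have -> : r = s - (s - r) by rewrite opprB addrC subrK.
  by rewrite (le_lt_trans (ler_normB _ _))//; lra.
have dQ (s : R) : `|s| < d -> derive1 (Q : R -> R^o) s = q' s.
  move=> sd; rewrite derive1E.
  have H : is_derive s 1 (Q : R -> R^o) (q' s).
    apply: near_eq_is_derive (dq s sd).
    by apply: filterS (near_lt s sd) => r rd; rewrite Qq.
  exact: derive_val.
rewrite derive1nS derive1n1 derive1E.
have H : is_derive (0 : R) 1 (derive1 (Q : R -> R^o) : R -> R^o) q''.
  apply: near_eq_is_derive dq'.
  have z0 : `|0 : R| < d by rewrite normr0.
  by apply: filterS (near_lt 0 z0) => r rd; rewrite dQ.
exact: derive_val.
Qed.

Lemma is_derive_affine (f : R -> R) (s f' c e p q : R) :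
  is_derive s 1 (f : R -> R^o) f' ->
  is_derive s 1 (fun r : R => c + e * f r - (p + r * q) : R^o) (e * f' - q).
Proof.
move=> /is_derive_eps H; apply/is_derive_eps => k k0.
have e1 : 0 < `|e| + 1 by rewrite ltr_wpDl.
have [r r0 Hr] := H _ (divr_gt0 k0 e1); exists r => // h hr.
rewrite (_ : _ - _ - _ = e * (f (s + h) - f s - h *: (f' : R^o))); last first.
  by rewrite /GRing.scale/=; ring.
rewrite normrM; apply: (le_trans (ler_wpM2l (normr_ge0 e) (Hr h hr))).
rewrite mulrA ler_wpM2r// mulrCA ler_piMr ?(ltW k0)//.
by rewrite ler_pdivrMr// mul1r lerDl.
Qed.

Lemma is_derive_scale_sub (f : R -> R) (s f' e p : R) :
  is_derive s 1 (f : R -> R^o) f' ->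
  is_derive s 1 (fun r : R => e * f r - p : R^o) (e * f').
Proof.
move=> /(@is_derive_affine f s f' 0 e p 0); rewrite subr0.
rewrite (_ : (fun r => _) = fun r => e * f r - p)//.
by apply/funext => r; rewrite add0r mulr0 addr0.
Qed.

End second_derivatives.

(** * Lower bound for the cross-curvature *)

Section curvature.
Context {R : realType} {n : nat}.
Variables (phi : nat -> R -> R) (V : 'rV[R]_n -> R).
Hypothesis phiC11 : forall (Q : R) k, C11_on 0 Q (phi k) (phi k.+1).
Hypothesis VE : forall x, V x = phi 0%N (half_sq x).
Local Notation E := 'rV[R]_n.
Local Notation hessV := (@hessV R n phi).
Variables (M B L : R).
Hypotheses (M0 : 0 <= M) (BM : 2 * M + 1 <= B) (L0 : 0 <= L).
Hypothesis estL : radial_estimate (n := n) phi B L.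
Hypothesis VK : exists K, forall x, V x <= K.

(** [K] precedes [eps], [W] and all arguments of the curvature, so one threshold on [eps] makes the
    bracket positive for all of them at once. *)
Lemma cross_curvature_ge : exists2 K : R, 0 <= K &
  forall (eps C : R) (W : set (E * E)) (x a u a1 : E) (g : R -> E),
  0 < eps -> eps <= 1 -> eps * L <= 1 / 4 ->
  open W -> (forall z, W z -> regular V eps z) ->
  (forall z, W z -> `|z.1| <= M /\ `|z.2| <= M) ->
  W (x, a) -> curve_at x u g -> dot a1 u = 0 ->
  (forall t : R, 0 <= t <= 1 -> [/\ C <= phi 2%N (half_sq (x + t *: a)),
    0 <= phi 3%N (half_sq (x + t *: a)) &
    0 <= phi 4%N (half_sq (x + t *: a))]) ->
  3 / 2 * (eps * ((C / 30 - K * eps) * (dot a1 a1 * dot u u))) <=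
  cross_curvature (cost (lagrangian V eps)) (Kset V eps W) x g a a1.
Proof.
have m0 := M0; have bm := BM; have B0 : 0 <= B by lra.
have [K K0 HK] := second_variation phiC11 B0 L0 estL.
exists K => // eps C W x a u a1 g eps0 eps1 epsL Wo Wreg WM Wxa.
move=> [[d0 d00 sg] g0 dg] a1u phiP.
have e0 := ltW eps0; have eL2 : eps * 2 * L <= 1 / 2 by lra.
have [r [G [r0 G0 fG]]] := smooth_curve_family d00 sg.
have G1 : G 1%N 0 = u.
  have z0 : `|0 : R| < r by rewrite normr0.
  by have := family_deriv_is_derive 0 (fG 0%N) z0; rewrite G0 =>
    /is_derive_unique; exact.
have [d d1 dW] : exists2 d : R, 0 < d & forall s : R, `|s| < d -> W (x,
  a + s *: a1).
  have /nbhs_ballP[q /= q0 Hq] : nbhs (x, a) W by exact: Wo.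
  have a10 : 0 < `|a1| + 1 by rewrite ltr_wpDl.
  exists (q / (`|a1| + 1)); first exact: divr_gt0.
  move=> s; rewrite ltr_pdivlMr// => sd; apply: Hq; split;
    rewrite /= -ball_normE /=.
    by rewrite subrr normr0.
  rewrite opprD addrA subrr sub0r normrN normrZ (le_lt_trans _ sd)//.
  by rewrite ler_wpM2l// lerDl.
have G0x : G 0%N 0 = x by rewrite G0.
have : forall s : R, exists p : (R -> E) * (R -> E), `|s| < d ->
    [/\ integral_path phi B eps x (a + s *: a1) p.1, continuous p.2,
      exists C : R, forall t, `|p.2 t| <= C,
      forall t, p.2 t = (1 - clamp t) *: u +
        eps *: boundary_op (fun r => p.2 r *m hessV (p.1 r)) t &
      derive1n 2 (fun t => cost (lagrangian V eps) (g t)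
          (Phi V eps 1 x (a + s *: a1))) 0 =
        dot u u + eps * dot (initial_op (fun r => p.2 r *m hessV (p.1 r)) 1) u
        - dot (a + s *: a1) (G 2%N 0)].
  move=> s; have [sd|] := boolP (`|s| < d); last by exists (fun=> 0, fun=> 0).
  have [X [J]] := cost_curve_derive2 phiC11 VE M0 BM L0 estL eps0 eps1 epsL Wo
    Wreg WM VK (dW s sd) r0 fG G0x G1.
  by rewrite G0 => H; exists (X, J).
move=> /choice[p Hp].
pose X s := (p s).1; pose J s := (p s).2.
have [F' [F'' [fF fF' FE]]] : exists F' F'' : R -> R -> E,
  [/\ family_deriv d (fun s t => J s t *m hessV (X s t)) F',
      family_deriv d F' F'' &
      forall t : R, `|dot (F'' 0 t) u -
        (1 - clamp t) *
        dot (u *m ddhessV phi (x + clamp t *: a) (clamp t *: a1) 0) u| <=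
        K * (eps * ((`|u| * `|u|) * (`|a1| * `|a1|)))].
  apply: (HK eps d x a a1 u X J) => //.
  - by move=> s sd; have [[h _ _ _] _ _ _ _] := Hp s sd; exact: h.
  - by move=> s t /Hp[[_ _ h _] _ _ _ _]; exact: h.
  - move=> t; have [/= xM aM] := WM _ Wxa; apply: (le_trans (ler_normD _ _)).
    by have := @norm_clampZ _ _ a t; lra.
  - by move=> s t /Hp[[_ _ _ h] _ _ _ _]; exact: h.
  - by move=> s sd; have [_ h _ _ _] := Hp s sd; exact: h.
  - by move=> s sd; have [_ _ h _ _] := Hp s sd; exact: h.
  - by move=> s t sd; have [_ _ _ h _] := Hp s sd; exact: h.
have Ti := @initial_op_operator R n.
have fT := family_deriv_operator ler01 Ti fF.
have fT' := family_deriv_operator ler01 Ti fF'.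
have z0 : `|0 : R| < d by rewrite normr0.
have CE : cross_curvature (cost (lagrangian V eps)) (Kset V eps W) x g a a1 =
    - (3 / 2) * (eps * dot (initial_op (F'' 0) 1) u).
  rewrite /cross_curvature; congr (_ * _).
  apply: (@derive1n2E _ _
    (fun s => dot u u + eps * dot (initial_op (fun r =>
      J s r *m hessV (X s r)) 1) u
       - (dot a (G 2%N 0) + s * dot a1 (G 2%N 0)))
    (fun s => eps * dot (initial_op (F' s) 1) u - dot a1 (G 2%N 0)) d) => //.
  - move=> s sd; have [_ _ _ _ HE] := Hp s sd.
    rewrite -/(J s) -/(X s) in HE; rewrite -(dotZl s) -dotDl -HE.
    by rewrite (cexp_Phi phiC11 VE M0 BM L0 estL eps0 eps1 epsL Wo Wreg WM VK
      (dW s sd)).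
  - move=> s sd; apply: is_derive_affine; apply: is_derive_dot.
    exact: (family_deriv_is_derive 1 fT sd).
  - apply: is_derive_scale_sub; apply: is_derive_dot.
    exact: (family_deriv_is_derive 1 fT' z0).
have [_ [CF HF] _] := fF'; have [cF _] := HF 0 z0.
(* [initial_op] is minus a double integral, which cancels the sign in the definition of the
   cross-curvature. *)
rewrite CE dot_initial_op// mulrN mulrNN ler_pM2l; last by lra.
rewrite ler_pM2l//.
set D := dot a1 a1 * dot u u.
have D0 : 0 <= D by rewrite mulr_ge0// dot_ge0.
rewrite (_ : _ * D = (C * D) / 30 - K * (eps * D)); last by field.
apply: I_I_ge.
- exact: mulr_ge0 K0 (mulr_ge0 e0 D0).
- exact: (continuous_bilinear (@dot_bounded_bilinear R n) cF (@cst_continuous _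
  _ u)).
move=> t t01; have := FE t; rewrite (clamp_id t01).
have [p2 p3 p4] := phiP t t01.
have := dot_ddhessV_ge (phi := phi) t a1u p2 p3 p4.
rewrite -/D => H1 H2; have /andP[t0 t1] := t01.
(* The error in sup norms is passed to Euclidean ones, so that it can be compared with the main
   term. *)
have H3 : K * (eps * (`|u| * `|u| * (`|a1| * `|a1|))) <= K * (eps * D).
  rewrite ler_wpM2l// ler_wpM2l// /D mulrC -!expr2.
  by rewrite ler_pM ?sqr_ge0// sqr_norm_le_dot.
have H4 : (1 - t) * (C * t ^+ 2 * D) <= (1 - t) *
    dot (u *m ddhessV phi (x + t *: a) (t *: a1) 0) u.
  by rewrite ler_wpM2l//; lra.
move: H2; rewrite ler_norml => /andP[H2 _].
have -> : C * D * ((1 - t) * t ^+ 2) = (1 - t) * (C * t ^+ 2 * D) by ring.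
by lra.
Qed.

End curvature.

Unset Implicit Arguments.
Set Strict Implicit.
Set Printing Implicit Defensive.

Theorem theorem6p1 (R : realType) (n : nat) (f : R -> R)
    (Ueps : R -> set ('rV[R]_n * 'rV[R]_n)) (U : set ('rV[R]_n * 'rV[R]_n))
    (V := @radial_potential R n f) :
  smooth_on `[0, +oo[ f ->
  (exists M : R, forall x : 'rV[R]_n, V x <= M) ->
  (forall eps : R, 0 < eps ->
     [/\ open (Ueps eps),
         forall z, Ueps eps z -> regular V eps z &
         forall z, Ueps eps z -> ~ conjugate_locus V eps z]) ->
  open U ->
  bounded_set U ->
  (exists2 C : R, 0 < C &
     forall (t : R) (x v : 'rV[R]_n), 0 <= t <= 1 -> U (x, v) ->
       let r := dot (x + t *: v) (x + t *: v) / 2 in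
       [/\ C <= hderiv 2 f r, 0 <= hderiv 3 f r & 0 <= hderiv 4 f r]) ->
  exists2 eps0 : R, 0 < eps0 &
    forall eps : R, 0 < eps < eps0 ->
      let W := Ueps eps `&` U in
      A3s (cost (lagrangian V eps)) W (Kset V eps W).
Proof.
move=> sf Vb Uok Uo Ub [C C0 HC].
pose phi k := hderiv k f.
have VE (x : 'rV[R]_n) : V x = phi 0%N (half_sq x) by [].
have phiC11 (Q : R) k : C11_on 0 Q (phi k) (phi k.+1).
  (* Derivatives relative to the half line restrict to the compact interval [[0, Q]], one-sided at
     0. *)
  have D j x : 0 <= x <= Q ->
      has_dwithin (W := R^o) `[0, Q] (phi j) x (phi j.+1 x).
    move=> /andP[x0 xQ]; apply: (@has_dwithin_sub _ _ `[0, +oo[).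
      by move=> y; rewrite /= !in_itv/= andbT => /andP[].
    by apply: smooth_on_dwithin => //; rewrite /= in_itv/= andbT.
  exact: dwithin_C11 (D k) (D k.+1) (D k.+2).
have [M M0 UM] : exists2 M : R, 0 <= M & forall z, U z -> `|z| <= M.
  have [M [_ HM]] := Ub; exists (`|M| + 1); first by rewrite addr_ge0.
  by move=> z Uz; apply: HM => //; rewrite (le_lt_trans (ler_norm M))// ltrDl.
pose B := 2 * M + 1; have B0 : 0 <= B by rewrite addr_ge0// mulr_ge0.
have [L L0 estL] := @ex_radial_estimate R n _ phiC11 _ B0.
have [K K0 HK] := cross_curvature_ge phiC11 VE M0 (lexx B) L0 estL Vb.
have L1 : 0 < 4 * (L + 1) by rewrite mulr_gt0// ltr_wpDl.
have K1 : 0 < 60 * (K + 1) by rewrite mulr_gt0// ltr_wpDl.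
(* The second entry gives [eps * L <= 1 / 4], and the third gives [K * eps < C / 60], so at least
   half of the main term [C / 30] is left. Adding 1 keeps the denominators positive. *)
exists (Num.min 1 (Num.min (1 / (4 * (L + 1))) (C / (60 * (K + 1))))).
  by rewrite !lt_min ltr01 !divr_gt0.
move=> eps /andP[eps0]; rewrite !lt_min !ltr_pdivlMr// =>
  /and3P[eps1 epsL epsK].
move=> W x a u a1 g Wxa gx a1u.
have [Uo' reg _] := Uok eps eps0.
have [Uexa Uxa] := Wxa.
set c := cost _; set cc := cross_curvature _ _ _ _ _ _.
have ge : 3 / 2 * (eps * ((C / 30 - K * eps) * (dot a1 a1 * dot u u))) <= cc.
  apply: (HK eps C W x a u a1 g eps0) => //.
  - exact: ltW.
  - by have := mulr_ge0 (ltW eps0) L0; lra.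
  - exact: openI.
  - by move=> z [/reg].
  - move=> z [_ /UM zM]; split; apply: le_trans zM.
      exact: norm_fst_le.
    exact: norm_snd_le.
  - by move=> t t01; rewrite /phi /half_sq; exact: HC t x a t01 Uxa.
have k0 : 0 < C / 30 - K * eps.
  by have := mulr_ge0 (ltW eps0) K0; lra.
have D0 : 0 <= dot a1 a1 * dot u u by rewrite mulr_ge0// dot_ge0.
have pos : 0 < 3 / 2 * (eps * (C / 30 - K * eps)) by rewrite !mulr_gt0.
have {}ge : 3 / 2 * (eps * (C / 30 - K * eps)) * (dot a1 a1 * dot u u) <= cc.
  by apply: le_trans ge; rewrite le_eqVlt; apply/orP; left; apply/eqP; ring.
split; first exact: le_trans (mulr_ge0 (ltW pos) D0) ge.
(* If the curvature vanishes, a positive multiple of [dot a1 a1 * dot u u] is at most 0, so one of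
   the two factors is zero. *)
move=> cc0; rewrite /= cc0 in ge.
have dot0 (v : 'rV[R]_n) : dot v v = 0 -> v = 0.
  move=> v0; have := sqr_norm_le_dot v; rewrite v0 => v2.
  apply/eqP; rewrite -normr_le0 -(@ler_pXn2r _ 2)// ?nnegrE// expr0n//=.
have : dot a1 a1 * dot u u == 0.
  by rewrite eq_le D0 andbT -(pmulr_rle0 _ pos).
by rewrite mulf_eq0 => /orP[] /eqP /dot0; [right|left].
Qed.
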